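(* Let $n\ge3$ and $1\le q<n-1$. Then there exist $p>q$ and a Sobolev $(p,q)$-extension domain $\Omega\subset\mathbb R^n$ with $|\partial\Omega|>0$.
   Context: $|\cdot|$ denotes $n$-dimensional Lebesgue measure. $W^{1,p}(\Omega)$ is the Sobolev space with norm $\|u\|_{W^{1,p}(\Omega)}=\|u\|_{L^p(\Omega)}+\|\nabla u\|_{L^p(\Omega)}$. For $1\le q\le p<\infty$, a bounded domain $\Omega\subset\mathbb R^n$ is a Sobolev $(p,q)$-extension domain if there is a bounded (not necessarily linear) operator $E:W^{1,p}(\Omega)\to W^{1,q}(\mathbb R^n)$ with $E(u)|_\Omega\equiv u$ for every $u\in W^{1,p}(\Omega)$ and $\|E\|:=\sup_{u\ne0}\|E(u)\|_{W^{1,q}(\mathbb R^n)}/\|u\|_{W^{1,p}(\Omega)}<\infty$. *)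

(* Defs.v *)
From HB Require Import structures.
From mathcomp Require Import all_boot all_order all_algebra.
From mathcomp Require Import all_classical all_reals all_analysis.
From mathcomp Require Import measurable_realfun.

Set Implicit Arguments.
Unset Strict Implicit.
Unset Printing Implicit Defensive.

Import Order.TTheory GRing.Theory Num.Theory.
Import numFieldNormedType.Exports.

Local Open Scope classical_set_scope.
Local Open Scope ring_scope.

Fact rV_borel_display : measure_display. Proof. exact: default_measure_display. Qed.

Section rV_borel.
Context (R : realType) (n : nat).

Definition rV_borel : set (set 'rV[R]_n) := <<s [set A | open A] >>.

Let rV_borel0 : rV_borel set0.
Proof. exact: sigma_algebra0. Qed.

Let rV_borelC A : rV_borel A -> rV_borel (~` A).
Proof. exact: sigma_algebraC. Qed.

Let rV_borel_bigcup (F : (set 'rV[R]_n)^nat) : (forall i, rV_borel (F i)) ->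
  rV_borel (\bigcup_i F i).
Proof. exact: sigma_algebra_bigcup. Qed.

HB.instance Definition _ := @isMeasurable.Build rV_borel_display
  'rV[R]_n rV_borel rV_borel0 rV_borelC rV_borel_bigcup.

Lemma measurable_rVE :
  @measurable rV_borel_display 'rV[R]_n = <<s [set A | open A] >>.
Proof. by []. Qed.

Lemma open_measurable_rV (A : set 'rV[R]_n) : open A -> measurable A.
Proof. by move=> oA; apply: sub_sigma_algebra. Qed.

Lemma measurable_coord (i : 'I_n) :
  measurable_fun [set: 'rV[R]_n] (fun v : 'rV[R]_n => v ord0 i).
Proof.
apply: (measurability _ (RGenOpens.measurableE R)).
move=> _ [_ [a [b ->]] <-]; rewrite setTI; apply: open_measurable_rV.
move/continuousP : (@coord_continuous R 1 n ord0 i) => /(_ `]a, b[%classic).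
by apply; exact: interval_open.
Qed.

Lemma measurable_fun_rV d (T : measurableType d) (f : T -> 'rV[R]_n) :
  (forall i, measurable_fun [set: T] (fun x => f x ord0 i)) ->
  measurable_fun [set: T] f.
Proof.
move=> mf; pose box (c : 'rV[rat]_n) (k : nat) :=
  [set v : 'rV[R]_n | forall i, `|v ord0 i - ratr (c ord0 i)| < k.+1%:R^-1].
have mbox c k : measurable (f @^-1` box c k).
  have -> : f @^-1` box c k = \bigcap_(i : 'I_n) ((fun x => f x ord0 i) @^-1`
        `]ratr (c ord0 i) - k.+1%:R^-1, ratr (c ord0 i) + k.+1%:R^-1[).
    rewrite predeqE => x; split=> [fx i _|fx i].
      by rewrite /= in_itv/= -ltr_distl.
    by have /= := fx i I; rewrite in_itv/= -ltr_distl.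
  apply: fin_bigcap_measurable => // i _; rewrite -[X in measurable X]setTI.
  exact: mf.
apply: (measurability _ measurable_rVE).
move=> _ [U oU <-]; rewrite setTI.
have -> : U = \bigcup_(ck : 'rV[rat]_n * nat)
    (if `[< box ck.1 ck.2 `<=` U >] then box ck.1 ck.2 else set0).
  rewrite predeqE => v; split=> [Uv|[ck _]]; last first.
    by case: asboolP => // sub; exact: sub.
  have /nbhs_ballP[e /= e0 veU] : nbhs v U by exact: open_nbhs_nbhs.
  have [k ke] : exists k : nat, k.+1%:R^-1 < e / 2.
    have e20 : 0 < (e / 2)^-1 by rewrite invr_gt0 divr_gt0.
    exists (Num.truncn (e / 2)^-1).
    by rewrite -[ltRHS]invrK ltf_pV2 ?posrE// truncnS_gt.
  have k0 : 0 < k.+1%:R^-1 :> R by rewrite invr_gt0.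
  have c_ i : {c : rat | `|v ord0 i - ratr c| < k.+1%:R^-1}.
    apply: cid.
    have /rat_in_itvoo[c] : v ord0 i - k.+1%:R^-1 < v ord0 i + k.+1%:R^-1
      by rewrite ltrD2l gtrN.
    rewrite in_itv/= => /andP[c1 c2]; exists c.
    by rewrite ltr_distl ltrBlDr c2/= -ltrBlDr.
  exists (\row_i sval (c_ i), k) => //=.
  rewrite ifT; first by move=> i; rewrite mxE; case: (c_ i).
  apply/asboolP => w wb; apply: veU; split => // i j; rewrite (ord1 i).
  have := wb j; rewrite mxE; case: (c_ j) => c /= vc wc.
  rewrite -ball_normE /ball_/= [e]splitr (le_lt_trans (ler_distD (ratr c) _ _))// ltrD//.
    exact: lt_trans vc _.
  by rewrite distrC; exact: lt_trans wc _.
rewrite preimage_bigcup; apply: countable_bigcupT_measurable => // ck.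
by case: ifPn => _; [exact: mbox|rewrite preimage_set0].
Qed.

End rV_borel.


Lemma product_sigma_finite d1 d2 (T1 : measurableType d1)
    (T2 : measurableType d2) (R : realType)
    (m1 : {sigma_finite_measure set T1 -> \bar R})
    (m2 : {sigma_finite_measure set T2 -> \bar R}) :
  sigma_finite setT (m1 \x m2)%E.
Proof.
have /sigma_finiteP[F [TF ndF Foo]] := sigma_finiteT m1.
have /sigma_finiteP[G [TG ndG Goo]] := sigma_finiteT m2.
exists (fun n => F n `*` G n).
  rewrite -setXTT TF TG predeqE => -[x y]; split.
    move=> [/= [n _ Fnx] [k _ Gky]]; exists (maxn n k) => //; split.
    - by move: x Fnx; exact/subsetPset/ndF/leq_maxl.
    - by move: y Gky; exact/subsetPset/ndG/leq_maxr.
  by move=> [n _ []/= ? ?]; split; exists n.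
move=> k; have [mF Fk] := Foo k; have [mG Gk] := Goo k.
split; first exact: measurableX.
by rewrite product_measure1E// lte_mul_pinfty// ge0_fin_numE.
Qed.

Section rV_lebesgue.
Context (R : realType).

Definition rV_cons n (z : measurableTypeR R * 'rV[R]_n) : 'rV[R]_n.+1 :=
  \row_i if unlift ord0 i is Some j then z.2 ord0 j else z.1.

Definition rV_uncons n (v : 'rV[R]_n.+1) : measurableTypeR R * 'rV[R]_n :=
  (v ord0 ord0, \row_i v ord0 (lift ord0 i)).

Lemma rV_cons0 n (z : measurableTypeR R * 'rV[R]_n) :
  rV_cons z ord0 ord0 = z.1.
Proof. by rewrite mxE unlift_none. Qed.

Lemma rV_consS n (z : measurableTypeR R * 'rV[R]_n) i :
  rV_cons z ord0 (lift ord0 i) = z.2 ord0 i.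
Proof. by rewrite mxE liftK. Qed.

Lemma rV_consK n : cancel (@rV_cons n) (@rV_uncons n).
Proof.
move=> z; rewrite /rV_uncons rV_cons0 [RHS]surjective_pairing; congr pair.
by apply/rowP => i; rewrite mxE rV_consS.
Qed.

Lemma measurable_rV_cons n : measurable_fun [set: _] (@rV_cons n).
Proof.
apply: measurable_fun_rV => i; case: (unliftP ord0 i) => [j|] ->.
  under eq_fun do rewrite rV_consS.
  exact: measurableT_comp (measurable_coord j) _.
under eq_fun do rewrite rV_cons0.
exact: measurable_fst.
Qed.

Lemma measurable_rV_uncons n : measurable_fun [set: _] (@rV_uncons n).
Proof.
apply/measurable_fun_pair; first exact: measurable_coord.
apply: measurable_fun_rV => i; under eq_fun do rewrite mxE.
exact: measurable_coord.
Qed.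

Section step.
Context n (mu : {sigma_finite_measure set 'rV[R]_n -> \bar R}).

Definition rV_lebesgue_cons : set 'rV[R]_n.+1 -> \bar R :=
  pushforward (lebesgue_measure \x mu)%E (@rV_cons n).

HB.instance Definition _ := Measure.copy rV_lebesgue_cons
  (measure_function.measure_function_pushforward__canonical__measure_function_Measure (lebesgue_measure \x mu)%E (@measurable_rV_cons n)).

Let rV_lebesgue_cons_sigma_finite : sigma_finite setT rV_lebesgue_cons.
Proof.
have [F FT Foo] := product_sigma_finite (@lebesgue_measure R) mu.
exists (fun i => @rV_uncons n @^-1` F i); first by rewrite -preimage_bigcup -FT.
move=> i; have [mF Fioo] := Foo i; split.
  by rewrite -[X in measurable X]setTI; exact: measurable_rV_uncons.
rewrite /rV_lebesgue_cons /pushforward -comp_preimage.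
by have -> : @rV_uncons n \o @rV_cons n = id by apply/funext/rV_consK.
Qed.

HB.instance Definition _ := @Measure_isSigmaFinite.Build _ _ _
  rV_lebesgue_cons rV_lebesgue_cons_sigma_finite.

End step.

Fixpoint rV_lebesgue n : {sigma_finite_measure set 'rV[R]_n -> \bar R} :=
  if n is n'.+1 then rV_lebesgue_cons (rV_lebesgue n') else \d_(0 : 'rV[R]_0).

Lemma rV_lebesgue_box n (a b : 'rV[R]_n) : (forall i, a ord0 i <= b ord0 i) ->
  rV_lebesgue n [set v | forall i, v ord0 i \in `[a ord0 i, b ord0 i]] =
  (\prod_(i < n) (b ord0 i - a ord0 i))%:E.
Proof.
elim: n a b => [|n IH] a b ab.
  by rewrite big_ord0/= diracE mem_set//= => -[].
pose a' := (rV_uncons a).2; pose b' := (rV_uncons b).2.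
pose B' := [set v : 'rV[R]_n | forall i, v ord0 i \in `[a' ord0 i, b' ord0 i]].
have mB' : measurable B'.
  have -> : B' = \bigcap_(i : 'I_n) ((fun v : 'rV[R]_n => v ord0 i) @^-1`
      `[a' ord0 i, b' ord0 i]).
    by rewrite predeqE => v; split=> [vB i _|vB i]; exact: (vB i).
  apply: fin_bigcap_measurable => // i _; rewrite -[X in measurable X]setTI.
  exact: measurable_coord.
rewrite /= /rV_lebesgue_cons /pushforward.
rewrite [X in product_measure1 _ _ X](_ : _ =
    `[a ord0 ord0, b ord0 ord0]%classic `*` B'); last first.
  rewrite predeqE => -[x v]; split=> /= [xv|[x0 vB] i].
    split; first by have := xv ord0; rewrite rV_cons0.
    by move=> i; have := xv (lift ord0 i); rewrite rV_consS !mxE.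
  case: (unliftP ord0 i) => [j|] ->; last by rewrite rV_cons0.
  by rewrite rV_consS; have := vB j; rewrite !mxE.
rewrite product_measure1E// IH; last by move=> i; rewrite !mxE.
rewrite [X in (X * _)%E](lebesgue_measure_itv `[a ord0 ord0, b ord0 ord0])/=.
rewrite lte_fin big_ord_recl.
under eq_bigr do rewrite !mxE.
have := ab ord0; rewrite le_eqVlt => /predU1P[->|->]; last by rewrite EFinM EFinB.
by rewrite ltxx subrr mul0r mul0e.
Qed.

End rV_lebesgue.

Section sobolev.
Context (R : realType) (n : nat).
Local Notation mu := (rV_lebesgue R n).
Implicit Types (D : set 'rV[R]_n) (f u phi : 'rV[R]_n -> R)
  (g : 'rV[R]_n -> 'rV[R]_n) (p q : R).

Definition partial (i : 'I_n) f : 'rV[R]_n -> R := 'D_(delta_mx ord0 i) f.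

Fixpoint Ck (k : nat) f : Prop := continuous f /\
  if k is k'.+1 then forall i : 'I_n,
    (forall x, derivable f x (delta_mx ord0 i)) /\ Ck k' (partial i f)
  else True.

Definition smooth f := forall k, Ck k f.

Definition support f : set 'rV[R]_n := closure [set x | f x != 0].

Definition test_function D phi :=
  [/\ smooth phi, compact (support phi) & support phi `<=` D].

(* The library's [locally_integrable] is restricted to functions on R. *)
Definition locally_integrable_on D f := measurable_fun D f /\
  forall K, compact K -> K `<=` D -> mu.-integrable K (EFin \o f).

(* [D] is meant to be open. The integrals are real-valued ([Rintegral]); both
   integrands are integrable because [phi] has compact support in [D]. *)
Definition weak_gradient D u g :=
  [/\ locally_integrable_on D u,
      forall i, locally_integrable_on D (fun x => g x ord0 i) &
      forall i phi, test_function D phi ->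
        \int[mu]_(x in D) (u x * partial i phi x) =
        - \int[mu]_(x in D) (g x ord0 i * phi x)].

(* The library's norm on ['rV[R]_n] is the sup norm; the size of a gradient is
   measured by the Euclidean one. *)
Definition enorm (v : 'rV[R]_n) : R := Num.sqrt (\sum_i v ord0 i ^+ 2).

Definition Lp_norm D p f : \bar R := 'N[mu]_(p%:E)[EFin \o (f \_ D)]%E.

Definition in_Lp D p f := measurable_fun D f /\ (Lp_norm D p f < +oo)%E.

(* Elements of L^p and W^{1,p} are represented by Borel functions; two functions
   are the same element when they agree almost everywhere on [D]. Values outside
   [D] are irrelevant. *)
Definition sobolev_space D p : set ('rV[R]_n -> R) := [set u | in_Lp D p u /\
  exists2 g, weak_gradient D u g & forall i, in_Lp D p (fun x => g x ord0 i)].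

(* A weak gradient is unique up to a.e. equality on [D], so the choice made here
   does not affect the norm below. *)
Definition grad D u : 'rV[R]_n -> 'rV[R]_n := xget (cst 0) (weak_gradient D u).

Definition sobolev_norm D p u : \bar R :=
  (Lp_norm D p u + Lp_norm D p (enorm \o grad D u))%E.

(* [E] acts on representatives; the second clause says that it is well defined
   on W^{1,p}(D). No linearity is required. *)
Definition extension_operator D p q (E : ('rV[R]_n -> R) -> 'rV[R]_n -> R) :=
  [/\ forall u, sobolev_space D p u -> sobolev_space setT q (E u),
      forall u v, sobolev_space D p u -> sobolev_space D p v ->
        u = v %[ae mu in D] -> E u = E v %[ae mu] &
      forall u, sobolev_space D p u -> E u = u %[ae mu in D]].

Definition operator_norm D p q (E : ('rV[R]_n -> R) -> 'rV[R]_n -> R) : \bar R :=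
  ereal_sup [set (sobolev_norm setT q (E u) / sobolev_norm D p u)%E |
    u in [set u | sobolev_space D p u /\ ~ (u = cst 0 %[ae mu in D])]].

Definition bounded_domain D :=
  [/\ open D, connected D, D !=set0 & bounded_set D].

Definition sobolev_extension_domain p q D :=
  [/\ 1 <= q <= p, bounded_domain D &
      exists2 E, extension_operator D p q E & (operator_norm D p q E < +oo)%E].

Definition boundary D := closure D `\` interior D.

End sobolev.

(* Main.v *)
Require Import Defs.
From mathcomp Require Import all_boot all_order all_algebra.
From mathcomp Require Import all_classical all_reals all_analysis.
From mathcomp Require Import measurable_realfun.
From mathcomp Require Import ring lra.

Set Implicit Arguments.
Unset Strict Implicit.
Unset Printing Implicit Defensive.
Import Order.TTheory GRing.Theory Num.Theory.
Import numFieldNormedType.Exports.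
Local Open Scope classical_set_scope.
Local Open Scope ring_scope.

(* The domain is a box, the base, with thin boxes (tentacles) of unit half-length
   attached along one axis. Their centres run through a dense set of the
   cross-section, their radii r_j are chosen greedily so that the doubled
   tentacles are disjoint, and the r_j are so small that the doubled tentacles
   fill only part of a slab beyond the base; the rest of the slab lies in the
   boundary of the domain.

   A function on a box is extended by reflecting it in the faces and cutting it
   off on the doubled box, which costs a factor r^-1 on a box of width r. Extend u
   in this way from the base to u~. On each tentacle the jump u - u~ is extended
   likewise to the doubled tentacle; it is zero on the part of the
   tentacle in the base, hence so is its extension on all slices of the doubled
   tentacle through that part, and adding all these jumps to u~ extends u. The q-th power of the
   cutoff loss, r^-q, is compensated by Hoelder's inequality from L^p to L^q on
   the tentacle, whose measure is of order r^(n-1) with q < n - 1, once p is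
   large; the radii then make the sum over the tentacles converge. *)

(** * Smooth cutoff functions *)

Section smooth1.
Context (R : realType).
Implicit Types (f g h : R -> R) (P : {poly R}) (x t z : R) (k : nat).

(** The jump is extended rather than [u] itself because the corrections on the tentacles must leave
    the function already extended unchanged in the base, into which every tentacle reaches. The
    doubled tentacles are disjoint, so corrections never overlap, and a point lies in the boundary
    only as a limit of infinitely many ever thinner tentacles. Hence all constants must be uniform
    over boxes, and the loss on a box may depend on its width alone. Neither traces nor
    approximation by smooth functions enter. Functions are integrable and extended by 0 outside
    their domain, and restriction, cutoff and reflection are moved onto the test function.
    Reflection is the delicate case: the folded test function does not vanish near the face. It is
    multiplied by cutoffs that approach the half-space, and the extra term dies because the folded
    function vanishes linearly on the face whenever the derivative is normal to it. Since the
    operator may be nonlinear, it suffices to extend one function at a time with a uniform constant;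
    the operator is then a choice made on classes modulo null sets. *)

Fixpoint Ck1 k h : Prop := if k is k'.+1 then
  exists2 h', (forall x, is_derive x 1 h (h' x)) & Ck1 k' h' else continuous h.

Lemma is_derive_continuous h h' : (forall x, is_derive x 1 h (h' x)) -> continuous h.
Proof.
move=> hh x; apply: differentiable_continuous; apply/derivable1_diffP.
by have [] := hh x.
Qed.

Lemma Ck1W k h : Ck1 k.+1 h -> Ck1 k h.
Proof.
elim: k h => [|k IH] h; first by case=> h' /is_derive_continuous.
by case=> h' hh Dh'; exists h' => //; exact: IH.
Qed.

Lemma Ck1D k f g : Ck1 k f -> Ck1 k g -> Ck1 k (f + g).
Proof.
elim: k f g => [|k IH] f g /=; first by move=> cf cg x; apply: cvgD; [exact: cf|exact: cg].
move=> [f' ff Df] [g' gg Dg]; exists (f' + g'); last exact: IH.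
by move=> x; exact: is_deriveD.
Qed.

Lemma Ck1M k f g : Ck1 k f -> Ck1 k g -> Ck1 k (f * g).
Proof.
elim: k f g => [|k IH] f g; first by move=> cf cg x; apply: cvgM; [exact: cf|exact: cg].
move=> Df Dg; have [f' ff Df'] := Df; have [g' gg Dg'] := Dg.
exists (f * g' + g * f'); first by move=> x; exact: is_deriveM.
by apply: Ck1D; apply: IH => //; exact: Ck1W.
Qed.

Lemma Ck1N k f : Ck1 k f -> Ck1 k (- f).
Proof.
elim: k f => [|k IH] f /=; first by move=> cf x; apply: cvgN; exact: cf.
by move=> [f' ff Df]; exists (- f'); [move=> x; exact: is_deriveN|exact: IH].
Qed.

Lemma Ck1V k f : (forall x, f x != 0) -> Ck1 k f -> Ck1 k (fun x => (f x)^-1).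
Proof.
move=> f0; elim: k => [|k IH]; first by move=> cf x; apply: cvgV; [exact: f0|exact: cf].
move=> Df; have [f' ff Df'] := Df.
exists (- ((fun x => (f x)^-1) * (fun x => (f x)^-1)) * f').
  move=> x; have := is_deriveV (f0 x) (ff x) => /is_derive_eq; apply.
  by rewrite /GRing.scale/= expr2 invfM.
by apply: Ck1M => //; apply: Ck1N; apply: Ck1M; apply: IH; exact: Ck1W.
Qed.

Lemma Ck1_cst k c : Ck1 k (cst c).
Proof.
elim: k c => [|k IH] c; first by move=> x; exact: cvg_cst.
by exists (cst 0); [move=> x; exact: is_derive_cst|exact: IH].
Qed.

Lemma Ck1_affine k f a b : Ck1 k f -> Ck1 k (fun x => f (a * x + b)).
Proof.
elim: k f => [|k IH] f /=.
  move=> cf x; apply: (@continuous_comp _ _ _ (fun x => a * x + b) f); last exact: cf.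
  apply: cvgD; last exact: cvg_cst.
  by apply: cvgM; [exact: cvg_cst|exact: cvg_id].
move=> [f' ff Df]; exists (cst a * (fun x => f' (a * x + b))).
  move=> x; have H : is_derive x 1 (fun x => a * x + b) a.
    by apply: is_derive_eq; rewrite /GRing.scale/= ?mulr1 ?addr0.
  have := @is_derive1_comp _ f (fun x => a * x + b) x _ _ (ff _) H.
  by move=> /is_derive_eq; apply; rewrite mulrC.
by apply: Ck1M; [exact: Ck1_cst|exact: IH].
Qed.

(* The functions [P(1/z) exp(-1/z)], extended by [0], are closed under
   differentiation: this is how [exp(-1/z)] is seen to be smooth. *)
Definition bump_poly P z : R := if 0 < z then P.[z^-1] * expR (- z^-1) else 0.

(** For [k] the size of [P] and [w = t^-1 >= 1] all monomials of [P] are at most [w ^+ k], while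
    [expR w] dominates [w ^+ k.+2]. The two spare powers of [t] make the derivative at the origin
    vanish. *)
Lemma bump_poly_flat P :
  exists2 C, 0 <= C & forall t, t < 1 -> `|bump_poly P t| <= C * t ^+ 2.
Proof.
pose k := size P; pose S := \sum_(i < k) `|P`_i|.
have S0 : 0 <= S by apply: sumr_ge0 => i _.
exists (S * (k.+2)`!%:R) => [|t t1]; first by rewrite mulr_ge0.
rewrite /bump_poly; case: ltP => t0; last first.
  by rewrite normr0 mulr_ge0// ?sqr_ge0// mulr_ge0.
set w := t^-1; have w1 : 1 <= w by rewrite invf_ge1// ltW.
have w0 : 0 < w by rewrite invr_gt0.
have Pw : `|P.[w]| <= S * w ^+ k.
  rewrite horner_coef (le_trans (ler_norm_sum _ _ _))// mulr_suml ler_sum// => i _.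
  rewrite normrM ler_wpM2l// normrX gtr0_norm// ler_weXn2l//.
  exact: ltnW (ltn_ord i).
have ew : expR (- w) <= (k.+2)`!%:R * w ^- k.+2.
  rewrite expRN -[leRHS]invrK lef_pV2 ?posrE ?expR_gt0//; last first.
    by rewrite invr_gt0 mulr_gt0// ?invr_gt0 ?exprn_gt0// ltr0n fact_gt0.
  rewrite invfM invrK mulrC; apply: le_trans (@expR_ge1Dxn _ w k.+1 (ltW w0)).
  by rewrite lerDr.
rewrite normrM (ger0_norm (expR_ge0 _)).
apply: (le_trans (ler_pM _ _ Pw ew)); rewrite ?expR_ge0//.
rewrite le_eqVlt; apply/orP; left; apply/eqP.
rewrite -addn2 exprD /w !exprVn; field.
by rewrite !expf_neq0// gt_eqF.
Qed.

(** With [w = z^-1] one has [w' = - w ^+ 2], and the product rule gives the polynomial on the right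
    for [z > 0]. At 0 flatness bounds the difference quotient by a multiple of [|h|]. *)
Lemma is_derive_bump_poly P x :
  is_derive x 1 (bump_poly P) (bump_poly ('X^2 * (P - P^`())) x).
Proof.
have [x0|x0|->] := ltgtP x 0.
- have -> : bump_poly ('X^2 * (P - P^`())) x = 0 by rewrite /bump_poly ltNge (ltW x0).
  apply: (@near_eq_is_derive _ _ _ (cst 0)).
  near=> y; rewrite /bump_poly; case: ifPn => // y0.
  have : y < 0 by near: y; exact: lt_nbhsl.
  by move=> /(lt_trans y0); rewrite ltxx.
- rewrite {2}/bump_poly x0.
  apply: (@near_eq_is_derive _ _ _ (fun z => P.[z^-1] * expR (- z^-1))).
    near=> y; rewrite /bump_poly ifT//.
    by near: y; exact: lt_nbhsr.
  have xn0 : x != 0 by rewrite gt_eqF.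
  have HV : is_derive x 1 (fun z => z^-1) (- x ^- 2).
    by have := is_deriveV xn0 (is_derive_id x 1) => /is_derive_eq; apply; rewrite /GRing.scale/= mulr1.
  have H1 : is_derive x 1 (fun z => P.[z^-1]) (P^`().[x^-1] * - x ^- 2).
    exact: (@is_derive1_comp _ (horner P)).
  have H2 : is_derive x 1 (fun z => expR (- z^-1)) (expR (- x^-1) * x ^- 2).
    apply: (@is_derive1_comp _ expR).
    by have := is_deriveN HV; rewrite opprK.
  have := is_deriveM H1 H2 => /is_derive_eq; apply.
  rewrite /GRing.scale/= hornerM hornerXn hornerD hornerN exprVn.
  by ring.
- have -> : bump_poly ('X^2 * (P - P^`())) 0 = 0 by rewrite /bump_poly ltxx.
  have [C C0 HC] := bump_poly_flat P.
  suff H : h^-1 *: ((bump_poly P \o shift 0) (h *: 1) - bump_poly P 0) @[h --> 0^'] --> (0 : R).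
    apply: DeriveDef; first by apply/cvg_ex; exists 0.
    exact: cvg_lim.
  apply/cvgrPdist_le => e e0.
  have Ce : 0 < e / (C + 1) by rewrite divr_gt0// ltr_wpDl.
  near=> h.
  have hn0 : h != 0 by near: h; exact: nbhs_dnbhs_neq.
  have h1 : `|h| < 1.
    near: h; apply: nbhs_dnbhs; exists 1 => //= y /=.
    by rewrite sub0r normrN.
  have he : `|h| < e / (C + 1).
    near: h; apply: nbhs_dnbhs; exists (e / (C + 1)) => //= y /=.
    by rewrite sub0r normrN.
  rewrite /= [h *: 1]mulr1 addr0 {2}/bump_poly ltxx subr0 sub0r normrN.
  rewrite /GRing.scale/= normrM normfV.
  have hh := HC _ (le_lt_trans (ler_norm h) h1).
  rewrite -ler_pdivlMl ?invr_gt0 ?normr_gt0// invrK (le_trans hh)//.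
  rewrite -normr_id -(@ger0_norm _ (h ^+ 2)) ?sqr_ge0// normrX expr2 mulrCA normr_id.
  rewrite ler_wpM2l//.
  rewrite (le_trans _ (_ : (C + 1) * `|h| <= e))//; first by rewrite ler_wpM2r// lerDl.
  by rewrite mulrC -ler_pdivlMr ?ltW// ltr_wpDl.
Unshelve. all: by end_near. Qed.

Lemma Ck1_bump_poly k P : Ck1 k (bump_poly P).
Proof.
elim: k P => [|k IH] P; first exact: is_derive_continuous (is_derive_bump_poly P).
by exists (bump_poly ('X^2 * (P - P^`()))); [exact: is_derive_bump_poly|].
Qed.

End smooth1.

Section smooth_step.
Context (R : realType).
Implicit Types (x z : R) (k : nat).

Definition bump z : R := bump_poly 1 z.
Definition dbump z : R := bump_poly 'X^2 z.

Lemma bumpE z : bump z = if 0 < z then expR (- z^-1) else 0.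
Proof. by rewrite /bump /bump_poly hornerC mul1r. Qed.

Lemma bump_ge0 z : 0 <= bump z.
Proof. by rewrite bumpE; case: ifP => // _; exact: expR_ge0. Qed.

Lemma bump_le1 z : bump z <= 1.
Proof.
rewrite bumpE; case: ifP => // z0.
by rewrite -expR0 ler_expR oppr_le0 invr_ge0 ltW.
Qed.

Lemma bump_le0 z : z <= 0 -> bump z = 0.
Proof. by rewrite bumpE leNgt => /negbTE ->. Qed.

Lemma bump_half z : 1 / 2 <= z -> expR (- 2) <= bump z.
Proof.
move=> z2; have z0 : 0 < z by lra.
rewrite bumpE z0 ler_expR lerN2 -[leRHS]invrK lef_pV2 ?posrE//; lra.
Qed.

Lemma is_derive_bump x : is_derive x 1 bump (dbump x).
Proof.
have := is_derive_bump_poly 1 x => /is_derive_eq; apply.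
by rewrite derivC subr0 mulr1.
Qed.

Lemma dbump_ge0 z : 0 <= dbump z.
Proof.
rewrite /dbump /bump_poly; case: ifP => // z0.
by rewrite hornerXn mulr_ge0 ?expR_ge0// exprn_ge0// invr_ge0 ltW.
Qed.

Lemma dbump_le0 z : z <= 0 -> dbump z = 0.
Proof. by rewrite /dbump /bump_poly leNgt => /negbTE ->. Qed.

Lemma dbump_le2 z : dbump z <= 2.
Proof.
rewrite /dbump /bump_poly; case: ifP => // z0.
rewrite hornerXn; set w := z^-1; have w0 : 0 < w by rewrite invr_gt0.
rewrite expRN ler_pdivrMr ?expR_gt0//.
have := @expR_ge1Dxn R w 1 (ltW w0); rewrite (_ : 2`! = 2)%N//; lra.
Qed.

(* [y bump'(y - 1)] is bounded and vanishes as [y -> oo]: this is what controls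
   the derivative of a cutoff near a face of reflection. *)
Lemma mul_dbump_le y : 1 < y ->
  `|y * dbump (y - 1)| <= (y - 1)^-1 + (y - 1)^-1 ^+ 2.
Proof.
move=> y1; have z0 : 0 < y - 1 by lra.
rewrite ger0_norm ?mulr_ge0 ?dbump_ge0//; last lra.
rewrite /dbump /bump_poly z0 hornerXn; set z := y - 1 in z0 *.
have -> : y = z + 1 by rewrite /z; ring.
have -> : (z + 1) * (z^-1 ^+ 2 * expR (- z^-1)) =
  (z^-1 + z^-1 ^+ 2) * expR (- z^-1) by field; rewrite gt_eqF.
rewrite ler_piMr ?addr_ge0 ?sqr_ge0 ?invr_ge0 ?ltW//.
by rewrite -expR0 ltr_expR oppr_lt0 invr_gt0.
Qed.

Lemma mul_dbump_le4 y : 0 <= y -> `|y * dbump (y - 1)| <= 4.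
Proof.
move=> y0; have [y1|y1] := leP y 1.
  by rewrite dbump_le0 ?mulr0 ?normr0//; lra.
have z0 : 0 < y - 1 by lra.
have [y2|y2] := leP y 2.
  rewrite ger0_norm ?mulr_ge0 ?dbump_ge0//.
  by apply: (le_trans (ler_pM _ _ y2 (dbump_le2 _))); rewrite ?dbump_ge0//; lra.
apply: (le_trans (mul_dbump_le y1)).
set w := _^-1; have w1 : w <= 1 by rewrite /w invf_le1//; lra.
have w0 : 0 <= w by rewrite invr_ge0 ltW.
have : w ^+ 2 <= 1 by rewrite expr_le1.
lra.
Qed.

Definition step z : R := bump z / (bump z + bump (1 - z)).

(** One of [z] and [1 - z] is at least 1/2. A uniform bound, rather than mere positivity, is what
    makes the derivative of [step] bounded. *)
Lemma step_denom z : expR (- 2) <= bump z + bump (1 - z).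
Proof.
have [z2|z2] := leP (1/2) z; first by rewrite ler_wpDr ?bump_ge0// bump_half.
by rewrite ler_wpDl ?bump_ge0// bump_half//; lra.
Qed.

Lemma step_denom_gt0 z : 0 < bump z + bump (1 - z).
Proof. by apply: lt_le_trans (step_denom z); exact: expR_gt0. Qed.

Lemma step_ge0 z : 0 <= step z.
Proof. by rewrite divr_ge0 ?bump_ge0// ltW// step_denom_gt0. Qed.

Lemma step_le1 z : step z <= 1.
Proof. by rewrite ler_pdivrMr ?step_denom_gt0// mul1r lerDl bump_ge0. Qed.

Lemma step_le0 z : z <= 0 -> step z = 0.
Proof. by move=> z0; rewrite /step bump_le0// mul0r. Qed.

Lemma step_ge1 z : 1 <= z -> step z = 1.
Proof.
move=> z1; have := step_denom_gt0 z; rewrite /step (@bump_le0 (1 - z)); last lra.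
by rewrite addr0 => /gt_eqF/negbT/divff.
Qed.

Lemma Ck1_bump1 k : Ck1 k (fun z => bump (1 - z)).
Proof.
have := Ck1_affine (-1) 1 (@Ck1_bump_poly R k 1).
by under eq_fun do rewrite mulN1r addrC.
Qed.

Lemma Ck1_step k : Ck1 k step.
Proof.
apply: (@Ck1M _ k bump (fun z => (bump z + bump (1 - z))^-1)).
  exact: Ck1_bump_poly.
apply: Ck1V => [z|]; first by rewrite gt_eqF// step_denom_gt0.
by apply: Ck1D; [exact: Ck1_bump_poly|exact: Ck1_bump1].
Qed.

Lemma is_derive_step : exists C dstep,
  (forall z, is_derive z 1 step (dstep z)) /\ (forall z, `|dstep z| <= C).
Proof.
pose d z := bump z + bump (1 - z); pose d' z := dbump z - dbump (1 - z).
have dd z : is_derive z 1 d (d' z).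
  apply: is_deriveD; first exact: is_derive_bump.
  have H : is_derive z 1 (fun x => 1 - x) (-1).
    by have := is_deriveB (is_derive_cst (1:R) z (1:R)) (is_derive_id z (1:R)) => /is_derive_eq; apply; rewrite sub0r.
  have := @is_derive1_comp _ bump (fun x => 1 - x) z _ _ (is_derive_bump _) H.
  by rewrite mulrN1.
have d0 z : 0 < d z by exact: step_denom_gt0.
have e0 : 0 < expR (- 2) :> R by exact: expR_gt0.
exists (2 * (expR (- 2))^-1 + 4 * expR (- 2) ^- 2).
exists (fun z => bump z * (- d z ^- 2 * d' z) + (d z)^-1 * dbump z); split => z.
  have dz0 : d z != 0 by rewrite gt_eqF.
  exact: is_deriveM (is_derive_bump z) (is_deriveV dz0 (dd z)).
have dV : (d z)^-1 <= (expR (- 2))^-1 by rewrite lef_pV2 ?posrE// step_denom.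
have dV0 : 0 <= (d z)^-1 by rewrite invr_ge0 ltW.
have d'2 : `|d' z| <= 4.
  rewrite (le_trans (ler_normB _ _))// !ger0_norm ?dbump_ge0//.
  have := dbump_le2 z; have := dbump_le2 (1 - z); lra.
rewrite addrC (le_trans (ler_normD _ _))// lerD//.
  rewrite normrM !ger0_norm ?dbump_ge0// mulrC.
  by apply: ler_pM; rewrite ?dbump_ge0// dbump_le2.
rewrite !normrM normrN (ger0_norm (bump_ge0 z)) normfV normrX (gtr0_norm (d0 z)).
rewrite -!exprVn [leRHS]mulrC -[leRHS]mul1r.
apply: ler_pM; rewrite ?bump_ge0 ?bump_le1 ?mulr_ge0 ?exprn_ge0//.
apply: ler_pM; rewrite ?exprn_ge0//.
by apply: lerXn2r; rewrite ?nnegrE// ?invr_ge0 ltW.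
Qed.

End smooth_step.

(** * Smooth functions of several variables *)

(** Both difference quotients are the same function of [h]. This gives access to the chain rule and
    the mean value theorem in one variable. *)
Lemma is_derive_line_at (R : realType) (V : normedModType R) (f : V -> R) x v (t0 d : R) :
  is_derive (t0 *: v + x) v f d <-> is_derive t0 1 (fun t => f (t *: v + x)) d.
Proof.
pose q1 := fun h : R => h^-1 *: ((f \o shift (t0 *: v + x)) (h *: v) - f (t0 *: v + x)).
pose F := fun t : R => f (t *: v + x).
pose q2 := fun h : R => h^-1 *: ((F \o shift t0) (h *: (1 : R)) - F t0).
have qq : q1 = q2.
  apply/funext => h; rewrite /q1 /q2 /F /=.
  by rewrite [h *: (1:R)]mulr1 scalerDl addrA.
split=> -[]; rewrite /derivable /derive -/q1 -/q2.
  by move=> H1 H2; apply: DeriveDef; rewrite /derivable /derive -/F -/q2 -qq.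
rewrite -/q2 -qq => H1 H2.
by apply: DeriveDef; rewrite /derivable /derive -/q1.
Qed.

Lemma is_derive_line (R : realType) (V : normedModType R) (f : V -> R) x v (d : R) :
  is_derive x v f d <-> is_derive (0 : R) 1 (fun t => f (t *: v + x)) d.
Proof. by have := is_derive_line_at f x v 0 d; rewrite scale0r add0r. Qed.

Lemma continuous_addr (R : realType) (T : topologicalType) (f g : T -> R) :
  continuous f -> continuous g -> continuous (f + g).
Proof. by move=> cf cg x; apply: cvgD; [exact: cf|exact: cg]. Qed.

Lemma continuous_mulr (R : realType) (T : topologicalType) (f g : T -> R) :
  continuous f -> continuous g -> continuous (f * g).
Proof. by move=> cf cg x; apply: cvgM; [exact: cf|exact: cg]. Qed.

Section smooth.
Context (R : realType) (n : nat).
Local Notation V := 'rV[R]_n.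
Local Notation e_ i := (delta_mx ord0 i : V).
Implicit Types (f g phi : V -> R) (D : set V) (k : nat) (i j : 'I_n) (x : V).

(** [Ck] speaks of [partial], a limit; with the derivatives as witnesses the closure lemmas only
    have to exhibit formulas. *)
Lemma CkS k f : Ck k.+1 f <-> continuous f /\
  exists f' : 'I_n -> V -> R, (forall i x, is_derive x (e_ i) f (f' i x)) /\
    (forall i, Ck k (f' i)).
Proof.
split=> -[cf].
  move=> H; split=> //; exists (fun i => partial i f); split=> i.
    by move=> x; apply: DeriveDef => //; exact: (H i).1.
  exact: (H i).2.
move=> [f' [ff H]]; split=> // i; split=> [x|]; first by have [] := ff i x.
by rewrite (_ : partial i f = f' i)//; apply/funext => x; have [] := ff i x.
Qed.

Lemma Ck_continuous k f : Ck k f -> continuous f.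
Proof. by case: k => [|k] []. Qed.

Lemma CkW k f : Ck k.+1 f -> Ck k f.
Proof.
elim: k f => [|k IH] f; first by case.
move=> /CkS[cf [f' [ff H]]]; apply/CkS; split=> //.
by exists f'; split=> // i; exact: IH.
Qed.

Lemma CkD k f g : Ck k f -> Ck k g -> Ck k (f + g).
Proof.
elim: k f g => [|k IH] f g.
  move=> /Ck_continuous cf /Ck_continuous cg; split=> //.
  exact: continuous_addr.
move=> /CkS[cf [f' [ff Hf]]] /CkS[cg [g' [gg Hg]]]; apply/CkS; split.
  exact: continuous_addr.
exists (fun i => f' i + g' i); split=> [i x|i]; first exact: is_deriveD.
exact: IH.
Qed.

Lemma CkM k f g : Ck k f -> Ck k g -> Ck k (f * g).
Proof.
elim: k f g => [|k IH] f g.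
  move=> /Ck_continuous cf /Ck_continuous cg; split=> //.
  exact: continuous_mulr.
move=> Kf Kg; have /CkS[cf [f' [ff Hf]]] := Kf; have /CkS[cg [g' [gg Hg]]] := Kg.
apply/CkS; split.
  exact: continuous_mulr.
exists (fun i => f * g' i + g * f' i); split=> [i x|i].
  by have := is_deriveM (ff i x) (gg i x) => /is_derive_eq; apply.
by apply: CkD; apply: IH => //; exact: CkW.
Qed.

Lemma Ck_cst k (c : R) : Ck k (cst c : V -> R).
Proof.
elim: k c => [|k IH] c; first by split=> // x; exact: cst_continuous.
apply/CkS; split; first by move=> x; exact: cst_continuous.
by exists (fun=> cst 0); split=> // i x; exact: is_derive_cst.
Qed.

Lemma is_derive_coord (h h' : R -> R) i j x : (forall z : R, is_derive z (1 : R) h (h' z)) ->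
  is_derive x (e_ j) (fun y : V => h (y ord0 i)) ((i == j)%:R * h' (x ord0 i)).
Proof.
move=> hh; apply/is_derive_line.
have -> : (fun t : R => h ((t *: e_ j + x) ord0 i)) = h \o (fun t : R => (i == j)%:R * t + x ord0 i).
  by apply/funext => t; rewrite /= !mxE eqxx/= mulrC.
have H : is_derive (0:R) 1 (fun t : R => (i == j)%:R * t + x ord0 i) (i == j)%:R.
  have := is_deriveD (is_deriveZ (i == j)%:R (is_derive_id (0:R) (1:R))) (is_derive_cst (x ord0 i) (0:R) (1:R)).
  by move=> /is_derive_eq; apply; rewrite /GRing.scale/= mulr1 addr0.
have := @is_derive1_comp _ h _ 0 _ _ (hh _) H => /is_derive_eq; apply.
by rewrite mulr0 add0r mulrC.
Qed.

Lemma Ck_coord k (h : R -> R) i : Ck1 k h -> Ck k (fun x : V => h (x ord0 i)).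
Proof.
have cc (h0 : R -> R) : continuous h0 -> continuous (fun x : V => h0 (x ord0 i)).
  move=> ch x; apply: (@continuous_comp _ _ _ (fun x : V => x ord0 i) h0); last exact: ch.
  exact: coord_continuous.
elim: k h => [|k IH] h; first by move=> ch; split=> //; exact: cc.
move=> [h' hh Kh]; apply/CkS; split.
  by apply: cc; exact: is_derive_continuous hh.
exists (fun j => cst (i == j)%:R * (fun x : V => h' (x ord0 i))); split.
  by move=> j x; exact: is_derive_coord.
by move=> j; apply: CkM; [exact: Ck_cst|exact: IH].
Qed.

Lemma smooth_coord (h : R -> R) i : (forall k, Ck1 k h) -> smooth (fun x : V => h (x ord0 i)).
Proof. by move=> H k; exact: Ck_coord. Qed.

Lemma smoothM f g : smooth f -> smooth g -> smooth (f * g).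
Proof. by move=> sf sg k; exact: CkM. Qed.

Lemma smoothD f g : smooth f -> smooth g -> smooth (f + g).
Proof. by move=> sf sg k; exact: CkD. Qed.

Lemma smooth_cst (c : R) : smooth (cst c : V -> R).
Proof. by move=> k; exact: Ck_cst. Qed.

Lemma smooth_continuous f : smooth f -> continuous f.
Proof. by move=> /(_ 0%N); exact: Ck_continuous. Qed.

Lemma smooth_partial i f : smooth f -> smooth (partial i f).
Proof. by move=> sf k; have [_ /(_ i)[]] := sf k.+1. Qed.

Lemma smooth_derive i f x : smooth f -> is_derive x (e_ i) f (partial i f x).
Proof. by move=> /(_ 1%N)[_ /(_ i)[df _]]; apply: DeriveDef. Qed.

Lemma smooth_prod (I : Type) (s : seq I) (F : I -> V -> R) :
  (forall l, smooth (F l)) -> smooth (fun x => \prod_(i <- s) F i x).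
Proof.
move=> sF; elim: s => [|i s IH].
  by under eq_fun do rewrite big_nil; exact: smooth_cst.
under eq_fun do rewrite big_cons.
exact: smoothM.
Qed.

Lemma partialM i f g x : smooth f -> smooth g ->
  partial i (f * g) x = f x * partial i g x + g x * partial i f x.
Proof.
move=> sf sg; have := is_deriveM (smooth_derive i x sf) (smooth_derive i x sg).
by case.
Qed.

Lemma partialD i f g x : smooth f -> smooth g ->
  partial i (f + g) x = partial i f x + partial i g x.
Proof.
move=> sf sg; have := is_deriveD (smooth_derive i x sf) (smooth_derive i x sg).
by case.
Qed.

Lemma partial_cst i (c : R) x : partial i (cst c : V -> R) x = 0.
Proof. by have [] := is_derive_cst c x (e_ i). Qed.

Lemma partial_coord i j (h h' : R -> R) x : (forall z : R, is_derive z (1 : R) h (h' z)) ->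
  partial j (fun y : V => h (y ord0 i)) x = (i == j)%:R * h' (x ord0 i).
Proof. by move=> hh; have [] := is_derive_coord i j x hh. Qed.

Definition refl i (a : R) (x : V) : V := x + (2 * (a - x ord0 i)) *: e_ i.

Lemma reflE i a x j : refl i a x ord0 j = if j == i then 2 * a - x ord0 i else x ord0 j.
Proof.
rewrite !mxE eqxx/=; case: eqVneq => [->|_]; last by rewrite mulr0 addr0.
by rewrite mulr1; ring.
Qed.

Lemma reflK i a : involutive (refl i a).
Proof.
move=> x; apply/rowP => j; rewrite reflE; case: eqVneq => [->|ji].
  by rewrite reflE eqxx; ring.
by rewrite reflE (negbTE ji).
Qed.

Lemma refl_continuous i a : continuous (refl i a).
Proof.
have c : continuous (fun x : V => 2 * (a - x ord0 i)).
  apply: (@continuous_mulr R V (cst 2)); first exact: cst_continuous.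
  apply: (@continuous_addr R V (cst a)); first exact: cst_continuous.
  by move=> x; apply: (@continuousN R R V (fun x : V => x ord0 i)); exact: coord_continuous.
move=> x; apply: (@continuousD R V V id (fun x : V => (2 * (a - x ord0 i)) *: e_ i)).
  by move=> A.
by apply: (@continuousZr_tmp R V V (fun x : V => 2 * (a - x ord0 i))); exact: c.
Qed.

Definition refl_sign i j : R := if i == j then -1 else 1.

Lemma is_derive_refl i a j f d x : is_derive (refl i a x) (e_ j) f d ->
  is_derive x (e_ j) (f \o refl i a) (refl_sign i j * d).
Proof.
move=> /is_derive_line fd; apply/is_derive_line.
pose F (t : R) := f (t *: e_ j + refl i a x).
have -> : (fun t : R => (f \o refl i a) (t *: e_ j + x)) = F \o (fun t : R => refl_sign i j * t).
  apply/funext => t; rewrite /F /=; congr f; apply/rowP => l.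
  have E c (y : V) m : (c *: e_ j + y) ord0 m = c * (m == j)%:R + y ord0 m.
    by rewrite !mxE.
  rewrite reflE !E reflE /refl_sign; case: (eqVneq l i) => [->|li].
    by case: (eqVneq i j) => _ /=; ring.
  by case: (eqVneq i j) => [<-|_]; rewrite ?(negbTE li)/=; ring.
have H : is_derive (0:R) 1 (fun t : R => refl_sign i j * t) (refl_sign i j).
  have := is_deriveZ (refl_sign i j) (is_derive_id (0:R) (1:R)) => /is_derive_eq; apply.
  by rewrite /GRing.scale/= mulr1.
have fd' : is_derive (refl_sign i j * 0) 1 F d by rewrite mulr0.
by have := is_derive1_comp fd' H => /is_derive_eq; apply; rewrite mulrC.
Qed.

Lemma Ck_refl k i a f : Ck k f -> Ck k (f \o refl i a).
Proof.
have cc g : continuous g -> continuous (g \o refl i a).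
  by move=> cg x; apply: continuous_comp; [exact: refl_continuous|exact: cg].
elim: k f => [|k IH] f; first by move=> [cf _]; split=> //; exact: cc.
move=> /CkS[cf [f' [ff Hf]]]; apply/CkS; split; first exact: cc.
exists (fun j => cst (refl_sign i j) * (f' j \o refl i a)); split=> [j x|j].
  exact: is_derive_refl.
by apply: CkM; [exact: Ck_cst|exact: IH].
Qed.

Lemma partial_refl i a j f x : smooth f ->
  partial j (f \o refl i a) x = refl_sign i j * partial j f (refl i a x).
Proof. by move=> sf; have [] := is_derive_refl (smooth_derive j (refl i a x) sf). Qed.

End smooth.

Local Notation supp := Defs.support.

(** * Supports and test functions *)

Section test_functions.
Context (R : realType) (n : nat).
Local Notation V := 'rV[R]_n.
Local Notation e_ i := (delta_mx ord0 i : V).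
Implicit Types (f g phi : V -> R) (D : set V) (i j : 'I_n) (x : V).

Lemma measurable_continuous f : continuous f -> measurable_fun [set: V] f.
Proof.
move=> /continuousP cf; apply: (measurability _ (RGenOpens.measurableE R)).
move=> _ [_ [a [b ->]] <-]; rewrite setTI; apply: open_measurable_rV.
by apply: cf; exact: interval_open.
Qed.

Lemma measurable_refl i a : measurable_fun [set: V] (@refl R n i a).
Proof.
apply: measurable_fun_rV => j; under eq_fun do rewrite reflE.
have mc l := @measurable_coord R n l.
case: eqVneq => _; last exact: mc.
exact: measurable_funB.
Qed.

Lemma support_out f x : ~ supp f x -> f x = 0.
Proof. by move=> H; apply: contrapT => /eqP fx; apply: H; exact: subset_closure. Qed.

Lemma support_subP f D : closed D -> (forall x, ~ D x -> f x = 0) -> supp f `<=` D.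
Proof.
move=> cD H; rewrite ((closure_id D).1 cD).
by apply: closureS => x /= /eqP fx; apply: contrapT => /H.
Qed.

Lemma test_continuous D phi : test_function D phi -> continuous phi.
Proof. by case=> /smooth_continuous. Qed.

Lemma test_measurable D phi : test_function D phi -> measurable_fun [set: V] phi.
Proof. by move=> /test_continuous/measurable_continuous. Qed.

Lemma test_out D phi x : test_function D phi -> ~ D x -> phi x = 0.
Proof. by move=> [_ _ sD] Dx; apply: support_out => /sD. Qed.

Lemma test_bounded D phi : test_function D phi ->
  exists2 M, 0 <= M & forall x, `|phi x| <= M.
Proof.
move=> tphi; have [_ cK _] := tphi.
have : compact (phi @` supp phi).
  apply: continuous_compact => //; apply: continuous_subspaceT.
  exact: test_continuous tphi.
move=> /compact_bounded[M [_ HM]].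
exists (`|M| + 1) => [|x]; first by rewrite addr_ge0.
have [sx|/support_out ->] := pselect (supp phi x); last by rewrite normr0 addr_ge0.
by apply: HM; [rewrite (le_lt_trans (ler_norm _))// ltrDl|exists x].
Qed.

Lemma support_closed f : closed (supp f).
Proof. exact: closed_closure. Qed.

Lemma support_partial f i : supp (partial i f) `<=` supp f.
Proof.
apply: support_subP; first exact: support_closed.
move=> x sx; rewrite /partial.
have -> : 'D_(e_ i) f x = 'D_(e_ i) (cst 0 : V -> R) x.
  apply: near_eq_derive; have : nbhs x (~` supp f).
    by apply: open_nbhs_nbhs; split=> //; exact/closed_openC/support_closed.
  by apply: filterS => y /support_out.
exact: partial_cst.
Qed.

Lemma test_partial D phi i : test_function D phi -> test_function D (partial i phi).
Proof.
move=> [sphi cK sD]; have sub := @support_partial phi i; split.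
- exact: smooth_partial.
- exact: subclosed_compact (@support_closed _) cK sub.
- exact: subset_trans sD.
Qed.

Lemma test_sub D D' phi : D `<=` D' -> test_function D phi -> test_function D' phi.
Proof. by move=> DD [sphi cK sD]; split=> //; exact: subset_trans DD. Qed.

(** The product is supported in [K] intersected with the compact support of [phi]. Applied to box
    cutoffs, and to face cutoffs, where [K] is a closed half-space inside the open one. *)
Lemma test_mul D D' chi phi K : smooth chi -> closed K ->
  (forall x, ~ K x -> chi x = 0) -> test_function D' phi -> K `&` D' `<=` D ->
  test_function D (chi * phi).
Proof.
move=> schi cK chiK [sphi cphi sD'] KD.
have sub : supp (chi * phi) `<=` K `&` supp phi.
  apply: support_subP; first by apply: closedI => //; exact: support_closed.
  move=> x Kx; rewrite /GRing.mul/=; have [Kx'|/chiK ->] := pselect (K x); last by rewrite mul0r.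
  by rewrite (support_out (x := x) (f := phi)) ?mulr0// => sx; apply: Kx.
split; first exact: smoothM.
  apply: (subclosed_compact (@support_closed _) cphi).
  by move=> x /sub[].
by move=> x /sub[Kx /sD' Dx]; exact: KD.
Qed.

Lemma closed_preimage_refl i a (A : set V) : closed A -> closed (refl i a @^-1` A).
Proof. by move=> cA; apply: (closed_comp _ cA) => x _; exact: refl_continuous. Qed.

Lemma test_refl D phi i a : (forall x, D x -> D (refl i a x)) ->
  test_function D phi -> test_function D (phi \o refl i a).
Proof.
move=> HD [sphi cK sD].
have sub : supp (phi \o refl i a) `<=` refl i a @^-1` supp phi.
  apply: support_subP; first by apply: closed_preimage_refl; exact: support_closed.
  by move=> x /= /support_out.
split.
- by move=> k; exact: Ck_refl.
- apply: (subclosed_compact (@support_closed _) _ sub).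
  have -> : refl i a @^-1` supp phi = refl i a @` supp phi.
    apply/seteqP; split=> [x /= sx|_ [x sx <-]]; last by rewrite /= reflK.
    by exists (refl i a x) => //; rewrite reflK.
  apply: continuous_compact => //; apply: continuous_subspaceT.
  exact: refl_continuous.
- by move=> x /sub /sD /HD; rewrite reflK.
Qed.

Lemma test_add D f g : test_function D f -> test_function D g -> test_function D (f + g).
Proof.
move=> [sf cf fD] [sg cg gD].
have sub : supp (f + g) `<=` supp f `|` supp g.
  apply: support_subP; first by apply: closedU; exact: support_closed.
  move=> x /not_orP[/support_out fx /support_out gx].
  by rewrite /GRing.add/= fx gx addr0.
split; first exact: smoothD.
  by apply: (subclosed_compact (@support_closed _) _ sub); exact: compactU.
by move=> x /sub[/fD|/gD].
Qed.

Lemma test_scale D (c : R) phi : test_function D phi -> test_function D (cst c * phi).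
Proof.
move=> t; apply: (@test_mul D D (cst c) phi setT) => //.
- exact: smooth_cst.
- by move=> x [].
Qed.

End test_functions.

(** * Boxes and reflections *)

Section boxes.
Context (R : realType) (n : nat).
Local Notation V := 'rV[R]_n.
Local Notation mu := (rV_lebesgue R n).
Implicit Types (a b c d x : V) (A U : set V) (i j : 'I_n).

Definition cbox a b : set V := [set x | forall i, a ord0 i <= x ord0 i <= b ord0 i].
Definition obox a b : set V := [set x | forall i, a ord0 i < x ord0 i < b ord0 i].

Lemma obox_cbox a b : obox a b `<=` cbox a b.
Proof. by move=> x xab i; have /andP[/ltW -> /ltW ->] := xab i. Qed.

Lemma closed_cbox a b : closed (cbox a b).
Proof.
have -> : cbox a b = \bigcap_(i in setT) ((fun x : V => x ord0 i) @^-1` `[a ord0 i, b ord0 i]).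
  by apply/seteqP; split=> x H i; [move=> _|]; have := H i; rewrite /= in_itv/=; auto.
apply: closed_bigI => i _; apply: closed_comp; last exact: itv_closed.
by move=> x _; exact: coord_continuous.
Qed.

Lemma open_obox a b : open (obox a b).
Proof.
rewrite openE => x xab.
exists (fun _ j => [set z | a ord0 j < z < b ord0 j]) => [k j|y yab i].
  rewrite ord1; have := near_in_itvoo; apply; rewrite in_itv/=; exact: xab.
exact: yab.
Qed.

Lemma measurable_cbox a b : measurable (cbox a b).
Proof.
rewrite -[cbox a b]setCK; apply: measurableC; apply: open_measurable_rV.
by apply: closed_openC; exact: closed_cbox.
Qed.

Lemma measurable_obox a b : measurable (obox a b).
Proof. by apply: open_measurable_rV; exact: open_obox. Qed.

Lemma rV_ball x (y : V) (r : R) : 0 < r -> (forall i, `|x ord0 i - y ord0 i| < r) -> ball x r y.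
Proof. by move=> r0 H; split=> // i j; rewrite (ord1 i); exact: H. Qed.

Definition rat_lo (ck : 'rV[rat]_n * nat) : V := \row_i (ratr (ck.1 ord0 i) - ck.2.+1%:R^-1).
Definition rat_hi (ck : 'rV[rat]_n * nat) : V := \row_i (ratr (ck.1 ord0 i) + ck.2.+1%:R^-1).

Lemma open_rat_box U x : open U -> U x ->
  exists ck, obox (rat_lo ck) (rat_hi ck) x /\ cbox (rat_lo ck) (rat_hi ck) `<=` U.
Proof.
move=> oU Ux; have /nbhs_ballP[e /= e0 xeU] : nbhs x U by exact: open_nbhs_nbhs.
have [k ke] : exists k : nat, k.+1%:R^-1 < e / 2.
  have e20 : 0 < (e / 2)^-1 by rewrite invr_gt0 divr_gt0.
  exists (Num.truncn (e / 2)^-1).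
  by rewrite -[ltRHS]invrK ltf_pV2 ?posrE// truncnS_gt.
set d : R := k.+1%:R^-1 in ke *; have d0 : 0 < d by rewrite invr_gt0.
have c_ i : {c : rat | `|x ord0 i - ratr c| < d}.
  apply: cid.
  have /rat_in_itvoo[c] : x ord0 i - d < x ord0 i + d by lra.
  rewrite in_itv/= => /andP[c1 c2]; exists c; rewrite ltr_norml; lra.
exists (\row_i sval (c_ i), k); split.
  by move=> i; rewrite !mxE; case: (c_ i) => c /=; rewrite ltr_norml -/d; lra.
move=> w wb; apply: xeU; apply: rV_ball => // i.
have := wb i; rewrite !mxE; case: (c_ i) => c /=.
rewrite -/d !ltr_norml => vc wc; lra.
Qed.

(* [K] is meant to be [obox] or [cbox]. *)
Lemma measurable_boxes (K : V -> V -> set V) :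
  (forall a b, obox a b `<=` K a b) -> (forall a b, K a b `<=` cbox a b) ->
  (forall a b, measurable (K a b)) ->
  @measurable rV_borel_display V = <<s [set A | exists a b, A = K a b] >>.
Proof.
move=> oK Kc mK; rewrite measurable_rVE; apply/seteqP; split; last first.
  apply: smallest_sub; first exact: smallest_sigma_algebra.
  by move=> _ [a [b ->]]; exact: mK.
apply: smallest_sub; first exact: smallest_sigma_algebra.
move=> U oU; pose G := [set A | exists a b, A = K a b].
pose B ck := K (rat_lo ck) (rat_hi ck).
have -> : U = \bigcup_ck (if `[< B ck `<=` U >] then B ck else set0).
  apply/seteqP; split=> [x Ux|x [ck _]]; last first.
    by case: asboolP => // sub; exact: sub.
  have [ck [xck ckU]] := open_rat_box oU Ux.
  exists ck => //; rewrite ifT; first exact: oK.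
  by apply/asboolP => y /Kc; exact: ckU.
apply: (@countable_bigcupT_measurable _ (g_sigma_algebraType G)) => // ck.
by case: asboolP => _; [apply: sub_sigma_algebra; do 2 eexists|exact: measurable0].
Qed.

Definition boxI (f : R -> R -> R) a b : V := \row_i f (a ord0 i) (b ord0 i).

Lemma cboxI a b c d : cbox a b `&` cbox c d = cbox (boxI Num.max a c) (boxI Num.min b d).
Proof.
apply/seteqP; split=> x /=.
  by move=> [H1 H2] i; rewrite !mxE le_min ge_max; have := H1 i; have := H2 i; lra.
by move=> H; split=> i; have := H i; rewrite !mxE le_min ge_max => /andP[/andP[? ?] /andP[? ?]]; apply/andP.
Qed.

Lemma cbox_setI : setI_closed [set A | exists a b, A = cbox a b].
Proof. by move=> _ _ [a [b ->]] [c [d ->]]; rewrite cboxI; do 2 eexists. Qed.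

Lemma oboxI a b c d : obox a b `&` obox c d = obox (boxI Num.max a c) (boxI Num.min b d).
Proof.
apply/seteqP; split=> x /=.
  by move=> [H1 H2] i; rewrite !mxE lt_min gt_max; have := H1 i; have := H2 i; lra.
by move=> H; split=> i; have := H i; rewrite !mxE lt_min gt_max => /andP[/andP[? ?] /andP[? ?]]; apply/andP.
Qed.

Lemma obox_setI : setI_closed [set A | exists a b, A = obox a b].
Proof. by move=> _ _ [a [b ->]] [c [d ->]]; rewrite oboxI; do 2 eexists. Qed.

Lemma coord_le_norm x i : `|x ord0 i| <= `|x|.
Proof.
have -> : `|x| = mx_norm x by [].
rewrite mx_normrE; apply: le_trans (le_bigmax_cond _ (fun ij => `|x ij.1 ij.2|) (_ : xpredT (ord0, i))) => //.
Qed.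

Lemma bigcup_obox : \bigcup_k obox (const_mx (- k%:R)) (const_mx k%:R) = [set: V].
Proof.
apply/seteqP; split=> // x _; exists (Num.truncn `|x|).+1 => // i.
rewrite !mxE -ltr_norml; apply: le_lt_trans (truncnS_gt _).
exact: coord_le_norm.
Qed.

Lemma bigcup_cbox : \bigcup_k cbox (const_mx (- k%:R)) (const_mx k%:R) = [set: V].
Proof.
apply/seteqP; split=> // x _; have [k _ xk] : (\bigcup_k obox (const_mx (- k%:R)) (const_mx k%:R)) x.
  by rewrite bigcup_obox.
by exists k => //; exact: obox_cbox.
Qed.

Lemma mu_cbox a b : (forall i, a ord0 i <= b ord0 i) ->
  mu (cbox a b) = (\prod_(i < n) (b ord0 i - a ord0 i))%:E.
Proof.
move=> ab; by rewrite -rV_lebesgue_box//; congr (mu _).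
Qed.

Lemma cbox_empty a b i : b ord0 i < a ord0 i -> cbox a b = set0.
Proof. by move=> ba; rewrite -subset0 => x /(_ i); lra. Qed.

Lemma mu_cbox_fin a b : (mu (cbox a b) < +oo)%E.
Proof.
have [ab|] := pselect (forall i, a ord0 i <= b ord0 i); first by rewrite mu_cbox// ltry.
by move=> /existsNP[i /negP]; rewrite -ltNge => /cbox_empty ->; rewrite measure0.
Qed.

Lemma refl_cbox i s a b : refl i s @^-1` cbox a b =
  cbox (\row_j if j == i then 2 * s - b ord0 i else a ord0 j)
       (\row_j if j == i then 2 * s - a ord0 i else b ord0 j).
Proof.
apply/seteqP; split=> x /= H j; have := H j; rewrite ?reflE !mxE;
  case: eqVneq => [->|ji]//; lra.
Qed.

Let mu_refl i s := measure_function_pushforward__canonical__measure_function_Measure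
  mu (@measurable_refl R n i s).

(** Closed boxes form a generating pi-system, and a reflection takes a box to a box with the same
    side lengths, an empty one to an empty one. *)
Lemma rV_lebesgue_refl i s A : measurable A -> mu (refl i s @^-1` A) = mu A.
Proof.
move=> mA; apply/esym; move: A mA.
apply: (@measure_unique _ _ _ [set A | exists a b, A = cbox a b]
  (fun k => cbox (const_mx (- k%:R)) (const_mx k%:R)) _ _ _ _ mu (mu_refl i s)).
- by apply: measurable_boxes => a b //; [exact: obox_cbox|exact: measurable_cbox].
- exact: cbox_setI.
- by move=> k; do 2 eexists.
- exact: bigcup_cbox.
- move=> _ [a [b ->]]; change (mu (cbox a b) = mu (refl i s @^-1` cbox a b)); rewrite refl_cbox.
  have [ab|/existsNP[j /negP]] := pselect (forall j, a ord0 j <= b ord0 j); last first.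
    rewrite -ltNge => ba; have -> : cbox a b = set0 by exact: cbox_empty ba.
    set c := (X in cbox X _); set d := (X in cbox _ X).
    rewrite (_ : cbox c d = set0) ?measure0//; apply: (@cbox_empty _ _ j).
    by rewrite !mxE; case: eqVneq => [<-|//]; lra.
  rewrite mu_cbox// mu_cbox; last first.
    by move=> j; rewrite !mxE; have := ab i; case: eqVneq => // _; lra.
  congr EFin; apply: eq_bigr => j _; rewrite !mxE; case: eqVneq => [->|//]; ring.
- by move=> k; exact: mu_cbox_fin.
Qed.

Lemma ge0_integral_refl i s (f : V -> \bar R) : measurable_fun setT f ->
  (forall x, 0 <= f x)%E -> (\int[mu]_x f (refl i s x) = \int[mu]_x f x)%E.
Proof.
move=> mf f0; transitivity (\int[mu_refl i s]_x f x)%E.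
  by rewrite (ge0_integral_pushforward (@measurable_refl R n i s)).
by apply: eq_measure_integral => A mA _; exact: rV_lebesgue_refl.
Qed.

Lemma integral_refl i s (f : V -> \bar R) : measurable_fun setT f ->
  (\int[mu]_x f (refl i s x) = \int[mu]_x f x)%E.
Proof.
move=> mf; rewrite integralE [RHS]integralE; congr (_ - _)%E.
  have m : measurable_fun setT (f^\+)%E by exact: measurable_funepos.
  rewrite -(ge0_integral_refl i s m (funepos_ge0 f)).
  by apply: eq_integral => x _; rewrite !funeposE.
have m : measurable_fun setT (f^\-)%E by exact: measurable_funeneg.
  rewrite -(ge0_integral_refl i s m (funeneg_ge0 f)).
  by apply: eq_integral => x _; rewrite !funenegE.
Qed.

Lemma Rintegral_refl i s (f : V -> R) : measurable_fun setT f ->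
  \int[mu]_x f (refl i s x) = \int[mu]_x f x.
Proof.
move=> mf; rewrite /Rintegral (integral_refl i s (f := EFin \o f))//.
exact/measurable_EFinP.
Qed.

Lemma integrable_refl i s (f : V -> R) : mu.-integrable setT (EFin \o f) ->
  mu.-integrable setT (EFin \o (f \o refl i s)).
Proof.
move=> /integrableP[mf If]; apply/integrableP; split.
  exact: measurableT_comp mf (measurable_refl i s).
rewrite (ge0_integral_refl i s (f := fun x => `|(EFin \o f) x|%E))//.
exact: measurableT_comp.
Qed.

End boxes.

(** * Weak gradients *)

Lemma is_derive_lipschitz (R : realType) (F F' : R -> R) M (a b : R) :
  (forall z : R, is_derive z (1 : R) F (F' z)) -> (forall z, `|F' z| <= M) ->
  `|F b - F a| <= M * `|b - a|.
Proof.
move=> FF F'M; wlog ab : a b / a < b.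
  move=> H; have [ab|ba|->] := ltgtP a b; first exact: H.
    by rewrite distrC [`|b - a|]distrC; exact: H.
  by rewrite !subrr normr0 mulr0.
have cF : {within `[a, b], continuous F}.
  by apply: derivable_within_continuous => z _; have [] := FF z.
have [c _ ->] := MVT ab (fun z _ => FF z) cF.
by rewrite normrM ler_wpM2r.
Qed.

(** A point and its reflection differ along one axis, so this bounds the difference of [phi] at the
    two points by the distance to the hyperplane. *)
Lemma test_lipschitz (R : realType) (n : nat) (D : set 'rV[R]_n) phi (i : 'I_n) :
  test_function D phi -> exists2 M, 0 <= M &
  forall x (t : R), `|phi (t *: delta_mx ord0 i + x) - phi x| <= M * `|t|.
Proof.
move=> tphi; have [M M0 HM] := test_bounded (test_partial i tphi).
exists M => // x t.
have H (z : R) : is_derive z (1 : R) (fun t => phi (t *: delta_mx ord0 i + x))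
    (partial i phi (z *: delta_mx ord0 i + x)).
  by apply: (is_derive_line_at _ _ _ _ _).1; apply: smooth_derive; case: tphi.
have := is_derive_lipschitz 0 t H (fun z => HM _).
by rewrite scale0r add0r subr0.
Qed.

Section integrals.
Context (R : realType) (n : nat).
Local Notation V := 'rV[R]_n.
Local Notation mu := (rV_lebesgue R n).
Implicit Types (u f g phi : V -> R) (D : set V).

Definition L1 f := mu.-integrable [set: V] (EFin \o f).

Lemma L1_measurable f : L1 f -> measurable_fun [set: V] f.
Proof. by move=> /measurable_int/measurable_EFinP. Qed.

Lemma L1D f g : L1 f -> L1 g -> L1 (f + g).
Proof. by move=> If Ig; have := integrableD measurableT If Ig. Qed.

Lemma L1M f g : L1 f -> measurable_fun [set: V] g -> (exists M, forall x, `|g x| <= M) ->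
  L1 (f * g).
Proof.
move=> If mg [M gM]; apply: (integrableMl (h := g) _ If mg) => //.
exists M; split; first exact: num_real.
by move=> r Mr x _; apply: le_trans (gM x) _; exact: ltW.
Qed.

Lemma L1Z c f : L1 f -> L1 (cst c * f).
Proof. by move=> If; rewrite mulrC; apply: L1M => //; exists `|c|. Qed.

Lemma L1N f : L1 f -> L1 (- f).
Proof. by move=> /(L1Z (-1)); congr L1; apply/funext => x; rewrite /GRing.mul/= mulN1r. Qed.

Lemma L1B f g : L1 f -> L1 g -> L1 (f - g).
Proof. by move=> If /L1N; exact: L1D. Qed.

Lemma L1_norm f : L1 f -> L1 (fun x => `|f x|).
Proof. by move=> If; exact: integrable_abse If. Qed.

Lemma L1_le f g : measurable_fun setT f -> (forall x, `|f x| <= g x) -> L1 g -> L1 f.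
Proof.
move=> mf fg; apply: le_integrable => //; first exact/measurable_EFinP.
by move=> x _; rewrite /= lee_fin (le_trans (fg x))// ler_norm.
Qed.

Lemma L1_restrict D f : measurable D -> L1 f -> L1 (f \_ D).
Proof.
move=> mD If; apply: (@L1_le _ (fun x => `|f x|)); last exact: L1_norm.
- by apply/(measurable_restrictT f mD); apply: measurable_funS (L1_measurable If).
- by move=> x; rewrite patchE; case: ifP => // _; rewrite normr0.
Qed.

Lemma L1_refl i s f : L1 f -> L1 (f \o refl i s).
Proof. exact: integrable_refl. Qed.

Lemma RintD f g : L1 f -> L1 g ->
  \int[mu]_x (f x + g x) = \int[mu]_x f x + \int[mu]_x g x.
Proof. by move=> If Ig; exact: RintegralD. Qed.

Lemma RintZ c f : L1 f -> \int[mu]_x (c * f x) = c * \int[mu]_x f x.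
Proof. by move=> If; exact: RintegralZl. Qed.

Lemma RintN f : L1 f -> \int[mu]_x (- f x) = - \int[mu]_x f x.
Proof. by move=> If; rewrite -mulN1r -RintZ//; under [RHS]eq_Rintegral do rewrite mulN1r. Qed.

Lemma Rint_dominated (F : nat -> V -> R) f G : (forall m, measurable_fun setT (F m)) ->
  (forall x, F m x @[m --> \oo] --> f x) -> L1 G -> (forall m x, `|F m x| <= G x) ->
  \int[mu]_x F m x @[m --> \oo] --> \int[mu]_x f x.
Proof.
move=> mF Ff IG FG.
have If : L1 f.
  apply: (L1_le _ _ IG) => [|x].
    by apply: (@measurable_fun_cvg _ _ _ setT F) => // x _; exact: Ff.
  by apply: (cvgr_to_le (cvg_norm (Ff x))); exact: nearW.
apply: fine_cvg; rewrite fineK; last exact: integrable_fin_num.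
apply: (@dominated_cvg _ _ _ mu setT _ (fun m => EFin \o F m) (EFin \o f) (EFin \o G)) => //.
- by move=> m; exact/measurable_EFinP.
- by move=> x _; apply: cvg_EFin; [exact: nearW|exact: Ff].
- by move=> m x _ /=; rewrite lee_fin.
Qed.

End integrals.

Section weak_gradients.
Context (R : realType) (n : nat).
Local Notation V := 'rV[R]_n.
Local Notation mu := (rV_lebesgue R n).
Implicit Types (u v f phi : V -> R) (g h : 'I_n -> V -> R) (D P : set V) (i j k : 'I_n).

(* Weak gradients on [D] for integrable functions extended by [0]: all integrals
   are over the whole space, only the test functions live on [D]. *)
Definition weak_grad0 D u g :=
  [/\ L1 u, forall i, L1 (g i), forall x, ~ D x -> u x = 0,
      forall i x, ~ D x -> g i x = 0 &
      forall i phi, test_function D phi ->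
        \int[mu]_x (u x * partial i phi x) = - \int[mu]_x (g i x * phi x)].

Lemma L1_test u D phi : L1 u -> test_function D phi -> L1 (u * phi).
Proof.
move=> Iu tphi; apply: L1M => //; first exact: test_measurable tphi.
by have [M _ HM] := test_bounded tphi; exists M.
Qed.

Lemma weak_grad0_restrict D P u g : measurable P -> P `<=` D ->
  weak_grad0 D u g -> weak_grad0 P (u \_ P) (fun i => g i \_ P).
Proof.
move=> mP PD [Iu Ig u0 g0 H]; split.
- exact: L1_restrict.
- by move=> i; exact: L1_restrict.
- by move=> x Px; rewrite patchE memNset.
- by move=> i x Px; rewrite patchE memNset.
move=> i phi tphi; have := H i phi (test_sub PD tphi).
have E f psi : test_function P psi -> forall x, (f \_ P) x * psi x = f x * psi x.
  move=> tpsi x; rewrite patchE; case: ifPn => //; rewrite notin_setE => Px.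
  by rewrite (test_out tpsi Px) !mulr0.
under [in X in _ -> X]eq_Rintegral do rewrite (E _ _ (test_partial i tphi)).
by under [in X in _ -> _ = - X]eq_Rintegral do rewrite (E _ _ tphi).
Qed.

Lemma weak_grad0_lin D (c : R) u v g h : weak_grad0 D u g -> weak_grad0 D v h ->
  weak_grad0 D (u + cst c * v) (fun i => g i + cst c * h i).
Proof.
move=> [Iu Ig u0 g0 Hu] [Iv Ih v0 h0 Hv]; split.
- by apply: L1D => //; exact: L1Z.
- by move=> i; apply: L1D => //; exact: L1Z.
- by move=> x Dx; rewrite !fctE u0// v0// mulr0 addr0.
- by move=> i x Dx; rewrite !fctE g0// h0// mulr0 addr0.
move=> i phi tphi; have tp := test_partial i tphi.
have := Hu i phi tphi; have := Hv i phi tphi.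
have E (f1 f2 psi : V -> R) : L1 (f1 * psi) -> L1 (f2 * psi) ->
    \int[mu]_x ((f1 + cst c * f2) x * psi x) =
    \int[mu]_x (f1 x * psi x) + c * \int[mu]_x (f2 x * psi x).
  move=> I1 I2; rewrite -RintZ// -RintD//; last exact: (L1Z c I2).
  by apply: eq_Rintegral => x _; rewrite !fctE mulrDl mulrA.
rewrite (E _ _ _ (L1_test Iu tp) (L1_test Iv tp)).
rewrite (E _ _ _ (L1_test (Ig i) tphi) (L1_test (Ih i) tphi)).
by move=> -> ->; rewrite mulrN opprD.
Qed.

(* Multiplication by a cutoff supported in [D] turns a weak gradient on [D] into
   one on the whole space. *)
Lemma weak_grad0_cutoff D K chi M u g : smooth chi -> closed K -> K `<=` D ->
  (forall x, ~ K x -> chi x = 0) ->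
  (forall x, `|chi x| <= M) -> (forall i x, `|partial i chi x| <= M) ->
  weak_grad0 D u g ->
  weak_grad0 setT (chi * u) (fun i => chi * g i + partial i chi * u).
Proof.
move=> schi cK KD chi0 Mchi Mdchi [Iu Ig u0 g0 H].
have mchi : measurable_fun setT chi.
  by apply: measurable_continuous; exact: smooth_continuous.
have mdchi i : measurable_fun setT (partial i chi).
  by apply: measurable_continuous; apply: smooth_continuous; exact: smooth_partial.
have IM f : L1 f -> L1 (chi * f) by move=> If; rewrite mulrC; apply: L1M => //; exists M.
have IdM i f : L1 f -> L1 (partial i chi * f).
  by move=> If; rewrite mulrC; apply: L1M => //; exists M.
split.
- exact: IM.
- by move=> i; apply: L1D; [exact: IM|exact: IdM].
- by move=> x [].
- by move=> i x [].
move=> i phi tphi.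
have tcp : test_function D (chi * phi).
  by apply: (@test_mul _ _ _ setT _ _ K) => //; rewrite setIT.
have sphi : smooth phi by case: tphi.
have tp := test_partial i tphi.
have E1 : \int[mu]_x (u x * partial i (chi * phi) x) =
   \int[mu]_x ((chi * u) x * partial i phi x) + \int[mu]_x ((partial i chi * u) x * phi x).
  rewrite -RintD; [|exact: L1_test (IM _ Iu) tp|exact: L1_test (IdM i _ Iu) tphi].
  by apply: eq_Rintegral => x _; rewrite partialM// !fctE; ring.
have E2 : \int[mu]_x ((chi * g i + partial i chi * u) x * phi x) =
   \int[mu]_x (g i x * (chi * phi) x) + \int[mu]_x ((partial i chi * u) x * phi x).
  rewrite -RintD; [|exact: L1_test (Ig i) tcp|exact: L1_test (IdM i _ Iu) tphi].
  by apply: eq_Rintegral => x _; rewrite !fctE; ring.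
by have := H i _ tcp; rewrite E1 E2 => EQ; rewrite opprD -EQ addrK.
Qed.

(** The behaviour of face cutoffs at distance [tau] from the hyperplane: they tend to 1, and their
    normal derivatives times [tau] tend to 0. The second limit handles test functions that vanish on
    the hyperplane. *)
Lemma cvg_mul_nat_bump (tau : R) : 0 < tau ->
  bump (m.+1%:R * tau - 1) @[m --> \oo] --> (1 : R) /\
  (m.+1%:R * tau * dbump (m.+1%:R * tau - 1)) @[m --> \oo] --> (0 : R).
Proof.
move=> tau0; have near_w (e : R) : 0 < e ->
    \forall m \near \oo, 1 < m.+1%:R * tau /\ (m.+1%:R * tau - 1)^-1 < e.
  move=> e0; near=> m.
  have : (1 + e^-1) / tau < m.+1%:R.
    apply: (@lt_trans _ _ m%:R); last by rewrite ltr_nat.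
    by near: m; exact: nbhs_infty_gtr.
  rewrite ltr_pdivrMr// => H; have e1 : 0 < e^-1 by rewrite invr_gt0.
  split; first lra.
  rewrite -[ltRHS]invrK ltf_pV2 ?posrE//; lra.
split; apply/cvgrPdist_le => e e0; near=> m.
- have [y1 we] : 1 < m.+1%:R * tau /\ (m.+1%:R * tau - 1)^-1 < e by near: m; exact: near_w.
  set z := _ - 1 in we *; have z0 : 0 < z by rewrite /z; lra.
  rewrite ger0_norm ?subr_ge0 ?bump_le1// bumpE z0.
  have := expR_ge1Dx (- z^-1); lra.
- have [y1 we] : 1 < m.+1%:R * tau /\ (m.+1%:R * tau - 1)^-1 < Num.min 1 (e / 2).
    by near: m; apply: near_w; rewrite lt_min ltr01 divr_gt0.
  rewrite sub0r normrN (le_trans (mul_dbump_le y1))//.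
  move: we; rewrite lt_min; set w := _^-1 => /andP[w1 we].
  have w0 : 0 <= w by rewrite /w invr_ge0; lra.
  have : w ^+ 2 <= w by rewrite expr2 ler_piMl// ltW.
  lra.
Unshelve. all: by end_near. Qed.

End weak_gradients.

(** * Weak gradients under reflection in a hyperplane *)

Section weak_gradient_reflection.
Context (R : realType) (n : nat).
Local Notation V := 'rV[R]_n.
Local Notation mu := (rV_lebesgue R n).
Implicit Types (u v f phi : V -> R) (g h : 'I_n -> V -> R) (D P : set V) (i j k : 'I_n).

Section face_cutoff.
Variables (k : 'I_n) (a s : R).
Hypothesis s1 : s = 1 \/ s = -1.

Definition side_dist (x : V) : R := s * (x ord0 k - a).

(** Expanded into an affine function of one coordinate, the form that [Ck1_affine] takes;
    [face_cutoffE] is the form to read. The shift by 1 makes it vanish up to distance [m.+1%:R^-1]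
    from the hyperplane. *)
Definition face_cutoff m (x : V) : R :=
  bump (m.+1%:R * s * x ord0 k + (- (m.+1%:R * s * a) - 1)).

Lemma face_cutoffE m x : face_cutoff m x = bump (m.+1%:R * side_dist x - 1).
Proof. by rewrite /face_cutoff /side_dist; congr bump; ring. Qed.

Lemma norm_side_dist x : `|side_dist x| = `|x ord0 k - a|.
Proof. by rewrite normrM; case: s1 => ->; rewrite ?normrN normr1 mul1r. Qed.

Lemma side_dist_continuous : continuous side_dist.
Proof.
move=> x; apply: (@continuous_mulr R V (cst s)); first exact: cst_continuous.
apply: (@continuous_addr R V (fun x : V => x ord0 k) (cst (- a))).
  exact: coord_continuous.
exact: cst_continuous.
Qed.

Lemma smooth_face_cutoff m : smooth (face_cutoff m).
Proof.
apply: (smooth_coord (h := fun z => bump (m.+1%:R * s * z + (- (m.+1%:R * s * a) - 1)))) => l.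
by apply: (Ck1_affine (m.+1%:R * s)); exact: Ck1_bump_poly.
Qed.

Lemma partial_face_cutoff m i x : partial i (face_cutoff m) x =
  (k == i)%:R * (m.+1%:R * s * dbump (m.+1%:R * side_dist x - 1)).
Proof.
have dh (z : R) : is_derive z (1 : R) (fun z => bump (m.+1%:R * s * z + (- (m.+1%:R * s * a) - 1)))
    (m.+1%:R * s * dbump (m.+1%:R * s * z + (- (m.+1%:R * s * a) - 1))).
  have H1 : is_derive z (1:R) (fun y : R => m.+1%:R * s * y + (- (m.+1%:R * s * a) - 1)) (m.+1%:R * s).
    have := is_deriveD (is_deriveZ (m.+1%:R * s) (is_derive_id z (1:R))) (is_derive_cst (- (m.+1%:R * s * a) - 1) z (1:R)).
    by move=> /is_derive_eq; apply; rewrite /GRing.scale/= mulr1 addr0.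
  by have := is_derive1_comp (is_derive_bump _) H1 => /is_derive_eq; apply; rewrite mulrC.
rewrite (partial_coord k i x dh) /side_dist; congr (_ * (_ * dbump _)).
by ring.
Qed.

Lemma face_cutoff_le1 m x : `|face_cutoff m x| <= 1.
Proof. by rewrite face_cutoffE ger0_norm ?bump_ge0 ?bump_le1. Qed.

Lemma face_cutoff0 m x : ~ (m.+1%:R^-1 <= side_dist x) -> face_cutoff m x = 0.
Proof.
move=> /negP; rewrite -ltNge => Hx; rewrite face_cutoffE; apply: bump_le0.
by rewrite subr_le0 mulrC -ler_pdivlMr// mul1r ltW.
Qed.

(* Only for [k = i] does the cutoff contribute a derivative, and then [Phi] is
   assumed to be small near the hyperplane. *)
Lemma mul_partial_face_cutoff m i (Phi : V -> R) L x : 0 <= L ->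
  (k = i -> forall x, `|Phi x| <= L * `|x ord0 k - a|) -> 0 < side_dist x ->
  `|Phi x * partial i (face_cutoff m) x| <=
  L * `|m.+1%:R * side_dist x * dbump (m.+1%:R * side_dist x - 1)|.
Proof.
move=> L0 PhiL tau0; rewrite partial_face_cutoff; case: eqVneq => [ki|_]; last first.
  by rewrite mul0r mulr0 normr0; exact: mulr_ge0 L0 (normr_ge0 _).
have := PhiL ki x; rewrite -norm_side_dist => Px.
rewrite mul1r normrM (normrM (_ * s)) (normrM _ s) (normrM (_ * side_dist x)) (normrM _ (side_dist x)).
have -> : `|s| = 1 by case: s1 => ->; rewrite ?normrN normr1.
rewrite mulr1; set A := `|m.+1%:R|; set B := `|dbump _|; set C := `|side_dist x|.
have -> : L * (A * C * B) = L * C * (A * B) by ring.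
by apply: ler_wpM2r; [exact: mulr_ge0 (normr_ge0 _) (normr_ge0 _)|exact: Px].
Qed.

(** [Phi] may be non-zero up to the hyperplane, so the identity is known only for its products with
    face cutoffs, and [m] tends to infinity. By dominated convergence only the term with the
    derivative of the cutoff matters. It is 0 unless [k = i]; then the linear decay of [Phi] bounds
    it by [4 * L * |u|] and lets it tend to 0. *)
Lemma weak_limit_face i (u g Phi : V -> R) L M : 0 <= L -> smooth Phi ->
  (forall x, `|Phi x| <= M) -> (forall x, `|partial i Phi x| <= M) ->
  (k = i -> forall x, `|Phi x| <= L * `|x ord0 k - a|) ->
  L1 u -> L1 g -> (forall x, ~ (0 < side_dist x) -> u x = 0) ->
  (forall x, ~ (0 < side_dist x) -> g x = 0) ->
  (forall m, \int[mu]_x (u x * partial i (face_cutoff m * Phi) x) =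
    - \int[mu]_x (g x * (face_cutoff m * Phi) x)) ->
  \int[mu]_x (u x * partial i Phi x) = - \int[mu]_x (g x * Phi x).
Proof.
move=> L0 sPhi HM1 HM2 PhiL Iu Ig u_out g_out Hm.
have seta := smooth_face_cutoff.
have cvgL : \int[mu]_x (u x * partial i (face_cutoff m * Phi) x) @[m --> \oo] -->
    \int[mu]_x (u x * partial i Phi x).
  apply: (@Rint_dominated _ _ _ _ (cst (M + L * 4) * (fun x => `|u x|))).
  - move=> m; apply: measurable_funM; first exact: L1_measurable.
    apply: measurable_continuous; apply: smooth_continuous; apply: smooth_partial.
    exact: smoothM.
  - move=> x; have [tau0|/u_out ->] := pselect (0 < side_dist x); last first.
      by under eq_fun do rewrite mul0r; rewrite mul0r; exact: cvg_cst.
    have [c1 c2] := cvg_mul_nat_bump tau0.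
    under eq_fun do rewrite (partialM _ _ (seta _) sPhi).
    apply: cvgM; first exact: cvg_cst.
    rewrite -[X in _ --> X]add0r addrC; apply: cvgD.
      rewrite -[X in _ --> X]mul1r; apply: cvgM; last exact: cvg_cst.
      by under eq_fun do rewrite face_cutoffE.
    apply/norm_cvg0P; apply: (@squeeze_cvgr _ _ _ _ (cst 0)
      (fun m => L * `|m.+1%:R * side_dist x * dbump (m.+1%:R * side_dist x - 1)|)).
    - apply: nearW => m; apply/andP; split; first exact: normr_ge0.
      exact: (mul_partial_face_cutoff m L0 PhiL tau0).
    - exact: cvg_cst.
    - rewrite -[X in _ --> X](mulr0 L); apply: cvgM; first exact: cvg_cst.
      exact/norm_cvg0P.
  - by apply: L1Z; exact: L1_norm.
  - move=> m x; rewrite normrM !fctE mulrC.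
    have [tau0|/u_out ->] := pselect (0 < side_dist x); last by rewrite normr0 !mulr0.
    apply: ler_wpM2r; first exact: normr_ge0.
    rewrite (partialM _ _ (seta _) sPhi).
    apply: (le_trans (ler_normD _ _)); apply: lerD.
      rewrite normrM -[leRHS]mul1r.
      exact: ler_pM (normr_ge0 _) (normr_ge0 _) (face_cutoff_le1 _ _) (HM2 _).
    apply: (le_trans (mul_partial_face_cutoff m L0 PhiL tau0)); apply: ler_wpM2l => //.
    by apply: mul_dbump_le4; apply: mulr_ge0; [exact: ler0n|exact: ltW].
have cvgR : \int[mu]_x (g x * (face_cutoff m * Phi) x) @[m --> \oo] -->
    \int[mu]_x (g x * Phi x).
  apply: (@Rint_dominated _ _ _ _ (cst M * (fun x => `|g x|))).
  - move=> m; apply: measurable_funM; first exact: L1_measurable.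
    apply: measurable_continuous; apply: smooth_continuous; exact: smoothM.
  - move=> x; have [tau0|/g_out ->] := pselect (0 < side_dist x); last first.
      by under eq_fun do rewrite mul0r; rewrite mul0r; exact: cvg_cst.
    have [c1 _] := cvg_mul_nat_bump tau0.
    apply: cvgM; first exact: cvg_cst.
    rewrite -[X in _ --> X]mul1r; apply: cvgM; last exact: cvg_cst.
    by under eq_fun do rewrite face_cutoffE.
  - by apply: L1Z; exact: L1_norm.
  - move=> m x; rewrite normrM !fctE mulrC; apply: ler_wpM2r; first exact: normr_ge0.
    rewrite normrM -[leRHS]mul1r.
    exact: ler_pM (normr_ge0 _) (normr_ge0 _) (face_cutoff_le1 _ _) (HM1 _).
move: cvgL; under eq_fun do rewrite Hm.
move=> /(cvg_lim (@Rhausdorff R)) <-.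
exact: (cvg_lim (@Rhausdorff R) (cvgN cvgR)).
Qed.

End face_cutoff.

(** As [u] is 0 off one side, the sum is the even reflection. A change of variables turns testing it
    with [phi] on [D] into testing [u] with the folded function [Phi] on one side. The sign in [Phi]
    is that of the reflected derivative: for [i = k] it makes [Phi] odd, hence zero on the
    hyperplane, as [weak_limit_face] requires; for other [i] the cutoff has no derivative. *)
Lemma weak_grad0_refl D k a s u g : s = 1 \/ s = -1 ->
  (forall x, D x -> D (refl k a x)) ->
  weak_grad0 (D `&` [set x | 0 < side_dist k a s x]) u g ->
  weak_grad0 D (u + (u \o refl k a))
    (fun i => g i + cst (refl_sign R k i) * (g i \o refl k a)).
Proof.
move=> s1 HD [Iu Ig u0 g0 H].
have HDN x : ~ D x -> ~ D (refl k a x) by move=> Dx /HD; rewrite reflK.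
split.
- by apply: L1D => //; exact: L1_refl.
- by move=> i; apply: L1D => //; apply: L1Z; exact: L1_refl.
- by move=> x Dx; rewrite /GRing.add/= !u0 ?addr0// => -[]// /(HDN _ Dx).
- by move=> i x Dx; rewrite /GRing.add/= /GRing.mul/= !g0 ?mulr0 ?addr0// => -[]// /(HDN _ Dx).
move=> i phi tphi; set sg := refl_sign R k i.
have sg2 : sg * sg = 1 by rewrite /sg /refl_sign; case: ifP => _; lra.
pose Phi := phi + cst sg * (phi \o refl k a).
have tphir := test_refl HD tphi.
have tPhi : test_function D Phi by apply: test_add => //; exact: test_scale.
have sphi : smooth phi by case: tphi.
have sphir : smooth (phi \o refl k a) by case: tphir.
have sPhi : smooth Phi by case: tPhi.
have dPhi x : partial i Phi x = partial i phi x + partial i phi (refl k a x).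
  rewrite partialD//; last by apply: smoothM => //; exact: smooth_cst.
  rewrite partialM//; last exact: smooth_cst.
  by rewrite partial_cst partial_refl// mulr0 addr0 mulrA sg2 mul1r.
have tp := test_partial i tphi.
have tpr := test_refl HD tp.
have swap f psi : L1 f -> measurable_fun setT psi ->
    \int[mu]_x (f (refl k a x) * psi x) = \int[mu]_x (f x * psi (refl k a x)).
  move=> If mpsi; rewrite -(@Rintegral_refl _ _ k a (fun x => f x * psi (refl k a x))).
    by apply: eq_Rintegral => x _; rewrite reflK.
  apply: measurable_funM; first exact: L1_measurable.
  exact: measurableT_comp mpsi (measurable_refl k a).
have EL : \int[mu]_x ((u + (u \o refl k a)) x * partial i phi x) =
    \int[mu]_x (u x * partial i Phi x).
  under [RHS]eq_Rintegral do rewrite dPhi mulrDr.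
  rewrite RintD; [|exact: L1_test Iu tp|exact: L1_test Iu tpr].
  rewrite -(swap u (partial i phi) Iu (test_measurable tp)).
  rewrite -RintD; [|exact: L1_test Iu tp|exact: L1_test (L1_refl k a Iu) tp].
  by apply: eq_Rintegral => x _; rewrite !fctE mulrDl.
have ER : \int[mu]_x ((g i + cst sg * (g i \o refl k a)) x * phi x) =
    \int[mu]_x (g i x * Phi x).
  have -> : \int[mu]_x (g i x * Phi x) = \int[mu]_x (g i x * phi x + sg * (g i x * phi (refl k a x))).
    by apply: eq_Rintegral => x _; rewrite /Phi !fctE; ring.
  rewrite RintD; [|exact: L1_test (Ig i) tphi|by apply: L1Z; exact: L1_test (Ig i) tphir].
  rewrite RintZ; last exact: L1_test (Ig i) tphir.
  rewrite -(swap (g i) phi (Ig i) (test_measurable tphi)).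
  rewrite -RintZ; last exact: L1_test (L1_refl k a (Ig i)) tphi.
  rewrite -RintD; [|exact: L1_test (Ig i) tphi|by apply: L1Z; exact: L1_test (L1_refl k a (Ig i)) tphi].
  by apply: eq_Rintegral => x _; rewrite !fctE; ring.
rewrite EL ER.
have [M1 M10 HM1] := test_bounded tPhi.
have [M2 M20 HM2] := test_bounded (test_partial i tPhi).
have [L L0 HL] := test_lipschitz k tphi.
apply: (@weak_limit_face k a s s1 i u (g i) Phi (2 * L) (M1 + M2) _ sPhi _ _ _ Iu (Ig i)).
- exact: mulr_ge0.
- by move=> x; apply: (le_trans (HM1 x)); rewrite lerDl.
- by move=> x; apply: (le_trans (HM2 x)); rewrite lerDr.
(* The two points are at distance [2 * |x ord0 k - a|], whence the constant [2 * L]. *)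
- move=> ki x; have -> : Phi x = phi x - phi (refl k a x).
    by rewrite /Phi !fctE /sg /refl_sign ki eqxx mulN1r.
  have := HL x (2 * (a - x ord0 k)); rewrite (addrC _ x) -/(refl k a x) distrC.
  by rewrite normrM (distrC a) (ger0_norm (ler0n R 2)) mulrA (mulrC L).
- by move=> x Hx; apply: u0 => -[].
- by move=> x Hx; apply: g0 => -[].
move=> m; apply: H.
apply: (@test_mul _ _ _ D _ _ [set x | m.+1%:R^-1 <= side_dist k a s x] _ _ _ tPhi).
- exact: smooth_face_cutoff.
- apply: (closed_comp (f := side_dist k a s) _ (@closed_ge R m.+1%:R^-1)).
  by move=> x _; exact: side_dist_continuous.
- by move=> x; exact: face_cutoff0.
- move=> x [Hx Dx]; split; first exact: Dx.
  by apply: (lt_le_trans _ Hx); rewrite invr_gt0 ltr0n.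
Qed.

End weak_gradient_reflection.

(** * Extension from boxes *)

Section energy.
Context (R : realType) (n : nat).
Local Notation V := 'rV[R]_n.
Local Notation mu := (rV_lebesgue R n).
Implicit Types (f g : V -> R) (s c : R) (x : V).

(** The [s]-th power of the L^s norm. Without the root, contributions of disjoint tentacles add up
    and pointwise inequalities integrate directly. *)
Definition energy s f : \bar R := (\int[mu]_x (`|f x| `^ s)%:E)%E.

Lemma measurable_powR_norm s f : measurable_fun setT f ->
  measurable_fun setT (fun x => (`|f x| `^ s)%:E).
Proof.
move=> mf; apply/measurable_EFinP.
apply: (measurableT_comp (measurable_powR s)).
exact: measurableT_comp mf.
Qed.

Lemma energy_ge0 s f : (0 <= energy s f)%E.
Proof. by apply: integral_ge0 => x _; rewrite lee_fin powR_ge0. Qed.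

Lemma energy_le s f g : 0 <= s -> measurable_fun setT f -> measurable_fun setT g ->
  (forall x, `|f x| <= `|g x|) -> (energy s f <= energy s g)%E.
Proof.
move=> s0 mf mg fg; apply: ge0_le_integral; first exact: measurableT.
- by move=> x _; rewrite lee_fin powR_ge0.
- exact: measurable_powR_norm.
- exact: measurable_powR_norm.
- by move=> x _; rewrite lee_fin; apply: ge0_ler_powR; rewrite ?nnegrE.
Qed.

Lemma energyZ s c f : measurable_fun setT f -> energy s (cst c * f) = ((`|c| `^ s)%:E * energy s f)%E.
Proof.
move=> mf; rewrite /energy -ge0_integralZl; [|exact: measurableT|exact: measurable_powR_norm| |].
- by apply: eq_integral => x _; rewrite fctE normrM powRM.
- by move=> x _; rewrite lee_fin powR_ge0.
- by rewrite lee_fin powR_ge0.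
Qed.

Lemma powRD_le (s x y : R) : 0 <= s -> 0 <= x -> 0 <= y ->
  (x + y) `^ s <= 2 `^ s * (x `^ s + y `^ s).
Proof.
move=> s0; wlog xy : x y / x <= y.
  move=> H x0 y0; have [|/ltW] := leP x y => xy; first exact: H.
  by rewrite [x + y]addrC [_ + y `^ s]addrC; exact: H.
move=> x0 y0; apply: (@le_trans _ _ ((2 * y) `^ s)).
  by apply: ge0_ler_powR; rewrite ?nnegrE//; lra.
by rewrite powRM// ler_wpM2l ?powR_ge0// lerDr powR_ge0.
Qed.

Lemma energyD s f g : 0 <= s -> measurable_fun setT f -> measurable_fun setT g ->
  (energy s (f + g)%R <= (2 `^ s)%:E * (energy s f + energy s g))%E.
Proof.
move=> s0 mf mg; rewrite /energy.
have P (h : V -> R) : forall x, setT x -> (0 <= (`|h x| `^ s)%:E)%E.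
  by move=> x _; rewrite lee_fin powR_ge0.
have Mf := measurable_powR_norm s mf; have Mg := measurable_powR_norm s mg.
rewrite -(ge0_integralD mu measurableT (P f) Mf (P g) Mg).
have PD : forall x, setT x -> (0 <= (`|f x| `^ s)%:E + (`|g x| `^ s)%:E)%E.
  by move=> x _; apply: adde_ge0; exact: P.
have MD := emeasurable_funD Mf Mg.
rewrite -(ge0_integralZl mu measurableT MD PD); last by rewrite lee_fin powR_ge0.
apply: ge0_le_integral; first exact: measurableT.
- exact: P.
- by apply: measurable_powR_norm; exact: measurable_funD.
- exact: measurable_funeM.
- move=> x _; rewrite -EFinD -EFinM lee_fin.
  apply: le_trans (powRD_le s0 (normr_ge0 _) (normr_ge0 _)).
  by apply: ge0_ler_powR; rewrite ?nnegrE// ler_normD.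
Qed.

Lemma energyM s c f g : 0 <= s -> measurable_fun setT f -> measurable_fun setT g ->
  (forall x, `|g x| <= c) -> (energy s (g * f)%R <= (c `^ s)%:E * energy s f)%E.
Proof.
move=> s0 mf mg gc; have c0 : 0 <= c by exact: le_trans (normr_ge0 _) (gc 0).
rewrite -[in leRHS](ger0_norm c0) -energyZ//; apply: energy_le => //.
- exact: measurable_funM.
- by apply: measurable_funM.
- by move=> x; rewrite !fctE !normrM ler_wpM2r// (ger0_norm c0).
Qed.

Lemma energy_refl s i a f : measurable_fun setT f -> energy s (f \o refl i a) = energy s f.
Proof.
move=> mf; rewrite /energy -[RHS](@ge0_integral_refl _ _ i a)//.
exact: measurable_powR_norm.
Qed.

Lemma energy_refl_sum s i a c f : 0 <= s -> `|c| = 1 -> measurable_fun setT f ->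
  (energy s (f + cst c * (f \o refl i a))%R <= (2 * 2 `^ s)%:E * energy s f)%E.
Proof.
move=> s0 c1 mf; have mr : measurable_fun setT (f \o refl i a).
  exact: measurableT_comp mf (measurable_refl i a).
apply: (le_trans (energyD s0 mf _)); first exact: measurable_funM.
rewrite energyZ// c1 powR1 mul1e energy_refl// -mule2n mulrC EFinM -muleA.
by rewrite lee_wpmul2l ?lee_fin ?powR_ge0// mule_natl.
Qed.

End energy.

(** * Cutoffs adapted to boxes *)

Section window.
Context (R : realType).
Implicit Types (y z : R).

Definition window y : R := step (2 - y) * step (2 + y).

Lemma Ck1_window k : Ck1 k window.
Proof.
apply: Ck1M.
  have := Ck1_affine (-1) 2 (@Ck1_step R k).
  by under eq_fun do rewrite mulN1r addrC.
have := Ck1_affine 1 2 (@Ck1_step R k).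
by under eq_fun do rewrite mul1r addrC.
Qed.

Lemma window_ge0 y : 0 <= window y.
Proof. by rewrite mulr_ge0 ?step_ge0. Qed.

Lemma window_le1 y : window y <= 1.
Proof. by rewrite -[leRHS]mulr1 ler_pM ?step_ge0 ?step_le1. Qed.

Lemma window1 y : `|y| <= 1 -> window y = 1.
Proof. by rewrite ler_norml => y1; rewrite /window !step_ge1 ?mulr1//; lra. Qed.

Lemma window0 y : 2 <= `|y| -> window y = 0.
Proof.
rewrite ler_normr /window => /orP[y2|y2].
  by rewrite step_le0 ?mul0r//; lra.
by rewrite [X in _ * X]step_le0 ?mulr0//; lra.
Qed.

Lemma is_derive_window : exists C dwindow,
  (forall y, is_derive y (1 : R) window (dwindow y)) /\ (forall y, `|dwindow y| <= C).
Proof.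
have [C [dstep [H HC]]] := is_derive_step R.
have H1 y : is_derive y (1 : R) (fun y => step (2 - y)) (- dstep (2 - y)).
  have := is_deriveB (is_derive_cst (2:R) y (1:R)) (is_derive_id y (1:R)).
  move=> /(@is_derive1_comp _ (@step R) _ y _ _ (H _)) /is_derive_eq; apply.
  by rewrite sub0r mulrN1.
have H2 y : is_derive y (1 : R) (fun y => step (2 + y)) (dstep (2 + y)).
  have := is_deriveD (is_derive_cst (2:R) y (1:R)) (is_derive_id y (1:R)).
  move=> /(@is_derive1_comp _ (@step R) _ y _ _ (H _)) /is_derive_eq; apply.
  by rewrite add0r mulr1.
exists (C + C), (fun y => step (2 - y) * dstep (2 + y) + step (2 + y) * (- dstep (2 - y))).
split=> y; first exact: is_deriveM (H1 y) (H2 y).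
apply: (le_trans (ler_normD _ _)); apply: lerD; rewrite normrM ger0_norm ?step_ge0//.
  by rewrite -[leRHS]mul1r ler_pM ?step_ge0 ?step_le1.
by rewrite normrN -[leRHS]mul1r ler_pM ?step_ge0 ?step_le1.
Qed.

End window.

Section box_cutoff.
Context (R : realType) (n : nat).
Local Notation V := 'rV[R]_n.
Implicit Types (c rho x : V).

Definition box_cutoff c rho x : R :=
  \prod_(k < n) window ((x ord0 k - c ord0 k) / rho ord0 k).

Lemma smooth_box_cutoff c rho : smooth (box_cutoff c rho).
Proof.
apply: smooth_prod => k.
apply: (@smooth_coord _ _ (fun z => window ((z - c ord0 k) / rho ord0 k))) => l.
have := Ck1_affine (rho ord0 k)^-1 (- (c ord0 k / rho ord0 k)) (@Ck1_window R l).
by under eq_fun do rewrite mulrC -mulrBl.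
Qed.

Lemma box_cutoff_norm c rho x : `|box_cutoff c rho x| <= 1.
Proof.
rewrite ger0_norm; last by apply: prodr_ge0 => k _; exact: window_ge0.
by apply: prodr_ile1 => k _; rewrite window_ge0 window_le1.
Qed.

Lemma box_cutoff1 c rho x : (forall k, 0 < rho ord0 k) ->
  cbox (c - rho) (c + rho) x -> box_cutoff c rho x = 1.
Proof.
move=> rho0 xc; rewrite /box_cutoff big1// => k _; apply: window1.
rewrite normrM normfV (gtr0_norm (rho0 k)) ler_pdivrMr// mul1r ler_norml.
by have := xc k; rewrite !mxE; lra.
Qed.

Lemma box_cutoff0 c rho x : (forall k, 0 < rho ord0 k) ->
  ~ cbox (c - rho *+ 2) (c + rho *+ 2) x -> box_cutoff c rho x = 0.
Proof.
move=> rho0 /existsNP[k /negP xk].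
rewrite /box_cutoff (bigD1 k)//= window0 ?mul0r//.
rewrite normrM normfV (gtr0_norm (rho0 k)) ler_pdivlMr// ler_normr.
move: xk; rewrite negb_and -!ltNge !mxE mulr2n => /orP[]; have := rho0 k => ? ?; apply/orP; [right|left]; lra.
Qed.

(** The constant precedes the box since it has to serve all tentacles. The derivative hits a single
    factor, rescaled by [rho ord0 i >= r], and the other factors are at most 1. *)
Lemma box_cutoff_partial : exists2 C : R, 0 <= C & forall c rho r, 0 < r ->
  (forall k, r <= rho ord0 k) ->
  forall i x, `|partial i (box_cutoff c rho) x| <= C * r^-1.
Proof.
have [C [dw [Hw HC]]] := is_derive_window R.
have C0 : 0 <= C by exact: le_trans (normr_ge0 _) (HC 0).
exists C => // c rho r r0 rrho i x.
have rho0 k : 0 < rho ord0 k by exact: lt_le_trans r0 (rrho k).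
pose W k (z : R) := window ((z - c ord0 k) / rho ord0 k).
have HW k (z : R) : is_derive z (1 : R) (W k) (dw ((z - c ord0 k) / rho ord0 k) / rho ord0 k).
  have H1 : is_derive z (1 : R) (fun z => (z - c ord0 k) / rho ord0 k) (rho ord0 k)^-1.
    have := is_deriveZ (rho ord0 k)^-1 (is_deriveB (is_derive_id z (1:R)) (is_derive_cst (c ord0 k) z (1:R))).
    rewrite subr0 [_ *: _]mulr1.
    by congr is_derive; apply/funext => y; rewrite /= mulrC.
  exact: (is_derive1_comp (Hw _) H1).
pose q := \prod_(k < n | k != i) W k (x ord0 k).
have q1 : `|q| <= 1.
  rewrite ger0_norm; last by apply: prodr_ge0 => k _; exact: window_ge0.
  by apply: prodr_ile1 => k _; rewrite window_ge0 window_le1.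
have H : is_derive x (delta_mx ord0 i) (box_cutoff c rho)
    (q * (dw ((x ord0 i - c ord0 i) / rho ord0 i) / rho ord0 i)).
  apply/is_derive_line.
  have -> : (fun t : R => box_cutoff c rho (t *: delta_mx ord0 i + x)) =
      (fun t : R => q * W i ((t *: delta_mx ord0 i + x) ord0 i)).
    apply/funext => t; rewrite /box_cutoff (bigD1 i)//= mulrC; congr (_ * _).
    apply: eq_bigr => k ki; congr window; congr (_ / _); congr (_ - _).
    by rewrite !mxE (negbTE ki) andbF mulr0 add0r.
  apply: is_deriveZ.
  have := is_derive_coord i i x (HW i); rewrite eqxx mul1r => /is_derive_line.
  by [].
have [_ E] := H; rewrite /partial E.
rewrite 2!normrM normfV (gtr0_norm (rho0 i)) -[leRHS]mul1r.
apply: ler_pM => //; first by rewrite mulr_ge0 ?invr_ge0// ltW.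
apply: ler_pM => //; first by rewrite invr_ge0 ltW.
by rewrite lef_pV2 ?posrE.
Qed.

End box_cutoff.

(** * Extension from a box by reflections and a cutoff *)

Section box_extension.
Context (R : realType) (n : nat).
Local Notation V := 'rV[R]_n.
Local Notation mu := (rV_lebesgue R n).
Implicit Types (a b c rho x y : V) (s t : R) (k i : 'I_n) (u : V -> R) (g : 'I_n -> V -> R).

(* [N] counts the reflections used. The third clause keeps hyperplane slices on
   which [u] vanishes; it makes the extended jump vanish on the base. *)
Definition box_extends N a b a' b' : Prop :=
  (forall k, a' ord0 k <= a ord0 k /\ b ord0 k <= b' ord0 k) /\
  forall u g, weak_grad0 (obox a b) u g -> exists u' g',
  [/\ weak_grad0 (obox a' b') u' g',
      forall x, obox a b x -> u' x = u x,
      forall k t, a ord0 k < t < b ord0 k ->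
        (forall y, y ord0 k = t -> u y = 0) -> forall y, y ord0 k = t -> u' y = 0,
      forall s, 0 <= s -> (energy s u' <= ((2 * 2 `^ s) ^+ N)%:E * energy s u)%E &
      forall s i, 0 <= s -> (energy s (g' i) <= ((2 * 2 `^ s) ^+ N)%:E * energy s (g i))%E].

Lemma box_extends_refl a b : box_extends 0 a b a b.
Proof.
split=> // u g ug; exists u, g; split=> // [s _|s i _]; by rewrite expr0 mul1e.
Qed.

Lemma box_extends_trans N N' a b a' b' a'' b'' :
  box_extends N a b a' b' -> box_extends N' a' b' a'' b'' ->
  box_extends (N' + N) a b a'' b''.
Proof.
move=> [ab H] [ab' H']; split.
  move=> k; have [? ?] := ab k; have [? ?] := ab' k; lra.
move=> u g /H[u1 [g1 [/H'[u2 [g2 [ug2 E2 V2 Iu2 Ig2]]] E1 V1 Iu1 Ig1]]].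
have K (s : R) m (z : \bar R) (w v : \bar R) :
    (w <= ((2 * 2 `^ s) ^+ N')%:E * v)%E -> (v <= ((2 * 2 `^ s) ^+ N)%:E * z)%E ->
    (w <= ((2 * 2 `^ s) ^+ (N' + N))%:E * z)%E.
  move=> wv vz; rewrite exprD EFinM -muleA (le_trans wv)//.
  by rewrite lee_wpmul2l// lee_fin exprn_ge0// mulr_ge0// powR_ge0.
exists u2, g2; split=> //.
- move=> x xab; rewrite E2 ?E1// => k; have [? ?] := ab k; have := xab k; lra.
- move=> k t tab uy; apply: V2; last exact: V1 uy.
  by have [? ?] := ab k; lra.
- by move=> s s0; apply: K (Iu2 s s0) (Iu1 s s0).
- by move=> s i s0; apply: K (Ig2 s i s0) (Ig1 s i s0).
Qed.

Lemma box_extends_reflect a b a' b' k h s : s = 1 \/ s = -1 ->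
  (forall k, a' ord0 k <= a ord0 k /\ b ord0 k <= b' ord0 k) ->
  (forall x, obox a' b' x -> obox a' b' (refl k h x)) ->
  obox a b = obox a' b' `&` [set x | 0 < side_dist k h s x] ->
  (forall t, a ord0 k < t < b ord0 k -> 0 < s * (t - h)) ->
  box_extends 1 a b a' b'.
Proof.
move=> s1 ab inv abE tk; split=> // u g ug.
have [Iu Ig u0 g0 _] := ug.
have out x : 0 < side_dist k h s x -> u (refl k h x) = 0.
  move=> Hx; apply: u0; rewrite abE => -[_ /=].
  by move: Hx; rewrite /side_dist reflE eqxx; case: s1 => ->; lra.
rewrite abE in ug; have := weak_grad0_refl s1 inv ug.
set u' := u + _; set g' := fun i => _ => ug'; exists u', g'; split=> //.
- by move=> x; rewrite abE => -[_ /= Hx]; rewrite /u' fctE /= out// addr0.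
(* A slice perpendicular to the reflected axis is carried out of the box, where [u] is 0; any other
   slice is mapped to itself. *)
- move=> k0 t tab uy y yt; rewrite /u' fctE /= uy// add0r.
  have [E|kk] := eqVneq k0 k; last by apply: uy; rewrite reflE (negbTE kk).
  by apply: out; rewrite /side_dist; subst k0; rewrite yt; exact: tk.
- move=> r r0; rewrite expr1.
  have -> : u' = u + cst 1 * (u \o refl k h) by apply/funext => x; rewrite !fctE mul1r.
  by apply: energy_refl_sum => //; [rewrite normr1|exact: L1_measurable].
- move=> r i r0; rewrite expr1; apply: energy_refl_sum => //; last exact: L1_measurable.
  by rewrite /refl_sign; case: ifP; rewrite ?normrN normr1.
Qed.

Definition set_coord k t x : V := \row_j if j == k then t else x ord0 j.

Lemma set_coordE k t x j : set_coord k t x ord0 j = if j == k then t else x ord0 j.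
Proof. by rewrite mxE. Qed.

Lemma box_extends_lower k a b : a ord0 k < b ord0 k ->
  box_extends 1 a b (set_coord k (2 * a ord0 k - b ord0 k) a) b.
Proof.
move=> akbk; apply: (@box_extends_reflect _ _ _ _ k (a ord0 k) 1); first by left.
- by move=> j; rewrite set_coordE; case: eqVneq => [->|_]; split=> //; lra.
- move=> x xb j; have := xb j; rewrite set_coordE reflE; case: eqVneq => [->|_]//; lra.
- apply/seteqP; split=> x /=.
    move=> xab; split.
      by move=> j; have := xab j; rewrite set_coordE; case: eqVneq => [->|_]//; lra.
    by rewrite /side_dist; have := xab k; lra.
  move=> [xab]; rewrite /side_dist => xk j; have := xab j; rewrite set_coordE.
  by case: eqVneq => [->|_]//; lra.
- by move=> t; lra.
Qed.

Lemma box_extends_upper k a b : a ord0 k < b ord0 k ->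
  box_extends 1 a b a (set_coord k (2 * b ord0 k - a ord0 k) b).
Proof.
move=> akbk; apply: (@box_extends_reflect _ _ _ _ k (b ord0 k) (-1)); first by right.
- by move=> j; rewrite set_coordE; case: eqVneq => [->|_]; split=> //; lra.
- move=> x xb j; have := xb j; rewrite set_coordE reflE; case: eqVneq => [->|_]//; lra.
- apply/seteqP; split=> x /=.
    move=> xab; split.
      by move=> j; have := xab j; rewrite set_coordE; case: eqVneq => [->|_]//; lra.
    by rewrite /side_dist; have := xab k; lra.
  move=> [xab]; rewrite /side_dist => xk j; have := xab j; rewrite set_coordE.
  by case: eqVneq => [->|_]//; lra.
- by move=> t; lra.
Qed.

(** One reflection in the lower and one in the upper face for each axis. Each adds at least the
    original width on its side. *)
Lemma box_extends_seq (l : seq 'I_n) a b : (forall k, a ord0 k < b ord0 k) ->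
  exists a' b', box_extends (size l).*2 a b a' b' /\
  forall k, k \in l -> a' ord0 k <= 2 * a ord0 k - b ord0 k /\
                       2 * b ord0 k - a ord0 k <= b' ord0 k.
Proof.
move=> ab; elim: l => [|k l [a' [b' [H Hl]]]].
  by exists a, b; split=> //; exact: box_extends_refl.
have [mon _] := H; have [mk1 mk2] := mon k; have abk := ab k.
have a'b' : a' ord0 k < b' ord0 k by lra.
have H1 := box_extends_trans H (box_extends_lower a'b').
set a1 := set_coord _ _ _ in H1.
have a1E : a1 ord0 k = 2 * a' ord0 k - b' ord0 k by rewrite set_coordE eqxx.
have a1b' : a1 ord0 k < b' ord0 k by rewrite a1E; lra.
have H2 := box_extends_trans H1 (box_extends_upper a1b').
do 2 eexists; split; first exact: H2.
move=> j; rewrite inE => /orP[/eqP ->|jl].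
  by rewrite !set_coordE eqxx; lra.
have [? ?] := Hl j jl; rewrite !set_coordE; case: eqVneq => [->|//].
by rewrite eqxx; lra.
Qed.

(** [C] depends on the exponent only, not on the box or the function. The base uses it for the
    exponent [p], the tentacles for [q]; the width enters through [r^-1] alone. *)
Definition extends_boxes (C : R -> R) : Prop :=
  forall c rho r, 0 < r -> (forall k, r <= rho ord0 k) ->
  forall u g, weak_grad0 (obox (c - rho) (c + rho)) u g ->
  exists u' g', [/\ weak_grad0 setT u' g',
    forall x, obox (c - rho) (c + rho) x -> u' x = u x,
    forall x, ~ cbox (c - rho *+ 2) (c + rho *+ 2) x -> u' x = 0 /\ forall i, g' i x = 0,
    forall k t, c ord0 k - rho ord0 k < t < c ord0 k + rho ord0 k ->
      (forall y, y ord0 k = t -> u y = 0) -> forall y, y ord0 k = t -> u' y = 0 &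
    forall s, 0 <= s -> (energy s u' <= (C s)%:E * energy s u)%E /\
      forall i, (energy s (g' i) <= (C s)%:E * (energy s (g i) + (r^-1 `^ s)%:E * energy s u))%E].

Lemma box_extension : exists2 C : R -> R, forall s, 0 <= C s & extends_boxes C.
Proof.
have [C C0 HC] := @box_cutoff_partial R n.
pose K s : R := (2 * 2 `^ s) ^+ (size (enum 'I_n)).*2.
have K0 s : 0 <= K s by rewrite exprn_ge0// mulr_ge0// powR_ge0.
(* The factor [K s] comes from the reflections, [C] from the derivative of the cutoff, and the
   leading power of 2 from the two terms of the gradient of a product. *)
exists (fun s => 2 `^ s * (1 + C `^ s) * K s) => [s|].
  by rewrite mulr_ge0// mulr_ge0 ?addr_ge0 ?powR_ge0.
move=> c rho r r0 rrho u g ug.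
have rho0 k : 0 < rho ord0 k by exact: lt_le_trans r0 (rrho k).
have ab k : (c - rho) ord0 k < (c + rho) ord0 k by rewrite !mxE; have := rho0 k; lra.
have [a' [b' [[_ ext] Hl]]] := box_extends_seq (enum 'I_n) ab.
have [u1 [g1 [ug1 E1 V1 Iu1 Ig1]]] := ext u g ug.
pose chi := box_cutoff c rho.
have schi : smooth chi := smooth_box_cutoff c rho.
pose Kb := cbox (c - rho *+ 2) (c + rho *+ 2).
have chi0 x : ~ Kb x -> chi x = 0 by exact: box_cutoff0.
have dchi0 i x : ~ Kb x -> partial i chi x = 0.
  move=> Kx; apply: support_out => /support_partial; apply: contra_not Kx.
  by apply: support_subP => //; exact: closed_cbox.
(* The reflected box contains the open box with half-widths [3 * rho], hence the closed box with
   half-widths [2 * rho]. *)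
have KbD : Kb `<=` obox a' b'.
  move=> x Kx k; have [] := Hl k (mem_enum _ k); have := Kx k; rewrite !mxE => ? ? ?.
  by have := rho0 k; lra.
have chi1 := box_cutoff_norm c rho.
have dchi := HC c rho r r0 rrho.
have Cr0 : 0 <= C * r^-1 by rewrite mulr_ge0// invr_ge0 ltW.
have [Iu _ _ _ _] := ug; have [Iu1' Ig1' _ _ _] := ug1.
have mchi : measurable_fun setT chi.
  by apply: measurable_continuous; exact: smooth_continuous.
have mdchi i : measurable_fun setT (partial i chi).
  by apply: measurable_continuous; apply: smooth_continuous; exact: smooth_partial.
exists (chi * u1), (fun i => chi * g1 i + partial i chi * u1); split.
- apply: (@weak_grad0_cutoff _ _ (obox a' b') Kb chi (1 + C * r^-1)) => //.
  + exact: closed_cbox.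
  + by move=> x; rewrite (le_trans (chi1 x))// lerDl.
  + by move=> i x; rewrite (le_trans (dchi i x))// lerDr.
- move=> x xab; rewrite fctE /chi box_cutoff1 ?mul1r ?E1//; exact: obox_cbox.
- by move=> x Kx; split=> [|i]; rewrite !fctE chi0// ?dchi0// !mul0r ?addr0.
- move=> k t tk uy y yt; rewrite fctE (V1 k t)// ?mulr0//.
  by rewrite !mxE.
move=> s s0; have p1 : 1 `^ s = 1 :> R by rewrite powR1.
have p2 : 1 <= 2 `^ s :> R.
  by rewrite -p1; apply: ge0_ler_powR; rewrite ?nnegrE//; lra.
have pC : 0 <= C `^ s by exact: powR_ge0.
have eu1 : (energy s (chi * u1)%R <= (K s)%:E * energy s u)%E.
  apply: (le_trans (energyM s0 (L1_measurable Iu1') mchi chi1)).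
  by rewrite p1 mul1e; exact: Iu1.
have KC : K s <= 2 `^ s * (1 + C `^ s) * K s.
  by rewrite ler_peMl// -[leLHS]mulr1 ler_pM//; lra.
split=> [|i].
  by rewrite (le_trans eu1)// lee_wpmul2r ?energy_ge0// lee_fin.
apply: (le_trans (energyD s0 _ _)).
- by apply: measurable_funM => //; exact: L1_measurable.
- by apply: measurable_funM => //; exact: L1_measurable.
rewrite -mulrA EFinM -muleA lee_wpmul2l ?lee_fin ?powR_ge0//.
have e1 : (energy s (chi * g1 i)%R <= (K s)%:E * energy s (g i))%E.
  apply: (le_trans (energyM s0 (L1_measurable (Ig1' i)) mchi chi1)).
  by rewrite p1 mul1e; exact: Ig1.
have e2 : (energy s (partial i chi * u1)%R <= (C `^ s * K s)%:E * ((r^-1 `^ s)%:E * energy s u))%E.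
  apply: (le_trans (energyM s0 (L1_measurable Iu1') (mdchi i) (dchi i))).
  rewrite powRM ?invr_ge0 ?(ltW r0)//.
  apply: (@le_trans _ _ ((C `^ s * r^-1 `^ s)%:E * ((K s)%:E * energy s u))%E).
    by apply: lee_wpmul2l; [rewrite lee_fin mulr_ge0 ?powR_ge0|exact: Iu1].
  by rewrite !muleA -!EFinM mulrAC.
have Ru0 : (0 <= (r^-1 `^ s)%:E * energy s u)%E.
  by rewrite mule_ge0 ?energy_ge0// lee_fin powR_ge0.
rewrite ge0_muleDr ?energy_ge0//; apply: leeD.
  apply: (le_trans e1); apply: lee_wpmul2r; first exact: energy_ge0.
  by rewrite lee_fin ler_peMl// lerDl.
apply: (le_trans e2); apply: lee_wpmul2r => //.
by rewrite lee_fin ler_wpM2r// lerDr.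
Qed.

End box_extension.

(** * Uniqueness of weak gradients and Sobolev norms *)

Section fundamental_lemma.
Context (R : realType) (n : nat).
Local Notation V := 'rV[R]_n.
Local Notation mu := (rV_lebesgue R n).
Implicit Types (f phi : V -> R) (D : set V) (a b x : V).

Lemma compact_cbox a b : compact (cbox a b).
Proof.
apply: bounded_closed_compact; last exact: closed_cbox.
exists (`|a| + `|b|); split; first exact: num_real.
move=> r Mr x xab; have r0 : 0 < r by apply: le_lt_trans Mr; rewrite addr_ge0.
rewrite /= (_ : `|x| = mx_norm x)// mx_normrE; apply/bigmax_leP; split; first exact: ltW.
move=> [i j] _ /=; rewrite (ord1 i).
have := xab j; have := coord_le_norm a j; have := coord_le_norm b j.
have := normr_ge0 a; have := normr_ge0 b.
rewrite !ler_norml; lra.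
Qed.

(** Smooth substitutes for the indicator of an open box, to which they converge pointwise; one face
    cutoff for each of the [2n] faces. *)
Definition box_bump a b m : V -> R := fun x =>
  \prod_(k < n) (face_cutoff k (a ord0 k) 1 m x * face_cutoff k (b ord0 k) (-1) m x).

Lemma smooth_box_bump a b m : smooth (box_bump a b m).
Proof.
apply: smooth_prod => k.
exact: (smoothM (smooth_face_cutoff k (a ord0 k) 1 m) (smooth_face_cutoff k (b ord0 k) (-1) m)).
Qed.

Lemma box_bump_norm a b m x : `|box_bump a b m x| <= 1.
Proof.
rewrite normr_prod; apply: prodr_ile1 => k _; rewrite normr_ge0 normrM/=.
by rewrite -[leRHS]mul1r ler_pM ?face_cutoff_le1.
Qed.

Lemma box_bump0 a b m x : ~ obox a b x -> box_bump a b m x = 0.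
Proof.
move=> /existsNP[k /negP]; rewrite negb_and -!leNgt => xk.
rewrite /box_bump (bigD1 k)//= !face_cutoffE /side_dist; case/orP: xk => xk.
  rewrite bump_le0 ?mul0r// subr_le0 mul1r.
  by apply: (@le_trans _ _ 0) => //; apply: mulr_ge0_le0 => //; lra.
rewrite [X in _ * X * _]bump_le0 ?mulr0 ?mul0r// subr_le0.
by apply: (@le_trans _ _ 0) => //; apply: mulr_ge0_le0 => //; lra.
Qed.

Lemma box_bump_cvg a b x : obox a b x -> box_bump a b m x @[m --> \oo] --> (1 : R).
Proof.
move=> xab.
have -> : 1 = \prod_(k < n) (1 : R) by rewrite big1.
apply: cvg_big => [|k _]; first exact: mul_continuous.
rewrite -[X in _ --> X]mulr1.
have [xa xb] : 0 < side_dist k (a ord0 k) 1 x /\ 0 < side_dist k (b ord0 k) (-1) x.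
  by rewrite /side_dist; have := xab k; lra.
have [ca _] := cvg_mul_nat_bump xa; have [cb _] := cvg_mul_nat_bump xb.
apply: cvgM; under eq_fun do rewrite face_cutoffE; [exact: ca|exact: cb].
Qed.

Lemma test_box_bump a b m D : cbox a b `<=` D -> test_function D (box_bump a b m).
Proof.
move=> abD; have sub : supp (box_bump a b m) `<=` cbox a b.
  apply: support_subP; first exact: closed_cbox.
  by move=> x xab; apply: box_bump0 => /obox_cbox.
split; first exact: smooth_box_bump.
  apply: (subclosed_compact _ _ sub); [exact: support_closed|exact: compact_cbox].
exact: subset_trans abD.
Qed.

Lemma test_integral_box D f a b : cbox a b `<=` D -> L1 (f \_ (cbox a b)) ->
  (forall phi, test_function D phi -> \int[mu]_(x in D) (f x * phi x) = 0) ->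
  \int[mu]_x (f \_ (obox a b)) x = 0.
Proof.
move=> abD If H.
have H0 m : \int[mu]_x ((f \_ (cbox a b)) x * box_bump a b m x) = 0.
  rewrite -[RHS](H _ (test_box_bump m abD)) [RHS]Rintegral_mkcond.
  apply: eq_Rintegral => x _; rewrite !patchE.
  have [xab|xab] := pselect (cbox a b x); first by rewrite !mem_set//; exact: abD.
  rewrite (memNset xab) mul0r box_bump0 ?mulr0; last by move=> /obox_cbox.
  by case: ifP.
have c : \int[mu]_x ((f \_ (cbox a b)) x * box_bump a b m x) @[m --> \oo] -->
    \int[mu]_x (f \_ (obox a b)) x.
  apply: (@Rint_dominated _ _ _ _ (fun x => `|(f \_ (cbox a b)) x|)).
  - move=> m; apply: measurable_funM; first exact: L1_measurable.
    by apply: measurable_continuous; apply: smooth_continuous; exact: smooth_box_bump.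
  - move=> x; have [xab|xab] := pselect (obox a b x).
      rewrite !patchE (mem_set xab) mem_set; last exact: obox_cbox.
      rewrite -[X in _ --> X]mulr1; apply: cvgM; first exact: cvg_cst.
      exact: box_bump_cvg.
    rewrite [X in _ --> X]patchE (memNset xab).
    by under eq_fun do rewrite box_bump0// mulr0; exact: cvg_cst.
  - exact: L1_norm.
  - by move=> m x; rewrite normrM ler_piMr// box_bump_norm.
move: c; under eq_fun do rewrite H0.
by move=> /(cvg_lim (@Rhausdorff R)) <-; rewrite lim_cst.
Qed.

(** The sets on which [h] integrates to 0 form a Dynkin system, the total integral being 0 for the
    sake of complements, and open boxes form a generating pi-system. *)
Lemma integral_obox_eq0 (h : V -> R) : L1 h -> \int[mu]_x h x = 0 ->
  (forall a b, \int[mu]_x (h \_ (obox a b)) x = 0) ->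
  \forall x \ae mu, h x = 0.
Proof.
move=> Ih h0 H.
have E0 (A : set V) : measurable A -> \int[mu]_x (h \_ A) x = 0 ->
    (\int[mu]_(x in A) (h x)%:E = 0)%E.
  move=> mA; rewrite integral_mkcond.
  have -> : ((fun x => (h x)%:E) \_ A) = EFin \o (h \_ A).
    by apply/funext => x; rewrite /= !patchE; case: ifP.
  rewrite /Rintegral => fine0.
  rewrite -[LHS]fineK ?fine0//.
  by apply: integrable_fin_num; rewrite //; exact: L1_restrict.
have K : forall A, <<s [set A | exists a b, A = obox a b] >> A ->
    (\int[mu]_(x in A) (h x)%:E = 0)%E.
  have mT : (\int[mu]_x (h x)%:E = 0)%E.
    by have := E0 setT measurableT; rewrite patch_setT; apply.
  apply: (@dynkin_induction _ _ _ (fun A => \int[mu]_(x in A) (h x)%:E = 0)%E) => //.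
  - by apply: (measurable_boxes (K := @obox R n)); [by move=> a b x|exact: obox_cbox|exact: measurable_obox].
  - exact: obox_setI.
  - by move=> _ [a [b ->]]; apply: E0; [exact: measurable_obox|exact: H].
  - move=> A mA A0; have := @integral_setU _ _ _ mu A (~` A) (EFin \o h) mA (measurableC mA).
    rewrite setUv A0 add0e mT => <- //; first exact: measurable_int Ih.
    by apply/disj_setPS => x [].
  - move=> F mF tF F0; rewrite integral_bigcup//.
      by apply: eseries0 => i _ _; exact: F0.
    by apply: integrableS Ih => //; exact: bigcup_measurable.
have := @integral_ae_eq _ _ _ mu setT measurableT (cst 0%E) (EFin \o h) Ih (measurable_cst _).
move=> /(_ _)[].
  move=> A _ mA; rewrite K ?integral0//.
  rewrite -(measurable_boxes (K := @obox R n)); [exact: mA|by move=> a b x|exact: obox_cbox|exact: measurable_obox].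
move=> N [mN N0 sub]; exists N; split=> // x hx; apply: sub => /= H'.
by apply: hx; have := H' I => -[].
Qed.

(** Since [f] is integrable only locally, the argument is run on each rational box whose closure
    lies in [D]. These boxes cover [D] and are countably many, so the exceptional sets have a null
    union. *)
Lemma fundamental_lemma D f : open D ->
  (forall a b, cbox a b `<=` D -> L1 (f \_ (cbox a b))) ->
  (forall phi, test_function D phi -> \int[mu]_(x in D) (f x * phi x) = 0) ->
  \forall x \ae mu, D x -> f x = 0.
Proof.
move=> oD If H.
pose B (ck : 'rV[rat]_n * nat) : set V := obox (rat_lo R ck) (rat_hi R ck).
(* Indexing the boxes by natural numbers prepares for [ae_foralln]; numbers that code no box impose
   nothing. *)
pose P i x := if unpickle i is Some ck then
  cbox (rat_lo R ck) (rat_hi R ck) `<=` D -> B ck x -> f x = 0 else True.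
have : \forall x \ae mu, forall i, P i x.
  apply: ae_foralln => i; rewrite /P; case: unpickle => [ck|]; last exact: nearW.
  have [ckD|ckD] := pselect (cbox (rat_lo R ck) (rat_hi R ck) `<=` D); last exact: nearW.
  have Ic := If _ _ ckD.
  have Eo : f \_ (B ck) = (f \_ (cbox (rat_lo R ck) (rat_hi R ck))) \_ (B ck).
    apply/funext => x; rewrite !patchE; case: ifPn => // /set_mem xB.
    by rewrite mem_set//; exact: obox_cbox.
  have Io : L1 (f \_ (B ck)) by rewrite Eo; apply: L1_restrict => //; exact: measurable_obox.
  have : \forall x \ae mu, (f \_ (B ck)) x = 0.
    apply: integral_obox_eq0 => //; first
      by have := @test_integral_box D f _ _ ckD Ic H.
    move=> a b; set lo := rat_lo R ck; set hi := rat_hi R ck.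
    have -> : (f \_ (B ck)) \_ (obox a b) = f \_ (obox (boxI Num.max a lo) (boxI Num.min b hi)).
      by rewrite -patch_setI oboxI.
    have sub : cbox (boxI Num.max a lo) (boxI Num.min b hi) `<=` cbox lo hi.
      by rewrite -cboxI => x [].
    apply: (@test_integral_box D f _ _ _ _ H); first exact: subset_trans ckD.
    apply: If; exact: subset_trans ckD.
  apply: filterS => x; rewrite patchE => + _ xB; by rewrite mem_set.
apply: filterS => x Px Dx; have [ck [xck ckD]] := open_rat_box oD Dx.
by have := Px (pickle ck); rewrite /P pickleK; apply.
Qed.

End fundamental_lemma.

Section sobolev_facts.
Context (R : realType) (n : nat).
Local Notation V := 'rV[R]_n.
Local Notation mu := (rV_lebesgue R n).
Implicit Types (u v w f phi : V -> R) (g h : V -> V) (D K : set V) (x : V) (p q : R) (i : 'I_n).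

Lemma L1_locally D f K : locally_integrable_on D f -> compact K -> K `<=` D -> L1 (f \_ K).
Proof.
move=> [_ H] cK KD; have mK : measurable K.
  rewrite -[K]setCK; apply: measurableC; apply: open_measurable_rV; apply: closed_openC.
  by apply: compact_closed cK; exact: norm_hausdorff.
have /(integrable_mkcond _ mK) := H K cK KD; congr integrable.
by apply/funext => x; rewrite /= !patchE; case: ifP.
Qed.

Lemma test_patch D f phi : test_function D phi ->
  (fun x => f x * phi x) \_ D = (f \_ (supp phi)) * phi.
Proof.
move=> [_ _ sD]; apply/funext => x; rewrite fctE !patchE.
have [sx|sx] := pselect (supp phi x); first by rewrite !mem_set//; exact: sD.
by rewrite (memNset sx) mul0r (support_out sx) mulr0; case: ifP.
Qed.

Lemma L1_test_patch D f phi : locally_integrable_on D f -> test_function D phi ->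
  L1 ((fun x => f x * phi x) \_ D).
Proof.
move=> lf tphi; rewrite test_patch//; have [_ cK sD] := tphi.
exact: L1_test (L1_locally lf cK sD) tphi.
Qed.

Lemma weak_gradient_unique D u g h : open D -> weak_gradient D u g -> weak_gradient D u h ->
  forall i, \forall x \ae mu, D x -> g x ord0 i = h x ord0 i.
Proof.
move=> oD [lu lg Hg] [_ lh Hh] i.
have : \forall x \ae mu, D x -> g x ord0 i - h x ord0 i = 0.
  apply: fundamental_lemma => //.
    move=> a b abD; have c := @compact_cbox R n a b.
    have := L1B (L1_locally (lg i) c abD) (L1_locally (lh i) c abD); congr L1.
    by apply/funext => x; rewrite !fctE !patchE; case: ifP => // _; rewrite subr0.
  move=> phi tphi; have := Hg i phi tphi; rewrite (Hh i phi tphi) => /oppr_inj E.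
  have Ig := L1_test_patch (lg i) tphi; have Ih := L1_test_patch (lh i) tphi.
  rewrite Rintegral_mkcond.
  have -> : \int[mu]_x ((fun x => (g x ord0 i - h x ord0 i) * phi x) \_ D) x =
     \int[mu]_x (((fun x => g x ord0 i * phi x) \_ D) x + (- ((fun x => h x ord0 i * phi x) \_ D)) x).
    apply: eq_Rintegral => x _; rewrite fctE !patchE; case: ifP => _; last by rewrite subr0.
    by rewrite mulrBl.
  rewrite RintD//; last exact: L1N.
  by rewrite RintN// -!Rintegral_mkcond E subrr.
by apply: filterS => x H /H /eqP; rewrite subr_eq0 => /eqP.
Qed.

Lemma energy_ae s f1 f2 : measurable_fun setT f1 -> measurable_fun setT f2 ->
  (\forall x \ae mu, f1 x = f2 x) -> energy s f1 = energy s f2.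
Proof.
move=> m1 m2 E; apply: ge0_ae_eq_integral => //.
- exact: measurable_powR_norm.
- exact: measurable_powR_norm.
- by apply: filterS E => x /= -> _.
Qed.

Lemma Lp_normE D p f : Lp_norm D p f = (energy p (f \_ D) `^ p^-1)%E.
Proof.
rewrite /Lp_norm unlock; by congr (_ `^ _)%E; apply: eq_integral => x _.
Qed.

Lemma Lp_norm_poweR D p f : p != 0 -> (Lp_norm D p f `^ p)%E = energy p (f \_ D).
Proof. by move=> p0; rewrite Lp_normE -poweRrM mulVf// poweRe1// energy_ge0. Qed.

Lemma Lp_norm_ge0 D p f : (0 <= Lp_norm D p f)%E.
Proof. by rewrite Lp_normE poweR_ge0. Qed.

Lemma Lp_norm_le D p f (k : R) : 0 < p -> 0 <= k ->
  (energy p (f \_ D) <= k%:E)%E -> (Lp_norm D p f <= (k `^ p^-1)%:E)%E.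
Proof.
move=> p0 k0 fk; rewrite Lp_normE -poweR_EFin.
apply: gt0_ler_poweR => //; first by rewrite invr_ge0 ltW.
  by rewrite in_itv/= leey energy_ge0.
by rewrite in_itv/= leey lee_fin k0.
Qed.

Lemma energy_le_Lp_norm D p f (N : R) : 0 < p -> 0 <= N ->
  (Lp_norm D p f <= N%:E)%E -> (energy p (f \_ D) <= (N `^ p)%:E)%E.
Proof.
move=> p0 N0 fN; rewrite -Lp_norm_poweR ?gt_eqF// -poweR_EFin.
apply: gt0_ler_poweR => //; first exact: ltW.
  by rewrite in_itv/= leey Lp_norm_ge0.
by rewrite in_itv/= leey lee_fin N0.
Qed.

Lemma coord_le_enorm (y : V) i : `|y ord0 i| <= enorm y.
Proof.
rewrite -sqrtr_sqr /enorm ler_wsqrtr// (bigD1 i)//= lerDl.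
by apply: sumr_ge0 => j _; exact: sqr_ge0.
Qed.

Lemma enorm_le (y : V) : enorm y <= \sum_i `|y ord0 i|.
Proof.
have S0 : 0 <= \sum_i `|y ord0 i| by apply: sumr_ge0.
rewrite -[leRHS]ger0_norm// -sqrtr_sqr /enorm ler_wsqrtr//.
rewrite expr2 mulr_suml; apply: ler_sum => i _.
rewrite -normr_id -real_normK ?num_real// normr_id expr2 ler_wpM2l//.
by rewrite (bigD1 i)//= lerDl sumr_ge0.
Qed.

Lemma powR_sum_le (I : Type) (s : seq I) (F : I -> R) q : 0 < q -> (forall j, 0 <= F j) ->
  (\sum_(j <- s) F j) `^ q <= (2 `^ q) ^+ size s * \sum_(j <- s) F j `^ q.
Proof.
move=> q0 F0; have one : 1 <= 2 `^ q :> R.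
  have E : 1 = 1 `^ q :> R by rewrite powR1.
  by rewrite [leLHS]E; apply: ge0_ler_powR; rewrite ?nnegrE ?ltW//; lra.
elim: s => [|j s IH]; first by rewrite !big_nil mulr0 powR0// gt_eqF.
rewrite !big_cons /= exprS.
have S0 : 0 <= \sum_(j <- s) F j by exact: sumr_ge0.
apply: (le_trans (powRD_le (ltW q0) (F0 j) S0)).
rewrite -mulrA ler_wpM2l ?powR_ge0// mulrDr lerD//.
by rewrite ler_peMl ?powR_ge0// exprn_ege1.
Qed.

Lemma measurable_enorm g : (forall i, measurable_fun setT (fun x => g x ord0 i)) ->
  measurable_fun setT (@enorm R n \o g).
Proof.
move=> mg; apply: (@measurableT_comp _ _ _ _ _ _ (@Num.sqrt R)).
  exact: continuous_measurable_fun (@sqrt_continuous R).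
by apply: measurable_sum => i; apply: measurable_funX; exact: mg.
Qed.

Lemma energy_enorm q g k : 0 < q -> 0 <= k ->
  (forall i, measurable_fun setT (fun x => g x ord0 i)) ->
  (forall i, energy q (fun x => g x ord0 i) <= k%:E)%E ->
  (energy q (@enorm R n \o g) <= ((2 `^ q) ^+ n * (n%:R * k))%:E)%E.
Proof.
move=> q0 k0 mg gk; rewrite /energy.
have M i := measurable_powR_norm q (mg i).
apply: (@le_trans _ _ (\int[mu]_x (((2 `^ q) ^+ n)%:E * (\sum_(i < n) (`|g x ord0 i| `^ q)%:E)))%E).
  apply: ge0_le_integral; first exact: measurableT.
  - by move=> x _; rewrite lee_fin powR_ge0.
  - by apply: measurable_powR_norm; exact: measurable_enorm.
  - by apply: measurable_funeM; apply: emeasurable_sum => i; exact: M.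
  move=> x _; rewrite sumEFin -EFinM lee_fin.
  have := powR_sum_le (index_enum 'I_n) q0 (fun i => normr_ge0 (g x ord0 i)).
  rewrite [size _](_ : _ = n); last by rewrite -sum1_size big_const_ord iter_addn_0 mul1n.
  apply: le_trans; apply: ge0_ler_powR; rewrite ?nnegrE ?(ltW q0)// ?sumr_ge0//.
  by rewrite ger0_norm ?enorm_le// sqrtr_ge0.
rewrite ge0_integralZl//.
- rewrite ge0_integral_sum//.
  rewrite EFinM lee_wpmul2l ?lee_fin ?exprn_ge0 ?powR_ge0//.
  apply: (le_trans (lee_sum (index_enum 'I_n) (fun i _ => gk i))).
  by rewrite sumEFin lee_fin sumr_const card_ord mulr_natl.
- by apply: emeasurable_sum => i; exact: M.
- by move=> x _; apply: sume_ge0 => i _; rewrite lee_fin powR_ge0.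
Qed.

End sobolev_facts.

Section extension_domains.
Context (R : realType) (n : nat).
Local Notation V := 'rV[R]_n.
Local Notation mu := (rV_lebesgue R n).
Implicit Types (u v w f phi : V -> R) (g h : V -> V) (D K : set V) (x : V) (p q : R) (i : 'I_n).

Lemma weak_grad0_weak_gradient u (g : 'I_n -> V -> R) :
  weak_grad0 setT u g -> weak_gradient setT u (fun x => \row_i g i x).
Proof.
move=> [Iu Ig _ _ H]; have loc f : L1 f -> locally_integrable_on setT f.
  move=> If; split; first exact: L1_measurable.
  move=> K cK _; apply: integrableS If => //.
  rewrite -[K]setCK; apply: measurableC; apply: open_measurable_rV; apply: closed_openC.
  by apply: compact_closed cK; exact: norm_hausdorff.
have E i : (fun x => (\row_i g i x) ord0 i) = g i by apply/funext => x; rewrite mxE.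
split; first exact: loc.
  by move=> i; rewrite E; exact: loc.
by move=> i phi tphi; rewrite H//; congr (- _); apply: eq_Rintegral => x _; rewrite mxE.
Qed.

Lemma grad_weak_gradient D u g : weak_gradient D u g -> weak_gradient D u (grad D u).
Proof. by move=> ug; apply: (@xgetPex _ (cst 0) (weak_gradient D u)); exists g. Qed.

Definition sobolev_const q : R := 1 + ((2 `^ q) ^+ n * n%:R) `^ q^-1.

(** The norm is computed with the chosen [grad], which need only agree with [g] almost everywhere;
    uniqueness carries the bounds over. *)
Lemma sobolev_norm_le q k u (g : 'I_n -> V -> R) : 0 < q -> 0 <= k ->
  weak_grad0 setT u g -> (energy q u <= k%:E)%E -> (forall i, (energy q (g i) <= k%:E)%E) ->
  sobolev_space setT q u /\
  (sobolev_norm setT q u <= (sobolev_const q * k `^ q^-1)%:E)%E.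
Proof.
move=> q0 k0 ug uk gk; have [Iu Ig _ _ _] := ug.
have Wg := weak_grad0_weak_gradient ug; set G := (fun x => _) in Wg.
have GE i : (fun x => G x ord0 i) = g i by apply/funext => x; rewrite mxE.
have fin f c : (energy q f <= c%:E)%E -> 0 <= c -> (Lp_norm setT q f <= (c `^ q^-1)%:E)%E.
  by move=> fc c0; apply: Lp_norm_le => //; rewrite patch_setT.
split.
  split; first by split; [exact: L1_measurable|exact: le_lt_trans (fin _ _ uk k0) (ltry _)].
  exists G => // i; rewrite GE; split; first exact: L1_measurable.
  exact: le_lt_trans (fin _ _ (gk i) k0) (ltry _).
have Wh := grad_weak_gradient Wg; set h := grad setT u in Wh *.
have mh i : measurable_fun setT (fun x => h x ord0 i) by have [_ /(_ i)[]] := Wh.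
have hk i : (energy q (fun x => h x ord0 i) <= k%:E)%E.
  apply: le_trans (gk i); rewrite le_eqVlt; apply/orP; left; apply/eqP.
  apply: energy_ae; [exact: mh|exact: L1_measurable|].
  have := weak_gradient_unique openT Wh Wg i.
  by apply: filterS => x /(_ I); rewrite -GE.
rewrite /sobolev_norm /sobolev_const mulrDl mul1r EFinD; apply: leeD; first exact: fin.
have c0 : 0 <= (2 `^ q) ^+ n * n%:R :> R by rewrite mulr_ge0// exprn_ge0// powR_ge0.
rewrite -powRM//; apply: fin; last by rewrite mulr_ge0.
by rewrite -mulrA; exact: energy_enorm.
Qed.

Lemma weak_gradient_ae D u v g : open D -> measurable_fun D v ->
  (\forall x \ae mu, D x -> u x = v x) -> weak_gradient D u g -> weak_gradient D v g.
Proof.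
move=> oD mv E [[mu_ lu] lg H].
have mD : measurable D by exact: open_measurable_rV.
split=> //.
  split=> // K cK KD; have mK : measurable K.
    rewrite -[K]setCK; apply: measurableC; apply: open_measurable_rV; apply: closed_openC.
    by apply: compact_closed cK; exact: norm_hausdorff.
  have /integrableP[muK fK] := lu K cK KD; have mvK := measurable_funS mD KD mv.
  apply/integrableP; split; first exact/measurable_EFinP.
  rewrite (@ge0_ae_eq_integral _ _ _ mu K _ (fun x => `|(EFin \o u) x|%E))//.
  - by apply: measurableT_comp => //; exact/measurable_EFinP.
  - by apply: measurableT_comp.
  - by apply: filterS E => x /= + Kx => -> //; exact: KD.
move=> i phi tphi; rewrite -H// /Rintegral; congr fine.
have mdphi : measurable_fun D (partial i phi).
  by apply: measurable_funTS; exact: test_measurable (test_partial i tphi).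
apply: ae_eq_integral => //.
- by apply/measurable_EFinP; exact: measurable_funM.
- by apply/measurable_EFinP; exact: measurable_funM.
- by apply: filterS E => x /= + Dx => -> //.
Qed.

Lemma sobolev_norm_ae D p u v : open D -> measurable_fun D u -> measurable_fun D v ->
  (\forall x \ae mu, D x -> u x = v x) -> sobolev_norm D p u = sobolev_norm D p v.
Proof.
move=> oD mu_ mv E; have mD : measurable D by exact: open_measurable_rV.
have E' : \forall x \ae mu, D x -> v x = u x by apply: filterS E => x + Dx => ->.
(* Both functions have the same set of weak gradients, so the choice returns the very same
   function. *)
have gradE : grad D u = grad D v.
  rewrite /grad; congr xget; apply/seteqP; split=> g; exact: weak_gradient_ae.
rewrite /sobolev_norm gradE; congr (_ + _)%E; rewrite !Lp_normE; congr (_ `^ _)%E; apply: energy_ae.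
- exact/(measurable_restrictT u mD).
- exact/(measurable_restrictT v mD).
- by apply: filterS E => x; rewrite !patchE; case: ifPn => // /set_mem Dx ->.
Qed.

(** [E u] is chosen from a set of extensions that depends only on the class of [u] modulo null sets,
    so functions equal almost everywhere have identical images. *)
Lemma extension_domain_of_bound D p q (C : R) : 1 <= q <= p -> bounded_domain D -> 0 < C ->
  (forall u g N, 0 < N -> weak_gradient D u g -> (energy p (u \_ D) <= (N `^ p)%:E)%E ->
    (forall i, (energy p ((fun x => g x ord0 i) \_ D) <= (N `^ p)%:E)%E) ->
    exists w, [/\ sobolev_space setT q w, forall x, D x -> w x = u x &
      (sobolev_norm setT q w <= (C * N)%:E)%E]) ->
  sobolev_extension_domain p q D.
Proof.
move=> /andP[q1 qp] bD C0 H; have [oD _ _ _] := bD.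
have mD : measurable D by exact: open_measurable_rV.
have p0 : 0 < p by lra.
(* The premise takes a positive bound [N] and so yields nothing proportional to a zero norm. No
   bound is asked for then: such a [u] is 0 almost everywhere and does not count in the operator
   norm. *)
pose good u := [set w | [/\ sobolev_space setT q w,
  \forall x \ae mu, D x -> w x = u x &
  sobolev_norm D p u = 0%E \/ (sobolev_norm setT q w <= C%:E * sobolev_norm D p u)%E]].
have good0 u : sobolev_space D p u -> good u !=set0.
  move=> [[mu_ uoo] [g ug goo]].
  have aew w : (forall x, D x -> w x = u x) -> \forall x \ae mu, D x -> w x = u x.
    by move=> wu; apply: nearW.
  have s0 : (0 <= sobolev_norm D p u)%E by rewrite adde_ge0 ?Lp_norm_ge0.
  have fin f : (Lp_norm D p f < +oo)%E -> (0 <= Lp_norm D p f)%E -> Lp_norm D p f \is a fin_num.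
    by move=> f1 f2; rewrite ge0_fin_numE.
  (* A crude bound through the given [g]; it provides some extension when the norm is 0 or
     infinite. *)
  have all_fin : exists2 N : R, 0 < N & (Lp_norm D p u <= N%:E)%E /\
      forall i, (Lp_norm D p (fun x => g x ord0 i) <= N%:E)%E.
    pose N : R := 1 + fine (Lp_norm D p u) + \sum_i fine (Lp_norm D p (fun x => g x ord0 i)).
    have f0 f : 0 <= fine (Lp_norm D p f) by rewrite fine_ge0// Lp_norm_ge0.
    have S0 : 0 <= \sum_i fine (Lp_norm D p (fun x => g x ord0 i)).
      by apply: sumr_ge0 => i _; exact: f0.
    have u0 := f0 u.
    exists N; first by rewrite /N; lra.
    split.
      by rewrite -[leLHS]fineK ?fin ?Lp_norm_ge0// lee_fin /N; lra.
    move=> i; have [_ gi] := goo i.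
    rewrite -[leLHS]fineK ?fin ?Lp_norm_ge0// lee_fin /N (bigD1 i)//=.
    have := sumr_ge0 _ (fun j (_ : j != i) => f0 (fun x => g x ord0 j)).
    by move=> /(_ (index_enum 'I_n)); lra.
  have [N1 N10 [uN1 gN1]] := all_fin.
  have [w0 [Sw0 wu0 _]] := H u g N1 N10 ug (energy_le_Lp_norm p0 (ltW N10) uN1)
      (fun i => energy_le_Lp_norm p0 (ltW N10) (gN1 i)).
  have [N0|N0] := eqVneq (sobolev_norm D p u) 0%E.
    by exists w0; split=> //; [exact: aew|left].
  (* The norm involves [grad D u], not yet compared with [g]; were it infinite, the bound would be
     trivial. *)
  have [Noo|Noo] := eqVneq (sobolev_norm D p u) +oo%E.
    exists w0; split=> //; [exact: aew|right].
    by rewrite Noo gt0_muley ?lte_fin// leey.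
  have Nfin : sobolev_norm D p u \is a fin_num.
    by rewrite ge0_fin_numE// ltey.
  pose N := fine (sobolev_norm D p u).
  have NE : sobolev_norm D p u = N%:E by rewrite fineK.
  have Npos : 0 < N by rewrite fine_gt0// lt0e N0 s0 ltey.
  have ug' := grad_weak_gradient ug; have [lu lg _] := ug'.
  have un : (Lp_norm D p u <= N%:E)%E by rewrite -NE leeDl// Lp_norm_ge0.
  have gn i : (energy p ((fun x => grad D u x ord0 i) \_ D) <= (N `^ p)%:E)%E.
    have en : (energy p ((@enorm R n \o grad D u) \_ D) <= (N `^ p)%:E)%E.
      by apply: energy_le_Lp_norm => //; [exact: ltW|rewrite -NE leeDr// Lp_norm_ge0].
    apply: le_trans en; apply: energy_le; first exact: ltW.
    - by apply/(measurable_restrictT _ mD); have [] := lg i.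
    - apply/(measurable_restrictT _ mD).
      apply: (measurableT_comp (f := @Num.sqrt R)).
        exact: continuous_measurable_fun (@sqrt_continuous R).
      by apply: measurable_sum => j; apply: measurable_funX; have [] := lg j.
    - move=> x; rewrite !patchE; case: ifP => // _.
      by rewrite [leRHS]ger0_norm ?coord_le_enorm// sqrtr_ge0.
  have [w [Sw wu wn]] := H u _ N Npos ug' (energy_le_Lp_norm p0 (ltW Npos) un) gn.
  by exists w; split=> //; [exact: aew|right; rewrite NE -EFinM].
pose E u := xget (cst 0 : V -> R) (good u).
have EP u : sobolev_space D p u -> good u (E u).
  by move=> /good0[w wg]; apply: (@xgetPex _ (cst 0) (good u)); exists w.
split; [by rewrite q1|by []|exists E].
- split=> [u /EP[]//|u v Su Sv uv|u /EP[]//].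
  suff -> : E u = E v by exact: nearW.
  have uv' : \forall x \ae mu, D x -> u x = v x := uv.
  have [[mu_ _] _] := Su; have [[mv _] _] := Sv.
  rewrite /E /good (sobolev_norm_ae p oD mu_ mv uv'); congr xget.
  apply/seteqP; split=> w [Sw wu nw]; split=> //.
    by apply: filterS2 wu uv' => x H1 H2 Dx; rewrite H1// H2.
  by apply: filterS2 wu uv' => x H1 H2 Dx; rewrite H1// H2.
- apply: (@le_lt_trans _ _ C%:E); last exact: ltry.
  apply: ge_ereal_sup => _ [u [Su nu] <-].
  have b0 : (0 <= sobolev_norm D p u)%E by rewrite adde_ge0 ?Lp_norm_ge0.
  have [n0|n0] := eqVneq (sobolev_norm D p u) 0%E.
    exfalso; apply: nu; have [[mu_ _] _] := Su.
    have L0 : Lp_norm D p u = 0%E.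
      apply/eqP; rewrite eq_le Lp_norm_ge0 andbT -n0.
      by rewrite leeDl// Lp_norm_ge0.
    have mr : measurable_fun setT (EFin \o (u \_ D)).
      by apply/measurable_EFinP; exact/(measurable_restrictT u mD).
    have := @Lnorm_eq0_eq0 _ _ _ mu (EFin \o (u \_ D)) p%:E mr _ L0.
    rewrite lte_fin => /(_ p0).
    by apply: filterS => x /= /(_ I) + Dx; rewrite patchE mem_set// => -[].
  have [_ _ [/eqP|]] := EP u Su; first by rewrite (negbTE n0).
  move: b0 n0; case: (sobolev_norm D p u) => [r| |]//; last first.
    by move=> _ _ _; rewrite invey mule0 lee_fin ltW.
  rewrite lee_fin eqe => r0 rn0 H1; rewrite inver (negbTE rn0) lee_pdivrMr//.
  by rewrite lt_def rn0.
Qed.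

End extension_domains.

(** * The domain *)

Lemma half_eseries_le (R : realType) (a : R) : 0 <= a ->
  (\sum_(i <oo) (a * (1 / 2) ^+ i)%:E <= (2 * a)%:E)%E.
Proof.
move=> a0; apply: lime_le.
  by apply: is_cvg_nneseries => i _ _; rewrite lee_fin mulr_ge0// exprn_ge0.
apply: nearW => N; rewrite sumEFin lee_fin.
suff -> : \sum_(0 <= i < N) a * (1 / 2) ^+ i = 2 * a * (1 - (1 / 2) ^+ N).
  by rewrite ler_piMr ?mulr_ge0// gerBl exprn_ge0.
elim: N => [|N IH]; first by rewrite big_geq// expr0 subrr mulr0.
by rewrite big_nat_recr//= IH exprS; field.
Qed.

Section tentacles.
Context (R : realType) (m : nat).
Local Notation V := 'rV[R]_m.+1.
Local Notation mu := (rV_lebesgue R m.+1).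
Implicit Types (c x y : V) (r : R) (i j : nat) (k : 'I_m.+1) (A : set V).

(* The coordinate [ord0] is the axis of the tentacles; a tentacle is a thin box
   around a segment of this axis. *)
Definition radii r : V := \row_k if k == ord0 then 1 else r.
Definition tentacle c r : set V := obox (c - radii r) (c + radii r).
Definition tentacle2 c r : set V := cbox (c - radii r *+ 2) (c + radii r *+ 2).
(** The doubled tentacle prolonged along its whole axis, so that disjointness and density concern
    the cross-section only. *)
Definition column c r : set V := [set x | forall k, k != ord0 -> `|x ord0 k - c ord0 k| <= r *+ 2].
(** Its cross-section has a margin 1 around the unit cube of the centres, enough for radii up to
    1/2. *)
Definition base : set V := obox (\row_k (-1)) (\row_k if k == ord0 then 0 else 2).

Lemma radiiE r k : radii r ord0 k = if k == ord0 then 1 else r.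
Proof. by rewrite mxE. Qed.

Lemma tentacleP c r x : c ord0 ord0 = 0 ->
  tentacle c r x <-> `|x ord0 ord0| < 1 /\ forall k, k != ord0 -> `|x ord0 k - c ord0 k| < r.
Proof.
move=> c0; split=> [H|[H0 H] k].
  split; first by have := H ord0; rewrite !mxE eqxx c0 ltr_norml; lra.
  by move=> k k0; have := H k; rewrite !mxE (negbTE k0) ltr_norml; lra.
rewrite !mxE; case: eqVneq => [->|k0].
  by move: H0; rewrite c0 ltr_norml; lra.
by have := H k k0; rewrite ltr_norml; lra.
Qed.

Lemma tentacle2_column c r : tentacle2 c r `<=` column c r.
Proof.
by move=> x H k k0; have := H k; rewrite !mxE (negbTE k0) ler_norml !mulr2n; lra.
Qed.

Lemma column_tentacle2 c r x : c ord0 ord0 = 0 -> `|x ord0 ord0| <= 2 -> column c r x ->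
  tentacle2 c r x.
Proof.
move=> c0 x0 H k; rewrite !mxE; case: eqVneq => [->|k0].
  by move: x0; rewrite c0 ler_norml !mulr2n; lra.
by have := H k k0; rewrite ler_norml !mulr2n; lra.
Qed.

Lemma closed_column c r : closed (column c r).
Proof.
have -> : column c r = \bigcap_(k in [set k | k != ord0])
    ((fun x : V => x ord0 k) @^-1` `[c ord0 k - r *+ 2, c ord0 k + r *+ 2]).
  apply/seteqP; split=> x H k k0; have := H k k0; rewrite /= in_itv/= ler_norml; lra.
apply: closed_bigI => k _; apply: closed_comp; last exact: itv_closed.
by move=> x _; exact: coord_continuous.
Qed.

(** Rational points clamped to the unit cube of the cross-section. Clamping does not increase the
    distance to a point of the cube, so density survives; a [j] that codes no point gives the
    origin. *)
Definition dense_pt j : V := if unpickle j is Some q then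
  \row_k (if k == ord0 then 0 else Num.min 1 (Num.max 0 (ratr ((q : 'rV[rat]_m.+1) ord0 k))))
  else 0.

Lemma dense_pt0 j : dense_pt j ord0 ord0 = 0.
Proof. by rewrite /dense_pt; case: unpickle => [q|]; rewrite mxE ?eqxx. Qed.

Lemma dense_pt01 j k : 0 <= dense_pt j ord0 k <= 1.
Proof.
rewrite /dense_pt; case: unpickle => [q|]; rewrite mxE; last by rewrite lexx ler01.
case: ifP => _; first by rewrite lexx ler01.
by rewrite ge_min lexx /= le_min ler01 le_max lexx.
Qed.

Lemma dense_pt_dense x (e : R) : 0 < e -> (forall k, k != ord0 -> 0 <= x ord0 k <= 1) ->
  exists j, forall k, k != ord0 -> `|x ord0 k - dense_pt j ord0 k| < e.
Proof.
move=> e0 x01; have c_ k : {q : rat | `|x ord0 k - ratr q| < e}.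
  apply: cid; have /rat_in_itvoo[q] : x ord0 k - e < x ord0 k + e by lra.
  rewrite in_itv/= => /andP[q1 q2]; exists q; rewrite ltr_norml; lra.
exists (pickle (\row_k sval (c_ k))) => k k0; rewrite /dense_pt pickleK mxE (negbTE k0) mxE.
case: (c_ k) => q /=; have := x01 k k0; rewrite !ltr_norml => ? ?.
by case: (leP (0 : R) (ratr q)) => h1; [case: (leP (1 : R) (ratr q)) => h2|rewrite (min_r ler01)]; lra.
Qed.

(** * Greedy choice of the radii *)

Section greedy.
Variable eps : nat -> R.
Hypothesis eps0 : forall j, 0 < eps j.

(* The radius is [0], i.e. there is no [j]-th tentacle, when no radius is
   admissible; then the [j]-th centre lies in an earlier column. *)
Definition greedy_radius j A : R :=
  xget 0 [set r | 0 < r <= eps j /\ column (dense_pt j) r `&` A = set0].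

Fixpoint taken j : set V := if j is i.+1 then
  taken i `|` [set x | 0 < greedy_radius i (taken i) /\
    column (dense_pt i) (greedy_radius i (taken i)) x]
  else set0.

Definition rad j : R := greedy_radius j (taken j).

Lemma radP j : 0 < rad j ->
  rad j <= eps j /\ column (dense_pt j) (rad j) `&` taken j = set0.
Proof.
rewrite /rad /greedy_radius; case: xgetP => [r -> [/andP[_ rj] H] _|_] //.
by rewrite ltxx.
Qed.

Lemma rad_le j : rad j <= eps j.
Proof.
have [/radP[]//|r0] := ltP 0 (rad j).
by rewrite (le_trans r0)// ltW.
Qed.

Lemma takenP j x : taken j x <-> exists i, [/\ (i < j)%N, 0 < rad i & column (dense_pt i) (rad i) x].
Proof.
elim: j => [|j IH] /=; first by split=> // -[i []].
split=> [[/IH[i [ij ri ci]]|[rj cj]]|[i [ij ri ci]]].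
- by exists i; split=> //; exact: ltnW.
- by exists j; split.
- move: ij; rewrite ltnS leq_eqVlt => /orP[/eqP E|ij]; first by right; rewrite -E.
  by left; apply/IH; exists i.
Qed.

Lemma columns_disjoint i j x : 0 < rad i -> 0 < rad j ->
  column (dense_pt i) (rad i) x -> column (dense_pt j) (rad j) x -> i = j.
Proof.
wlog ij : i j / (i <= j)%N.
  move=> H ri rj ci cj; have [/H|/ltnW/H H'] := leqP i j; first exact.
  by apply/esym; exact: H'.
move=> ri rj ci cj; move: ij; rewrite leq_eqVlt => /orP[/eqP//|ij].
have [_ E] := radP rj; exfalso.
have : (column (dense_pt j) (rad j) `&` taken j) x.
  by split=> //; apply/takenP; exists i.
by rewrite E.
Qed.

Lemma closed_taken j : closed (taken j).
Proof.
elim: j => [|j IH] /=; first exact: closed0.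
apply: closedU => //; rewrite -/(rad j).
have [r0|r0] := pselect (0 < rad j).
  rewrite (_ : [set x | _] = column (dense_pt j) (rad j)); first exact: closed_column.
  by apply/seteqP; split=> x // [].
rewrite (_ : [set x | _] = set0); first exact: closed0.
by apply/seteqP; split=> x // [].
Qed.

Lemma taken_column j x y : (forall k, k != ord0 -> x ord0 k = y ord0 k) -> taken j x -> taken j y.
Proof.
move=> xy /takenP[i [ij ri ci]]; apply/takenP; exists i; split=> //.
by move=> k k0; rewrite -xy//; exact: ci.
Qed.

(** A finite union of columns is closed and invariant along the axis, so [y] may first be moved to
    the height of [x]. *)
Lemma avoid_taken j x : ~ taken j x ->
  exists2 e : R, 0 < e & forall y, (forall k, k != ord0 -> `|x ord0 k - y ord0 k| < e) -> ~ taken j y.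
Proof.
move=> xj; have : nbhs x (~` taken j).
  by apply: open_nbhs_nbhs; split=> //; apply: closed_openC; exact: closed_taken.
move=> /nbhs_ballP[e /= e0 H]; exists e => // y xy.
pose y' : V := \row_k if k == ord0 then x ord0 ord0 else y ord0 k.
have yy' k : k != ord0 -> y ord0 k = y' ord0 k by move=> k0; rewrite mxE (negbTE k0).
move=> /(taken_column yy'); apply: H; apply: rV_ball => // k; rewrite mxE.
by case: eqVneq => [->|k0]; [rewrite subrr normr0|exact: xy].
Qed.

(** A centre off the earlier columns has a positive distance [e] to them, and a radius of at most
    [e / 4] gives a column of half-width at most [e / 2], which is admissible. *)
Lemma rad0_taken j : ~ (0 < rad j) -> taken j (dense_pt j).
Proof.
move=> r0; apply: contrapT => /avoid_taken[e e0 H]; apply: r0.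
rewrite /rad /greedy_radius; case: xgetP => [r -> [/andP[]//]|/(_ (Num.min (eps j) (e / 4)))].
case; split.
  by rewrite lt_min eps0 ge_min lexx divr_gt0.
apply/seteqP; split=> // y [cy ty]; apply: (H y) => // k k0.
have : Num.min (eps j) (e / 4) <= e / 4 by rewrite ge_min lexx orbT.
by have := cy k k0; rewrite distrC mulr2n; lra.
Qed.

Definition omega : set V := base `|` \bigcup_(j in [set j | 0 < rad j]) tentacle (dense_pt j) (rad j).

Hypothesis eps_half : forall j, eps j <= 1 / 2.
Hypothesis eps_cvg : forall e : R, 0 < e -> exists J, forall j, (J <= j)%N -> eps j < e.

Lemma tentacle_base j x : tentacle (dense_pt j) (rad j) x -> x ord0 ord0 < 0 -> base x.
Proof.
move=> /(tentacleP _ _ (dense_pt0 j))[H0 H] x0 k; rewrite !mxE.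
case: eqVneq => [->|k0]; first by move: H0; rewrite ltr_norml; lra.
have := H k k0; have := dense_pt01 j k; have := rad_le j; have := eps_half j.
by rewrite ltr_norml; lra.
Qed.

Lemma omega_bounded x : omega x -> cbox (\row_k (-2)) (\row_k 2) x.
Proof.
have bb y : base y -> cbox (\row_k (-2)) (\row_k 2) y.
  by move=> H k; have := H k; rewrite !mxE; case: ifP => _; lra.
case=> [/bb//|[j rj tj]]; have [/(tentacle_base tj)/bb//|x0] := ltP (x ord0 ord0) 0.
move/(tentacleP _ _ (dense_pt0 j)) : tj => [H0 H] k; rewrite !mxE.
have [->|k0] := eqVneq k ord0; first by move: H0; rewrite ltr_norml; lra.
have := H k k0; have := dense_pt01 j k; have := rad_le j; have := eps_half j.
by rewrite ltr_norml; lra.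
Qed.

Lemma open_omega : open omega.
Proof.
apply: openU; first exact: open_obox.
by apply: bigcup_open => j _; exact: open_obox.
Qed.

Lemma star_connected (T : normedModType R) (U : set T) (x0 : T) :
  (forall (x : T) (t : R), U x -> 0 <= t <= 1 -> U (t *: (x - x0) + x0)) -> connected U.
Proof.
move=> H; have -> : U = \bigcup_(x in U) ((fun t : R => t *: (x - x0) + x0) @` `[0, 1]).
  apply/seteqP; split=> [x Ux|y [x Ux [t /= + <-]]].
    by exists x => //; exists 1; rewrite ?scale1r ?subrK//= in_itv/= ler01 lexx.
  by rewrite in_itv/=; exact: H.
apply: bigcup_connected.
  exists x0 => x Ux; exists 0; rewrite ?scale0r ?add0r//= in_itv/= ler01 lexx//.
move=> x Ux; apply: connected_continuous_connected; first exact: segment_connected.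
apply: continuous_subspaceT => t; apply: cvgD; last exact: cvg_cst.
by apply: cvgZr_tmp.
Qed.

Lemma connected_obox (a b : V) (x0 : V) : obox a b x0 -> connected (obox a b).
Proof.
move=> H0; apply: (@star_connected _ _ x0) => x t H /andP[t0 t1] k.
have := H0 k; have := H k; rewrite !mxE; set z := x ord0 k; set z0 := x0 ord0 k.
move=> /andP[h1 h2] /andP[h3 h4].
have -> : t * (z - z0) + z0 = t * z + (1 - t) * z0 by ring.
set l := a ord0 k in h1 h3 *; set h := b ord0 k in h2 h4 *.
have [->|tn0] := eqVneq t 0; first by rewrite mul0r add0r subr0 mul1r h3 h4.
have tp : 0 < t by rewrite lt_def tn0.
have [e1 e2] : t * l < t * z /\ t * z < t * h by rewrite !ltr_pM2l.
have [e3 e4] : (1 - t) * l <= (1 - t) * z0 /\ (1 - t) * z0 <= (1 - t) * h.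
  by split; apply: ler_wpM2l; rewrite ?subr_ge0// ltW.
have E1 : l = t * l + (1 - t) * l by ring.
have E2 : h = t * h + (1 - t) * h by ring.
by apply/andP; split; [rewrite [ltLHS]E1|rewrite [ltRHS]E2]; [exact: ltr_leD|exact: ltr_leD].
Qed.

Lemma connected_omega : connected omega.
Proof.
pose b0 : V := \row_k (if k == ord0 then - (1 / 2) else 1 / 2).
have Bb0 : base b0.
  by move=> k; rewrite !mxE; case: ifP => _; lra.
have cB : connected base by exact: connected_obox Bb0.
(* Joining every tentacle with the base gives the members of the union the common point [b0]. *)
pose F j := base `|` (if 0 < rad j then tentacle (dense_pt j) (rad j) else set0).
have -> : omega = \bigcup_(j in setT) F j.
  apply/seteqP; split=> [x [Bx|[j rj tj]]|x [j _ [Bx|]]].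
  - by exists 0%N => //; left.
  - by exists j => //; right; rewrite rj.
  - by left.
  - by case: ifP => // rj tj; right; exists j.
apply: bigcup_connected; first by exists b0 => j _; left.
move=> j _; rewrite /F; case: ifP => [rj|_]; last by rewrite setU0.
pose y : V := \row_k (if k == ord0 then - (1 / 2) else dense_pt j ord0 k).
have ty : tentacle (dense_pt j) (rad j) y.
  apply/(tentacleP _ _ (dense_pt0 j)); split; first by rewrite mxE eqxx ltr_norml; lra.
  by move=> k k0; rewrite mxE (negbTE k0) subrr normr0.
apply: connectedU => //; last exact: connected_obox ty.
by exists y; split=> //; apply: (tentacle_base ty); rewrite mxE eqxx; lra.
Qed.

(** It lies above the base, over the cube in which the centres are dense, at heights that all
    tentacles reach. *)
Definition slab : set V := cbox 0 (\row_k if k == ord0 then 1 / 2 else 1).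

(** A point [x] off the doubled tentacles is not in the domain. To see that it is a limit of
    tentacles, take a centre near [x]. If it has no tentacle, it lies in an earlier column, whose
    index is large because [x] keeps a distance from the first [J] columns; that column is thin, so
    its own centre is near [x] too. *)
Lemma slab_boundary : slab `<=`
  boundary omega `|` \bigcup_j (if 0 < rad j then tentacle2 (dense_pt j) (rad j) else set0).
Proof.
move=> x xs; have [|out] := pselect ((\bigcup_j (if 0 < rad j then tentacle2 (dense_pt j) (rad j) else set0)) x).
  by right.
left; have x0 : 0 <= x ord0 ord0 <= 1 / 2 by have := xs ord0; rewrite !mxE eqxx.
have xk k : k != ord0 -> 0 <= x ord0 k <= 1.
  by move=> k0; have := xs k; rewrite !mxE (negbTE k0).
have x02 : `|x ord0 ord0| <= 2 by rewrite ler_norml; lra.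
have outc j : 0 < rad j -> ~ column (dense_pt j) (rad j) x.
  move=> rj cj; apply: out; exists j => //; rewrite rj.
  exact: (column_tentacle2 (dense_pt0 j)).
split; last first.
  rewrite ((interior_id omega).1 open_omega) => -[bx|[j rj tj]].
    by have := bx ord0; rewrite !mxE eqxx; lra.
  apply: (outc j) => //; apply: tentacle2_column.
  by move=> k; have := tj k; rewrite !mxE; case: ifP => _; rewrite ?mulr2n; lra.
move=> W /nbhs_ballP[e /= e0 eW].
have [J HJ] : exists J, forall j, (J <= j)%N -> eps j < e / 4 by apply: eps_cvg; rewrite divr_gt0.
have nJ : ~ taken J x by move=> /takenP[i [_ ri ci]]; exact: (outc i).
have [d d0 Hd] := avoid_taken nJ.
have dmin : 0 < Num.min d (e / 4) by rewrite lt_min d0 divr_gt0.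
have [j Hj] := dense_pt_dense dmin xk.
have Hjd k : k != ord0 -> `|x ord0 k - dense_pt j ord0 k| < d /\ `|x ord0 k - dense_pt j ord0 k| < e / 4.
  by move=> /Hj; rewrite lt_min => /andP.
have [i ri Hi] : exists2 i, 0 < rad i & forall k, k != ord0 -> `|x ord0 k - dense_pt i ord0 k| < e.
  have [rj|/rad0_taken /takenP[i [ij ri ci]]] := pselect (0 < rad j).
    by exists j => // k /Hjd[_ H]; lra.
  have Ji : (J <= i)%N.
    rewrite leqNgt; apply/negP => iJ; apply: (Hd (dense_pt j)).
      by move=> k /Hjd[].
    by apply/takenP; exists i.
  exists i => // k k0; have [_ H1] := Hjd k k0; have H2 := ci k k0.
  have H3 := HJ i Ji; have H4 := rad_le i; rewrite mulr2n in H2.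
  by apply: (le_lt_trans (ler_distD (dense_pt j ord0 k) _ _)); lra.
pose y : V := \row_k (if k == ord0 then x ord0 ord0 else dense_pt i ord0 k).
exists y; split.
  right; exists i => //; apply/(tentacleP _ _ (dense_pt0 i)); split.
    by rewrite mxE eqxx ltr_norml; lra.
  by move=> k k0; rewrite mxE (negbTE k0) subrr normr0.
apply: eW; apply: rV_ball => // k; rewrite mxE.
by case: eqVneq => [->|k0]; [rewrite subrr normr0|exact: Hi].
Qed.

Lemma mu_tentacle2 c r : 0 <= r -> mu (tentacle2 c r) = (4 * (4 * r) ^+ m)%:E.
Proof.
move=> r0; rewrite /tentacle2 mu_cbox.
  rewrite big_ord_recl !mxE eqxx; congr (_%:E); congr (_ * _); first by ring.
  rewrite (eq_bigr (fun=> 4 * r)) => [|i _]; first by rewrite prodr_const card_ord.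
  by rewrite !mxE /=; ring.
by move=> k; rewrite !mxE; case: ifP => _; rewrite ?mulr2n; lra.
Qed.

Hypothesis eps_small : forall j, eps j <= (1 / 128) * (1 / 2) ^+ j.
Hypothesis m0 : (0 < m)%N.

Lemma boundary_omega : (0 < mu (boundary omega))%E.
Proof.
pose P j := if 0 < rad j then tentacle2 (dense_pt j) (rad j) else set0.
have mP j : measurable (P j) by rewrite /P; case: ifP => // _; exact: measurable_cbox.
have mB : measurable (boundary omega).
  apply: measurableD; last by apply: open_measurable_rV; exact: open_interior.
  rewrite -[closure _]setCK; apply: measurableC; apply: open_measurable_rV.
  by apply: closed_openC; exact: closed_closure.
(* As [4 * rad j <= 1] and [m >= 1], the volume is at most [16 * rad j], and 16/128 = 1/8. The total
   1/4 stays below the volume 1/2 of the slab. *)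
have mPj j : (mu (P j) <= ((1 / 8) * (1 / 2) ^+ j)%:E)%E.
  have p0 : 0 <= (1 / 2 : R) ^+ j by rewrite exprn_ge0.
  rewrite /P; case: ifP => r0; last by rewrite measure0 lee_fin mulr_ge0.
  rewrite mu_tentacle2; last exact: ltW.
  rewrite lee_fin; have := rad_le j; have := eps_small j; have := eps_half j.
  move=> h1 h2 h3; have p1 : (1 / 2 : R) ^+ j <= 1 by apply: exprn_ile1; lra.
  have : (4 * rad j) ^+ m <= (4 * rad j) ^+ 1.
    by apply: ler_wiXn2l => //; lra.
  rewrite expr1; lra.
have mU : (mu (\bigcup_j P j) <= (1 / 4)%:E)%E.
  have mUP : measurable (\bigcup_j P j) by exact: bigcup_measurable.
  apply: (le_trans (generalized_Boole_inequality mu mP mUP)).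
  apply: (@le_trans _ _ (\sum_(j <oo) ((1 / 8) * (1 / 2 : R) ^+ j)%:E)%E).
    by apply: lee_nneseries => // j _; exact: mPj.
  by apply: (le_trans (half_eseries_le _)); rewrite // lee_fin; lra.
rewrite lt_def measure_ge0 andbT; apply/eqP => B0.
have : (mu slab <= (1 / 4)%:E)%E.
  apply: (@le_trans _ _ (mu (boundary omega `|` \bigcup_j P j))).
    apply: le_measure; rewrite ?inE.
    - exact: measurable_cbox.
    - by apply: measurableU => //; exact: bigcup_measurable.
    - exact: slab_boundary.
  have mUP : measurable (\bigcup_j P j) by exact: bigcup_measurable.
  apply: (le_trans (measureU2 mu mB mUP)); rewrite -[leRHS]add0e; apply: leeD => //.
  by rewrite le_eqVlt; apply/orP; left; apply/eqP; exact: B0.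
rewrite mu_cbox; last by move=> k; rewrite !mxE; case: ifP => _; lra.
rewrite big_ord_recl !mxE eqxx; under eq_bigr do rewrite !mxE /= subr0.
rewrite big1// lee_fin; lra.
Qed.

End greedy.
End tentacles.

(** * Extension from the domain *)

Section gluing.
Context (R : realType) (n : nat).
Local Notation V := 'rV[R]_n.
Local Notation mu := (rV_lebesgue R n).
Implicit Types (f : V -> R) (p q : R) (x : V) (K : set V) (j : nat).

(** The two terms bound values above and below the threshold. This replaces Hoelder's inequality and
    leaves [th] free to be adapted to the radius. *)
Lemma powR_split_le p q (th y : R) : 0 < q -> q <= p -> 0 < th -> 0 <= y ->
  y `^ q <= th `^ (q - p) * y `^ p + th `^ q.
Proof.
move=> q0 qp th0 y0; have [yt|ty] := leP y th.
  rewrite (@le_trans _ _ (th `^ q))//.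
    by apply: ge0_ler_powR; rewrite ?nnegrE ?(ltW q0) ?(ltW th0).
  by rewrite lerDr mulr_ge0 ?powR_ge0.
have yp : 0 < y by exact: lt_trans ty.
rewrite (@le_trans _ _ (th `^ (q - p) * y `^ p))//; last by rewrite lerDl powR_ge0.
have -> : y `^ q = y `^ (q - p) * y `^ p.
  by rewrite -powRD ?subrK// (gt_eqF yp) implybT.
rewrite ler_wpM2r ?powR_ge0// -(opprB p q) !powRN lef_pV2 ?posrE ?powR_gt0//.
by apply: ge0_ler_powR; rewrite ?nnegrE ?subr_ge0 //; exact: ltW.
Qed.

Lemma energy_split p q (th : R) f K : 0 < q -> q <= p -> 0 < th -> measurable_fun setT f ->
  measurable K -> (forall x, ~ K x -> f x = 0) ->
  (energy q f <= (th `^ (q - p))%:E * energy p f + (th `^ q)%:E * mu K)%E.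
Proof.
move=> q0 qp th0 mf mK f0; have -> : mu K = (\int[mu]_x (\1_K x)%:E)%E by rewrite integral_indic// setIT.
rewrite /energy.
have Mf := measurable_powR_norm p mf.
have Pf : forall x, setT x -> (0 <= (`|f x| `^ p)%:E)%E by move=> x _; rewrite lee_fin powR_ge0.
have M1 : measurable_fun setT (fun x => (\1_K x : R)%:E) by apply/measurable_EFinP; exact: measurable_indic.
have P1 : forall x, setT x -> (0 <= (\1_K x : R)%:E)%E by move=> x _; rewrite lee_fin.
have c1 : (0 <= (th `^ (q - p))%:E)%E by rewrite lee_fin powR_ge0.
have c2 : (0 <= (th `^ q)%:E)%E by rewrite lee_fin powR_ge0.
rewrite -(ge0_integralZl mu measurableT Mf Pf c1) -(ge0_integralZl mu measurableT M1 P1 c2).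
rewrite -ge0_integralD//.
- apply: ge0_le_integral; first exact: measurableT.
  + by move=> x _; rewrite lee_fin powR_ge0.
  + exact: measurable_powR_norm.
  + by apply: emeasurable_funD; exact: measurable_funeM.
  move=> x _; rewrite -!EFinM -EFinD lee_fin indicE.
  have [xK|xK] := pselect (K x).
    by rewrite mem_set// mulr1 powR_split_le.
  by rewrite f0// normr0 powR0 ?gt_eqF// addr_ge0 ?mulr_ge0 ?powR_ge0.
- by move=> x _; rewrite mule_ge0// Pf.
- exact: measurable_funeM.
- by move=> x _; rewrite mule_ge0// P1.
- exact: measurable_funeM.
Qed.

(** The threshold is [N * lam]: scaling it with [N] makes the estimate homogeneous, so that the
    final bound is linear in the norm of [u]. *)
Lemma energy_holder p q (N lam k M : R) f K : 0 < q -> q <= p -> 0 < N -> 0 < lam ->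
  measurable_fun setT f -> measurable K -> (forall x, ~ K x -> f x = 0) ->
  (mu K <= M%:E)%E -> (energy p f <= (k * N `^ p)%:E)%E ->
  (energy q f <= (N `^ q * (k * lam `^ (q - p) + lam `^ q * M))%:E)%E.
Proof.
move=> q0 qp N0 lam0 mf mK f0 KM fk.
have t0 : 0 < N * lam by rewrite mulr_gt0.
apply: (le_trans (energy_split q0 qp t0 mf mK f0)).
have -> : N `^ q * (k * lam `^ (q - p) + lam `^ q * M) =
    (N * lam) `^ (q - p) * (k * N `^ p) + (N * lam) `^ q * M.
  rewrite !powRM ?ltW// mulrDr; congr (_ + _); last by rewrite mulrA.
  have -> : N `^ q = N `^ (q - p) * N `^ p by rewrite -powRD ?subrK// (gt_eqF N0) implybT.
  by ring.
rewrite EFinD (EFinM _ (k * _)) (EFinM _ M).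
by apply: leeD; apply: lee_wpmul2l => //; rewrite lee_fin powR_ge0.
Qed.

Lemma L1_of_energy p f K : 1 <= p -> measurable_fun setT f -> measurable K ->
  (mu K < +oo)%E -> (forall x, ~ K x -> f x = 0) -> (energy p f < +oo)%E -> L1 f.
Proof.
move=> p1 mf mK Koo f0 foo.
have := @energy_split p 1 1 f K ltr01 p1 ltr01 mf mK f0.
rewrite !powR1 !mul1e => H; apply/integrableP; split; first exact/measurable_EFinP.
have -> : (\int[mu]_x `|(EFin \o f) x|)%E = energy 1 f.
  by apply: eq_integral => x _; rewrite /= powRr1.
by apply: le_lt_trans H _; rewrite lte_add_pinfty.
Qed.

Section glue.
Variables (T : nat -> set V).
Hypothesis T_disj : forall i j x, T i x -> T j x -> i = j.

Definition piece x : nat := xget 0%N [set j | T j x].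

(* The pieces are disjoint, so this is the sum of the [F j] when each [F j]
   vanishes outside [T j]. *)
Definition glue (F : nat -> V -> R) x : R := F (piece x) x.

Lemma pieceE j x : T j x -> piece x = j.
Proof.
move=> Tx; apply: (T_disj (x := x)) => //.
by apply: (@xgetPex _ 0%N [set j | T j x]); exists j.
Qed.

Variable F : nat -> V -> R.
Hypothesis F_out : forall j x, ~ T j x -> F j x = 0.

Lemma glue_sum N x : \sum_(j < N) F j x = if (piece x < N)%N then glue F x else 0.
Proof.
have Fj j : j != piece x -> F j x = 0.
  by move=> jx; apply: F_out => /pieceE E; rewrite E eqxx in jx.
case: ifPn => [xN|Nx].
  rewrite (bigD1 (Ordinal xN))//= big1 ?addr0// => j jx.
  by apply: Fj; apply: contra jx => /eqP E; apply/eqP/val_inj.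
rewrite big1// => j _; apply: Fj; apply: contraNneq Nx => <-; exact: ltn_ord.
Qed.

Lemma glue_sum_cvg x : \sum_(j < N) F j x @[N --> \oo] --> glue F x.
Proof.
apply: (@cvg_trans _ (cst (glue F x) @ \oo)); last exact: cvg_cst.
apply: near_eq_cvg; near=> N; rewrite glue_sum /= ifT//.
by near: N; exact: nbhs_infty_gt.
Unshelve. all: by end_near. Qed.

Lemma glue_sum_le N x : `|\sum_(j < N) F j x| <= `|glue F x|.
Proof. by rewrite glue_sum; case: ifP => // _; rewrite normr0. Qed.

Hypothesis F_meas : forall j, measurable_fun setT (F j).

Lemma measurable_glue : measurable_fun setT (glue F).
Proof.
apply: (@measurable_fun_cvg _ _ _ setT (fun N x => \sum_(j < N) F j x)).
  by move=> N; apply: measurable_sum => j.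
by move=> x _; exact: glue_sum_cvg.
Qed.

Lemma glue_energy q (a : R) : 0 <= a ->
  (forall j, (energy q (F j) <= (a * (1 / 2) ^+ j)%:E)%E) ->
  (energy q (glue F) <= (2 * a)%:E)%E.
Proof.
move=> a0 Fa; apply: (@le_trans _ _ (\sum_(j <oo) energy q (F j))%E); last first.
  apply: le_trans (half_eseries_le a0); apply: lee_nneseries => j _ *; [exact: energy_ge0|exact: Fa].
rewrite /energy -integral_nneseries//; last first.
- by move=> j; exact: measurable_powR_norm.
apply: ge0_le_integral; first exact: measurableT.
- by move=> x _; rewrite lee_fin powR_ge0.
- by apply: measurable_powR_norm; exact: measurable_glue.
- apply: ge0_emeasurable_sum => [j x _ _|j _]; first by rewrite lee_fin powR_ge0.
  exact: measurable_powR_norm.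
move=> x _; apply: (@le_trans _ _ (\sum_(0 <= j < (piece x).+1) (`|F j x| `^ q)%:E)%E).
  by rewrite big_nat_recr//= leeDr// sume_ge0.
by apply: nneseries_lim_ge => j _; rewrite lee_fin powR_ge0.
Qed.

End glue.

(** Finite sums satisfy the identity by linearity. At each point a partial sum is either 0 or the
    glued value, so the glued function itself is the majorant for dominated convergence; it is
    integrable, having finite [q]-energy and vanishing off the set [K] of finite measure. *)
Lemma weak_grad0_glue (T : nat -> set V) K q a (w : nat -> V -> R) (G : nat -> 'I_n -> V -> R) :
  (forall i j x, T i x -> T j x -> i = j) -> (forall j, T j `<=` K) ->
  measurable K -> (mu K < +oo)%E -> 1 <= q -> 0 <= a ->
  (forall j, weak_grad0 setT (w j) (G j)) ->
  (forall j x, ~ T j x -> w j x = 0 /\ forall i, G j i x = 0) ->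
  (forall j, (energy q (w j) <= (a * (1 / 2) ^+ j)%:E)%E) ->
  (forall j i, (energy q (G j i) <= (a * (1 / 2) ^+ j)%:E)%E) ->
  [/\ weak_grad0 setT (glue T w) (fun i => glue T (fun j => G j i)),
    (energy q (glue T w) <= (2 * a)%:E)%E &
    forall i, (energy q (glue T (fun j => G j i)) <= (2 * a)%:E)%E].
Proof.
move=> Tdisj TK mK Koo q1 a0 wG out ew eG.
have L1F F : (forall j x, ~ T j x -> F j x = 0) -> (forall j, L1 (F j)) ->
    (forall j, (energy q (F j) <= (a * (1 / 2) ^+ j)%:E)%E) ->
    (energy q (glue T F) <= (2 * a)%:E)%E /\ L1 (glue T F).
  move=> F0 IF eF; have mF j := L1_measurable (IF j).
  have eg := glue_energy Tdisj F0 mF a0 eF; split=> //.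
  apply: (L1_of_energy q1 (measurable_glue Tdisj F0 mF) mK Koo _ (le_lt_trans eg (ltry _))).
  by move=> x Kx; apply: F0 => /TK.
have Iw j : L1 (w j) by case: (wG j).
have IG j i : L1 (G j i) by case: (wG j).
have [e1 I1] := L1F w (fun j x Tx => (out j x Tx).1) Iw ew.
have H2 i := L1F (fun j => G j i) (fun j x Tx => (out j x Tx).2 i) (IG^~ i) (eG^~ i).
split=> //; last by move=> i; exact: (H2 i).1.
split=> //; first by move=> i; exact: (H2 i).2.
- by move=> x [].
- by move=> i x [].
move=> i phi tphi; have tp := test_partial i tphi.
have lim F psi : (forall j x, ~ T j x -> F j x = 0) -> (forall j, L1 (F j)) ->
    L1 (glue T F) -> test_function setT psi ->
    \int[mu]_x ((\sum_(j < N) F j x) * psi x) @[N --> \oo] --> \int[mu]_x (glue T F x * psi x).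
  move=> F0 IF Ig tpsi; have [M M0 HM] := test_bounded tpsi.
  apply: (@Rint_dominated _ _ _ _ (cst M * (fun x => `|glue T F x|))).
  - move=> N; apply: measurable_funM; last exact: test_measurable tpsi.
    by apply: measurable_sum => j; exact: L1_measurable.
  - move=> x; apply: cvgM; last exact: cvg_cst.
    exact: glue_sum_cvg.
  - by apply: L1Z; exact: L1_norm.
  - move=> N x; rewrite normrM !fctE mulrC.
    by apply: ler_pM => //; exact: glue_sum_le.
have sumI F psi N : (forall j, L1 (F j)) -> test_function setT psi ->
    \int[mu]_x ((\sum_(j < N) F j x) * psi x) = \sum_(j < N) \int[mu]_x (F j x * psi x).
  move=> IF tpsi; elim: N => [|N IH].
    rewrite big_ord0; under eq_Rintegral do rewrite big_ord0 mul0r.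
    by rewrite /Rintegral integral0.
  rewrite big_ord_recr/= -IH.
  have LS : L1 (fun x => \sum_(j < N) F j x).
    elim: (N) => [|k IHk].
      under eq_fun do rewrite big_ord0.
      exact: integrable0.
    under eq_fun do rewrite big_ord_recr/=.
    exact: L1D.
  rewrite -RintD; [|exact: L1_test LS tpsi|exact: L1_test (IF N) tpsi].
  by apply: eq_Rintegral => x _; rewrite big_ord_recr/= mulrDl.
have c1 := lim w _ (fun j x Tx => (out j x Tx).1) Iw I1 tp.
have c2 := lim (fun j => G j i) _ (fun j x Tx => (out j x Tx).2 i) (IG^~ i) (H2 i).2 tphi.
move: c1; under eq_fun do rewrite (sumI _ _ _ Iw tp).
have EQ N : \sum_(j < N) \int[mu]_x (w j x * partial i phi x) =
    - \int[mu]_x ((\sum_(j < N) G j i x) * phi x).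
  rewrite (sumI (fun j => G j i) _ _ (IG^~ i) tphi) -sumrN; apply: eq_bigr => j _.
  by case: (wG j) => _ _ _ _; apply.
under eq_fun do rewrite EQ.
move=> /(cvg_lim (@Rhausdorff R)) <-.
exact: (cvg_lim (@Rhausdorff R) (cvgN c2)).
Qed.

End gluing.

Lemma weak_gradient_weak_grad0 (R : realType) (n : nat) (D : set 'rV[R]_n) p u g (N : R) :
  open D -> (rV_lebesgue R n D < +oo)%E -> 1 <= p -> weak_gradient D u g ->
  (energy p (u \_ D) <= N%:E)%E -> (forall i, energy p ((fun x => g x ord0 i) \_ D) <= N%:E)%E ->
  weak_grad0 D (u \_ D) (fun i => (fun x => g x ord0 i) \_ D).
Proof.
move=> oD Doo p1 [[mu_ _] lg H] uN gN; have mD := open_measurable_rV oD.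
have out (f : 'rV[R]_n -> R) x : ~ D x -> (f \_ D) x = 0 by move=> Dx; rewrite patchE memNset.
have I (f : 'rV[R]_n -> R) : measurable_fun D f -> (energy p (f \_ D) <= N%:E)%E -> L1 (f \_ D).
  move=> mf fN; apply: (L1_of_energy p1 _ mD Doo (out f) (le_lt_trans fN (ltry _))).
  exact/(measurable_restrictT f mD).
split.
- exact: I.
- by move=> i; apply: I => //; have [] := lg i.
- exact: out.
- by move=> i; exact: out.
move=> i phi tphi; have := H i phi tphi.
have E (f psi : 'rV[R]_n -> R) : \int[rV_lebesgue R n]_x ((f \_ D) x * psi x) =
    \int[rV_lebesgue R n]_(x in D) (f x * psi x).
  rewrite [RHS]Rintegral_mkcond; apply: eq_Rintegral => x _; rewrite !patchE.
  by case: ifP => // _; rewrite mul0r.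
by rewrite !E.
Qed.

Lemma energy_restrict (R : realType) (n : nat) (D : set 'rV[R]_n) s (f : 'rV[R]_n -> R) :
  0 <= s -> measurable D -> measurable_fun setT f -> (energy s (f \_ D) <= energy s f)%E.
Proof.
move=> s0 mD mf; apply: energy_le => //.
  by apply/(measurable_restrictT f mD); exact: measurable_funTS.
by move=> x; rewrite patchE; case: ifP => // _; rewrite normr0.
Qed.

(** * Choice of the exponent and of the radii *)

Section exponents.
Variables (R : realType) (m : nat) (q : R).
Hypothesis q1 : 1 <= q.
Hypothesis qm : q < m%:R.

Let delta : R := m%:R - q.
Let alpha : R := delta / (2 * q).

(** It solves [alpha * (p - q) = 2 * q]. With threshold [r^-alpha] and loss [r^-q], the term with
    [p] becomes [r^(-q + 2q) = r^q]; since [alpha * q = delta / 2], the volume term becomes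
    [r^(m - q - delta / 2) = r^(delta / 2)]. *)
Definition exponent : R := q + 4 * q ^+ 2 / delta.

(** The first entry keeps the volume of the doubled tentacles small and yields [r^q <= 2^-j], the
    second yields [r^(delta / 2) <= 2^-j]. *)
Definition radius_bound (j : nat) : R :=
  Num.min ((1 / 128) * (1 / 2) ^+ j) (((1 / 2) ^+ j) `^ (2 / delta)).

Let q0 : 0 < q. Proof. exact: lt_le_trans q1. Qed.
Let delta0 : 0 < delta. Proof. by rewrite subr_gt0. Qed.

Lemma exponent_gt : q < exponent.
Proof. by rewrite /exponent ltrDl divr_gt0// mulr_gt0// exprn_gt0. Qed.

Lemma radius_bound_gt0 j : 0 < radius_bound j.
Proof.
have p0 : 0 < (1 / 2 : R) ^+ j by rewrite exprn_gt0.
by rewrite lt_min powR_gt0// andbT mulr_gt0.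
Qed.

Lemma radius_bound_le j : radius_bound j <= (1 / 128) * (1 / 2) ^+ j.
Proof. by rewrite ge_min lexx. Qed.

Lemma radius_bound_half j : radius_bound j <= 1 / 2.
Proof.
have p1 : (1 / 2 : R) ^+ j <= 1 by apply: exprn_ile1; lra.
by have := radius_bound_le j; lra.
Qed.

Lemma radius_bound_cvg (e : R) : 0 < e -> exists J, forall j, (J <= j)%N -> radius_bound j < e.
Proof.
move=> e0; exists (Num.truncn e^-1) => j Jj; apply: (le_lt_trans (radius_bound_le j)).
have H : e^-1 < j.+1%:R.
  by apply: (lt_le_trans (truncnS_gt _)); rewrite ler_nat ltnS.
have H2 : j.+1%:R <= 2 ^+ j :> R by rewrite -natrX ler_nat ltn_expl.
have : (1 / 2) ^+ j < e.
  rewrite mul1r exprVn -[ltRHS]invrK ltf_pV2 ?posrE ?invr_gt0 ?exprn_gt0//.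
  exact: lt_le_trans H2.
have : 0 < (1 / 2 : R) ^+ j by rewrite exprn_gt0.
lra.
Qed.

(* The choice of the exponent: Hoelder's inequality with threshold [r^-alpha]
   gains more than the factor [r^-q] lost in the gradient of a cutoff. *)
Lemma tentacle_decay j r k : 0 < r -> r <= radius_bound j -> 0 <= k ->
  r^-1 `^ q * (k * (r `^ - alpha) `^ (q - exponent) + (r `^ - alpha) `^ q * (4 * (4 * r) ^+ m))
  <= (k + 4 * 4 ^+ m) * (1 / 2) ^+ j.
Proof.
move=> r0 rj k0; have p1 : (1 / 2 : R) ^+ j <= 1 by apply: exprn_ile1; lra.
have p0 : 0 < (1 / 2 : R) ^+ j by rewrite exprn_gt0.
have rle := le_trans rj (radius_bound_le j).
have r1 : r <= 1 by lra.
have P a b : r `^ a * r `^ b = r `^ (a + b) by rewrite powRD// (gt_eqF r0) implybT.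
have E1 : r^-1 `^ q * (r `^ - alpha) `^ (q - exponent) = r `^ q.
  rewrite -powRrM -(powR_inv1 (ltW r0)) -powRrM P; congr (_ `^ _).
  rewrite /exponent /alpha; field.
  by rewrite (gt_eqF q0) gt_eqF.
have E2 : r^-1 `^ q * ((r `^ - alpha) `^ q * r ^+ m) = r `^ (delta / 2).
  rewrite -powRrM -(powR_inv1 (ltW r0)) -powRrM -(powR_mulrn _ (ltW r0)) !P; congr (_ `^ _).
  rewrite /alpha /delta; field.
  by rewrite (gt_eqF q0).
have L1 : r `^ q <= (1 / 2) ^+ j.
  apply: (@le_trans _ _ (r `^ 1)); first by apply: ger_powR => //; rewrite r0 r1.
  by rewrite powRr1 ?ltW//; lra.
have L2 : r `^ (delta / 2) <= (1 / 2) ^+ j.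
  have -> : (1 / 2) ^+ j = (((1 / 2) ^+ j) `^ (2 / delta)) `^ (delta / 2) :> R.
    rewrite -powRrM (_ : 2 / delta * (delta / 2) = 1) ?powRr1 ?ltW//.
    by field; rewrite gt_eqF.
  apply: ge0_ler_powR; rewrite ?nnegrE ?powR_ge0 ?(ltW r0)//.
    by rewrite divr_ge0// ltW.
  by apply: (le_trans rj); rewrite ge_min lexx orbT.
have -> : r^-1 `^ q * (k * (r `^ - alpha) `^ (q - exponent) + (r `^ - alpha) `^ q * (4 * (4 * r) ^+ m)) =
    k * (r^-1 `^ q * (r `^ - alpha) `^ (q - exponent)) +
    4 * 4 ^+ m * (r^-1 `^ q * ((r `^ - alpha) `^ q * r ^+ m)).
  by rewrite exprMn; ring.
rewrite E1 E2 [leRHS]mulrDl; apply: lerD; first exact: ler_wpM2l.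
by apply: ler_wpM2l => //; rewrite mulr_ge0// exprn_ge0.
Qed.

End exponents.

(** * Extension of the jump from one tentacle *)

Section tentacle_extension.
Variables (R : realType) (m : nat) (q : R).
Hypothesis q1 : 1 <= q.
Hypothesis qm : q < m%:R.

Local Notation V := 'rV[R]_m.+1.
Local Notation mu := (rV_lebesgue R m.+1).
Local Notation p := (exponent m q).
Local Notation eps := (radius_bound m q).
Local Notation rad := (@rad R m eps).
Local Notation dense_pt := (@dense_pt R m).
Local Notation Omega := (@omega R m eps).
Local Notation base := (@base R m).

Let q0 : 0 < q. Proof. exact: lt_le_trans q1. Qed.
Let qp : q < p. Proof. exact: exponent_gt q1 qm. Qed.
Let p0 : 0 < p. Proof. exact: lt_trans qp. Qed.
Let eps_half j : eps j <= 1 / 2. Proof. exact: radius_bound_half. Qed.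

Definition tube (j : nat) : set V := tentacle (dense_pt j) (rad j).
Definition tube2 (j : nat) : set V := if 0 < rad j then tentacle2 (dense_pt j) (rad j) else set0.

Lemma tube2_disj i j (x : V) : tube2 i x -> tube2 j x -> i = j.
Proof.
rewrite /tube2; case: ifP => // ri; case: ifP => // rj /tentacle2_column ci /tentacle2_column cj.
exact: columns_disjoint ri rj ci cj.
Qed.

Lemma tube2_bounded j : tube2 j `<=` cbox (\row_k (-2)) (\row_k 2).
Proof.
rewrite /tube2; case: ifPn => [rj|_] x xt k; last by [].
have := xt k; rewrite !mxE ?mulr2n.
have [->|k0] := eqVneq k ord0.
  by rewrite dense_pt0; lra.
have := dense_pt01 R j k; have := rad_le m (radius_bound_gt0 m q) j; have := eps_half j; lra.
Qed.

Lemma tube_tube2 j : 0 < rad j -> tube j `<=` tube2 j.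
Proof.
move=> rj x xt; rewrite /tube2 rj => k; have := xt k; rewrite !mxE ?mulr2n.
by case: ifP => _; lra.
Qed.

Lemma measurable_tube j : measurable (tube j).
Proof. exact: measurable_obox. Qed.

(* [ut] is the part already extended from the base; the jump [u0 - ut] is
   extended from each tentacle to its double. *)
Lemma tube_extension (C : R -> R) (k N : R) (u0 ut : V -> R) (g0 gt : 'I_m.+1 -> V -> R) (j : nat) :
  (forall s, 0 <= C s) ->
  @extends_boxes R m.+1 C ->
  0 < N -> 0 <= k -> weak_grad0 Omega u0 g0 -> weak_grad0 setT ut gt ->
  (forall x : V, base x -> ut x = u0 x) ->
  (forall D, measurable D -> energy p ((u0 \_ D) + cst (-1) * (ut \_ D))%R <= (k * N `^ p)%:E)%E ->
  (forall D i, measurable D -> energy p ((g0 i \_ D) + cst (-1) * (gt i \_ D))%R <= (k * N `^ p)%:E)%E ->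
  exists w G, [/\ weak_grad0 setT w G,
    0 < rad j -> forall x, tube j x -> w x = u0 x - ut x,
    forall x, ~ tube2 j x -> w x = 0 /\ forall i, G i x = 0,
    forall x : V, -1 < x ord0 ord0 < 0 -> w x = 0 &
    (energy q w <= (2 * C q * (N `^ q * (k + 4 * 4 ^+ m)) * (1 / 2) ^+ j)%:E)%E /\
    forall i, (energy q (G i) <= (2 * C q * (N `^ q * (k + 4 * 4 ^+ m)) * (1 / 2) ^+ j)%:E)%E].
Proof.
move=> C0 ext N0 k0 Wu0 Wut utu0 eu eg; pose a := (N `^ q * (k + 4 * 4 ^+ m)) * (1 / 2) ^+ j.
have a0 : 0 <= a by rewrite !mulr_ge0 ?powR_ge0 ?addr_ge0 ?mulr_ge0 ?exprn_ge0.
(* One [a] for the gradient of the jump, one for the jump multiplied by the cutoff loss. *)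
have aE : 2 * C q * (N `^ q * (k + 4 * 4 ^+ m)) * (1 / 2) ^+ j = C q * (a + a) by rewrite /a; ring.
rewrite aE; have [rj|rj] := pselect (0 < rad j); last first.
  exists (cst 0), (fun=> cst 0).
  have L0 : L1 (cst 0 : V -> R) by exact: integrable0.
  have e0 : (energy q (cst 0%R : V -> R) <= (C q * (a + a))%:E)%E.
    rewrite /energy integral0_eq ?lee_fin ?mulr_ge0 ?addr_ge0// => x _.
    by rewrite normr0 powR0// gt_eqF.
  split=> //; split=> // i phi _.
  by rewrite /Rintegral !integral0_eq ?oppr0// => x _; rewrite mul0r.
set r := rad j in rj *; set c := dense_pt j; pose rho : V := radii m r.
have reps : r <= eps j := rad_le m (radius_bound_gt0 m q) j.
have rhalf : r <= 1 / 2 := le_trans reps (eps_half j).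
have rrho i : r <= rho ord0 i by rewrite radiiE; case: ifP => _ //; lra.
have mD := measurable_tube j.
have tO : tube j `<=` Omega by move=> x tx; right; exists j.
have W1 := weak_grad0_lin (-1) (weak_grad0_restrict mD tO Wu0)
  (weak_grad0_restrict mD (@subsetT _ _) Wut).
set v := (_ + _) in W1; set h := (fun i => _) in W1.
have [w [G [WG wv out V0 ew]]] := ext c rho r rj rrho v h W1.
have [Iv Ih v_out h_out _] := W1.
have tt2 : tube j `<=` tentacle2 c r by have := @tube_tube2 j rj; rewrite /tube2 rj.
have r0inv : 1 <= r^-1 `^ q.
  have E : 1 = 1 `^ q :> R by rewrite powR1.
  rewrite [leLHS]E; apply: ge0_ler_powR; rewrite ?nnegrE ?invr_ge0 ?(ltW rj) ?(ltW q0)//.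
  by rewrite invf_ge1//; lra.
(* The threshold for which [tentacle_decay] is stated. *)
pose lam := r `^ - ((m%:R - q) / (2 * q)).
have lam0 : 0 < lam by rewrite powR_gt0.
pose S := k * lam `^ (q - p) + lam `^ q * (4 * (4 * r) ^+ m).
have S0 : 0 <= S.
  rewrite addr_ge0 ?mulr_ge0 ?powR_ge0// exprn_ge0// mulr_ge0//; exact: ltW.
have mt : (mu (tentacle2 c r) <= (4 * (4 * r) ^+ m)%:E)%E by rewrite mu_tentacle2; [exact: lexx|exact: ltW].
have eS f : L1 f -> (forall x, ~ tube j x -> f x = 0) -> (energy p f <= (k * N `^ p)%:E)%E ->
    (energy q f <= (N `^ q * S)%:E)%E.
  move=> If fout fN; apply: (@energy_holder _ _ p q N lam k _ f (tentacle2 c r) q0 (ltW qp) N0 lam0) => //.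
  - exact: L1_measurable.
  - exact: measurable_cbox.
  - by move=> x tx; apply: fout => /tt2.
have rS : r^-1 `^ q * (N `^ q * S) <= a.
  rewrite mulrCA /a -mulrA ler_wpM2l ?powR_ge0//.
  exact: tentacle_decay.
have Sa : N `^ q * S <= a.
  by apply: le_trans rS; rewrite ler_peMl// mulr_ge0 ?powR_ge0.
have ev : (energy q v <= (N `^ q * S)%:E)%E by apply: eS => //; exact: eu.
have eh i : (energy q (h i) <= (N `^ q * S)%:E)%E.
  by apply: eS => //; [exact: h_out|exact: eg].
exists w, G; split=> //.
- move=> _ x tx; rewrite wv// /v !fctE !patchE mem_set// mulN1r//.
- by move=> x; rewrite /tube2 rj; exact: out.
- move=> x x0; apply: (V0 ord0 (x ord0 ord0)) => //.
    by rewrite /c dense_pt0 radiiE eqxx; lra.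
  move=> y yx; rewrite /v !fctE !patchE; case: ifPn => [/set_mem ty|_]; last by rewrite mulr0 addr0.
  rewrite utu0 ?mulN1r ?subrr//.
  apply: (tentacle_base (radius_bound_gt0 m q) eps_half ty); rewrite yx; lra.
have [ew1 ew2] := ew q (ltW q0).
split=> [|i].
  apply: (le_trans ew1); rewrite EFinM; apply: lee_wpmul2l; first by rewrite lee_fin.
  apply: (le_trans ev); rewrite lee_fin; lra.
apply: (le_trans (ew2 i)); rewrite EFinM; apply: lee_wpmul2l; first by rewrite lee_fin.
rewrite EFinD; apply: leeD; first by apply: (le_trans (eh i)); rewrite lee_fin.
apply: (@le_trans _ _ ((r^-1 `^ q)%:E * (N `^ q * S)%:E)%E); last by rewrite -EFinM lee_fin.
by apply: lee_wpmul2l; first by rewrite lee_fin powR_ge0.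
Qed.

End tentacle_extension.

(** * Extension from the whole domain *)

Section omega_extension.
Variables (R : realType) (m : nat) (q : R).
Hypothesis q1 : 1 <= q.
Hypothesis qm : q < m%:R.

Local Notation V := 'rV[R]_m.+1.
Local Notation mu := (rV_lebesgue R m.+1).
Local Notation p := (exponent m q).
Local Notation eps := (radius_bound m q).
Local Notation Omega := (@omega R m eps).
Local Notation base := (@base R m).

Let q0 : 0 < q. Proof. exact: lt_le_trans q1. Qed.
Let qp : q < p. Proof. exact: exponent_gt q1 qm. Qed.
Let p0 : 0 < p. Proof. exact: lt_trans qp. Qed.

Definition base_center : V := \row_k if k == ord0 then - (1 / 2) else 1 / 2.
Definition base_radii : V := \row_k if k == ord0 then 1 / 2 else 3 / 2.

Lemma baseE : base = obox (base_center - base_radii) (base_center + base_radii).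
Proof.
rewrite /base; congr obox; apply/rowP => k; rewrite !mxE; case: ifP => _; lra.
Qed.

Lemma omega_extension : exists2 C : R, 0 < C & forall u g (N : R), 0 < N ->
  weak_gradient Omega u g -> (energy p (u \_ Omega) <= (N `^ p)%:E)%E ->
  (forall i, (energy p ((fun x => g x ord0 i) \_ Omega) <= (N `^ p)%:E)%E) ->
  exists w, [/\ sobolev_space setT q w, forall x, Omega x -> w x = u x &
    (sobolev_norm setT q w <= (C * N)%:E)%E].
Proof.
have [CE CE0 ext] := @box_extension R m.+1.
pose box : set V := cbox (\row_k (-2)) (\row_k 2).
have mbox : measurable box by exact: measurable_cbox.
have boxoo : (mu box < +oo)%E by exact: mu_cbox_fin.
have Ooo : (mu Omega < +oo)%E.
  apply: le_lt_trans boxoo; apply: le_measure; rewrite ?inE//.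
    by apply: open_measurable_rV; exact: open_omega.
  move=> x; exact: (omega_bounded (radius_bound_gt0 m q) (radius_bound_half m q)).
pose Kb := cbox (base_center - base_radii *+ 2) (base_center + base_radii *+ 2).
have mKb : measurable Kb by exact: measurable_cbox.
pose M := fine (mu Kb).
have ME : (mu Kb <= M%:E)%E.
  by rewrite fineK// ge0_fin_numE//; exact: mu_cbox_fin.
have M0 : 0 <= M by rewrite fine_ge0.
pose h2 : R := (1 / 2)^-1 `^ p.
have h20 : 0 <= h2 by exact: powR_ge0.
(* In units of the norm of [u], [k1] bounds the [p]-energy of the extension from the base, whose
   least half-width is 1/2, [k2] that of a jump, and [k3] the [q]-energy of the final extension. *)
pose k1 := CE p * (1 + h2).
have k10 : 0 <= k1 by rewrite mulr_ge0// addr_ge0.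
pose k2 := 2 `^ p * (1 + k1).
have k20 : 0 <= k2 by rewrite mulr_ge0 ?powR_ge0// addr_ge0.
pose k3 := 2 `^ q * (k1 + M + 4 * CE q * (k2 + 4 * 4 ^+ m)).
have k30 : 0 <= k3.
  apply: mulr_ge0; first exact: powR_ge0.
  by rewrite !addr_ge0// !mulr_ge0// addr_ge0// mulr_ge0// exprn_ge0.
have sc0 : 0 <= sobolev_const m.+1 q by rewrite addr_ge0// powR_ge0.
(* The summand 1 only makes the constant positive. *)
exists (sobolev_const m.+1 q * k3 `^ q^-1 + 1).
  by rewrite ltr_wpDl// mulr_ge0// powR_ge0.
move=> u g N N0 ug uN gN; have Np0 : 0 <= N `^ p by exact: powR_ge0.
have p1 : 1 <= p := le_trans q1 (ltW qp).
have W0 := weak_gradient_weak_grad0 (@open_omega R m eps) Ooo p1 ug uN gN.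
set u0 := u \_ Omega in W0 uN; set g0 := (fun i => _) in W0.
have [I0 Ig0 _ _ _] := W0.
have bO : base `<=` Omega by move=> x; left.
have mb : measurable base by exact: measurable_obox.
have Wb := weak_grad0_restrict mb bO W0.
have rb k : 1 / 2 <= base_radii ord0 k :> R by rewrite mxE; case: ifP => _; lra.
have half0 : 0 < 1 / 2 :> R by lra.
rewrite {1}baseE in Wb.
have [ut [gt [Wt utb t_out _ et]]] := ext base_center base_radii (1 / 2) half0 rb _ _ Wb.
have [It Igt _ _ _] := Wt.
rewrite -baseE in utb.
have utu0 x : base x -> ut x = u0 x by move=> bx; rewrite utb// patchE mem_set.
have [et1 et2] := et p (ltW p0).
have eub : (energy p (u0 \_ base) <= (N `^ p)%:E)%E.
  exact: le_trans (energy_restrict (ltW p0) mb (L1_measurable I0)) uN.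
have egb i : (energy p (g0 i \_ base) <= (N `^ p)%:E)%E.
  exact: le_trans (energy_restrict (ltW p0) mb (L1_measurable (Ig0 i))) (gN i).
have eut : (energy p ut <= (k1 * N `^ p)%:E)%E.
  apply: (le_trans et1); apply: (@le_trans _ _ ((CE p)%:E * (N `^ p)%:E)%E).
    by apply: lee_wpmul2l; rewrite ?lee_fin.
  by rewrite -EFinM lee_fin ler_wpM2r// ler_peMr// lerDl.
have egt i : (energy p (gt i) <= (k1 * N `^ p)%:E)%E.
  apply: (le_trans (et2 i)).
  apply: (@le_trans _ _ ((CE p)%:E * ((N `^ p)%:E + h2%:E * (N `^ p)%:E))%E).
    apply: lee_wpmul2l; first by rewrite lee_fin.
    by apply: leeD; [exact: egb|apply: lee_wpmul2l; rewrite ?lee_fin].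
  by rewrite -(EFinM h2) -(EFinD (N `^ p)) -EFinM lee_fin /k1 -mulrA mulrDl mul1r.
have mixed (f1 f2 : V -> R) D : measurable D -> L1 f1 -> L1 f2 ->
    (energy p f1 <= (N `^ p)%:E)%E -> (energy p f2 <= (k1 * N `^ p)%:E)%E ->
    (energy p ((f1 \_ D) + cst (-1) * (f2 \_ D))%R <= (k2 * N `^ p)%:E)%E.
  move=> mD I1 I2 e1 e2.
  have r1 := L1_restrict mD I1; have r2 := L1_restrict mD I2.
  apply: (le_trans (energyD (ltW p0) (L1_measurable r1) (L1_measurable (L1Z (-1) r2)))).
  rewrite energyZ; last exact: L1_measurable.
  rewrite normrN normr1 powR1 mul1e /k2 -mulrA EFinM; apply: lee_wpmul2l.
    by rewrite lee_fin powR_ge0.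
  rewrite mulrDl mul1r EFinD; apply: leeD.
    exact: le_trans (energy_restrict (ltW p0) mD (L1_measurable I1)) e1.
  exact: le_trans (energy_restrict (ltW p0) mD (L1_measurable I2)) e2.
have tubes j := tube_extension q1 qm j CE0 ext N0 k20 W0 Wt utu0
  (fun D mD => mixed u0 ut D mD I0 It uN eut)
  (fun D i mD => mixed (g0 i) (gt i) D mD (Ig0 i) (Igt i) (gN i) (egt i)).
have [w0 Hw0] := choice tubes.
have [G0 HwG] := choice Hw0.
pose a := 2 * CE q * (N `^ q * (k2 + 4 * 4 ^+ m)).
have a0 : 0 <= a.
  by rewrite !mulr_ge0 ?powR_ge0// addr_ge0// mulr_ge0// exprn_ge0.
have [||||W1 ew1 eG1] := @weak_grad0_glue R m.+1 (@tube2 R m q) box q a w0 G0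
  (@tube2_disj R m q) (@tube2_bounded R m q) mbox boxoo q1 a0.
- by move=> j; have [] := HwG j.
- by move=> j x; have [_ _ + _ _] := HwG j; apply.
- by move=> j; have [_ _ _ _ []] := HwG j.
- by move=> j i; have [_ _ _ _ [_]] := HwG j; apply.
have W2 := weak_grad0_lin 1 Wt W1.
set w := ut + _ in W2; set G := (fun i => _) in W2.
have [I1 IG1 _ _ _] := W1.
have total (f1 f2 : V -> R) : L1 f1 -> L1 f2 -> (forall x, ~ Kb x -> f1 x = 0) ->
    (energy p f1 <= (k1 * N `^ p)%:E)%E -> (energy q f2 <= (2 * a)%:E)%E ->
    (energy q (f1 + cst 1 * f2)%R <= (k3 * N `^ q)%:E)%E.
  move=> If1 If2 f1_out e1 e2.
  apply: (le_trans (energyD (ltW q0) (L1_measurable If1) (L1_measurable (L1Z 1 If2)))).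
  rewrite energyZ; last exact: L1_measurable.
  rewrite normr1 powR1 mul1e /k3 -mulrA EFinM; apply: lee_wpmul2l.
    by rewrite lee_fin powR_ge0.
  (* The base has a fixed size, so the ratio [lam = 1] will do. *)
  have H := energy_holder q0 (ltW qp) N0 ltr01 (L1_measurable If1) mKb f1_out ME e1.
  apply: (le_trans (leeD H e2)); rewrite -EFinD lee_fin !powR1 /a.
  by rewrite le_eqVlt; apply/orP; left; apply/eqP; ring.
have ew : (energy q w <= (k3 * N `^ q)%:E)%E.
  by apply: total => // x /t_out[].
have eG i : (energy q (G i) <= (k3 * N `^ q)%:E)%E.
  apply: (total _ _ (Igt i) (IG1 i) _ (egt i) (eG1 i)).
  by move=> x /t_out[_ ->].
have k3N : 0 <= k3 * N `^ q by rewrite mulr_ge0// powR_ge0.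
have [Sw wN] := sobolev_norm_le q0 k3N W2 ew eG.
exists w; split=> //; last first.
  apply: (le_trans wN); rewrite lee_fin powRM ?powR_ge0// -powRrM divff ?gt_eqF//.
  rewrite powRr1 ?mulrA; last exact: ltW.
  apply: ler_wpM2r; [exact: ltW|by rewrite lerDl].
move=> x Ox; have u0x : u0 x = u x by rewrite /u0 patchE mem_set.
(* In the base every correction vanishes, including the one that [piece] returns by default off all
   doubled tentacles. On the [j]-th tentacle only the [j]-th correction counts, and it turns [ut]
   into [u]. *)
rewrite /w !fctE mul1r; case: (Ox) => [bx|[j rj tj]].
  rewrite utu0// u0x /glue; have [_ _ _ H _] := HwG (piece (@tube2 R m q) x).
  rewrite H ?addr0//.
  by have := bx ord0; rewrite !mxE eqxx.
rewrite /glue (pieceE (@tube2_disj R m q) (tube_tube2 rj tj)).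
have [_ H _ _ _] := HwG j; rewrite (H rj x tj) u0x; ring.
Qed.

End omega_extension.

Unset Implicit Arguments.

Theorem theorem1p7 (R : realType) (n : nat) (q : R)
    (hn : (3 <= n)%N) (hq : 1 <= q) (hqn : q < n%:R - 1) :
  exists p : R, q < p /\
    exists Omega : set 'rV[R]_n,
      sobolev_extension_domain p q Omega /\
      (0 < rV_lebesgue R n (boundary Omega))%E.
Proof.
case: n hn hqn => [//|m] hm hqn.
have qm : q < m%:R by move: hqn; rewrite -natr1; lra.
exists (exponent m q); split; first exact: exponent_gt.
exists (omega (radius_bound m q)); split; last first.
  apply: boundary_omega.
  - exact: radius_bound_gt0.
  - exact: radius_bound_half.
  - exact: radius_bound_cvg.
  - exact: radius_bound_le.
  - by case: m hm {hqn qm}.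
have [C C0 HC] := omega_extension hq qm.
apply: (extension_domain_of_bound _ _ C0 HC).
  by rewrite hq ltW// exponent_gt.
split.
- exact: open_omega.
- by apply: connected_omega; [exact: radius_bound_gt0|exact: radius_bound_half].
- exists (base_center R m); left; rewrite baseE => k; rewrite !mxE.
  by case: ifP => _; lra.
- have := compact_bounded (@compact_cbox R m.+1 (\row_k (-2)) (\row_k 2)).
  rewrite /bounded_set /bounded_near; apply: filterS => M HM x Ox; apply: HM.
  exact: (omega_bounded (radius_bound_gt0 m q) (radius_bound_half m q) Ox).
Qed.
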